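(* Let $Q^{(k_0)}$ be a proper geometric structure of order $k_0$ and let $\gamma=\kappa+\tau+\sigma$ be the structure function of its $W$-normal complete step prolongation $\mathcal S_WQ^{(k_0)}$, with values in $\mathrm{Hom}(\wedge^2\mathfrak g,\mathfrak g)$. Let $\gamma_d$, $\kappa_d$, $\tau_d$, $\sigma_d$ denote the parts of homogeneous degree $d$. Then: (1) For $X\in\mathfrak g_x$, $Y\in\mathfrak g_y$, $Z\in\mathfrak g_z$ with $x,y,z<0$, and every integer $k\ge0$, $$(\partial\kappa_k)(X,Y,Z)=\mathfrak S_{X,Y,Z}\Big\{\sum_{\substack{d_1+d_2=k\\ d_1,d_2>0}}\big\{\kappa_{d_1}(\kappa_{d_2}(X,Y)_-,Z)+\tau_{d_1}(\kappa_{d_2}(X,Y)_+,Z)\big\}-D_X\kappa_{k+x}(Y,Z)\Big\}.$$ (2) For $X\in\mathfrak g_x$, $Y\in\mathfrak g_y$, $A\in\mathfrak g_a$ with $x,y<0$, $a\ge0$, and every integer $d\ge0$, $$\begin{aligned}\big(\partial(\tau_d(A,\cdot))\big)(X,Y)={}&(D_A\kappa_{d+a}+\rho(A)\kappa_d)(X,Y)-\mathscr A_{X,Y}\tau_d([A,X]_+,Y)+[\kappa_d(X,Y)_+,A]-\sigma_0(\kappa_d(X,Y)_+,A)\\&-\sum_{\substack{\delta_1+\delta_2=d\\ -a\le\delta_1<d,\ \delta_1\ne0\\ 0<\delta_2\le d+a}}\big\{\tau_{\delta_1}(\kappa_{\delta_2}(X,Y)_-,A)+\sigma_{\delta_1}(\kappa_{\delta_2}(X,Y)_+,A)\big\}\\&-\mathscr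 A_{X,Y}\sum_{\substack{d_1+d_2=d\\ d_1,d_2>0}}\big\{\kappa_{d_1}(\tau_{d_2}(A,X)_-,Y)+\tau_{d_1}(\tau_{d_2}(A,X)_+,Y)\big\}+\mathscr A_{X,Y}D_Y\tau_{d+y}(A,X).\end{aligned}$$ (3) For $A\in\mathfrak g_a$, $B\in\mathfrak g_b$, $X\in\mathfrak g_x$ with $a,b\ge0$, $x<0$, and every integer $d$, $$\begin{aligned}[\sigma_d(A,B),X]={}&\mathscr A_{A,B}\sum_{\substack{d_1+d_2=d\\0\le d_2\le d+a}}\big\{\sigma_{d_1}(A,\tau_{d_2}(B,X)_+)+\tau_{d_1}(A,\tau_{d_2}(B,X)_-)\big\}\\&+\sum_{\substack{\delta_1+\delta_2=d\\0<\delta_1\le d+\min(a,b)}}\tau_{\delta_1}(X,\sigma_{\delta_2}(A,B))+D_X\sigma_{d+x}(A,B)+\mathscr A_{A,B}D_A\tau_{d+a}(B,X).\end{aligned}$$ (4) For $A\in\mathfrak g_a$, $B\in\mathfrak g_b$, $C\in\mathfrak g_c$ with $a,b,c\ge0$, and every integer $d$, $$\mathfrak S_{A,B,C}\Big\{\sum_{\substack{d_1+d_2=d\\-\min\{a,b\}\le d_2\le d+c}}\sigma_{d_1}(\sigma_{d_2}(A,B),C)-D_C\sigma_{d+c}(A,B)\Big\}=0.$$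
   Context: Notation of the identities. $\kappa,\tau,\sigma$ are the restrictions of $\gamma$ to $\wedge^2\mathfrak g_-$, $\mathfrak g_+\wedge\mathfrak g_-$, $\wedge^2\mathfrak g_+$, where $\mathfrak g_-=\bigoplus_{p<0}\mathfrak g_p$, $\mathfrak g_+=\bigoplus_{p\ge0}\mathfrak g_p$ (completed). For $U,V$ with one argument in $\mathfrak g_+$ and one in $\mathfrak g_-$, $\tau(U,V)=\gamma(U,V)$ in either order (so it is skew). Homogeneous degree $d$ means $\mathfrak g_i\wedge\mathfrak g_j\to\mathfrak g_{i+j+d}$. Subscripts $\pm$ on a vector denote its components in $\mathfrak g_\pm$. $\mathfrak S$ is the cyclic sum over the three arguments, $\mathscr A_{U,V}G(U,V)=G(U,V)-G(V,U)$ (degrees $a,b$ in summation ranges are exchanged along with $A,B$; cyclic sums likewise permute degrees). $D_V f$ is the derivative of $f$ along the vector field $\tilde V$ with $\theta(\tilde V)=V$. $(\rho(A)\kappa_d)(X,Y)=[A,\kappa_d(X,Y)]-\kappa_d([A,X]_-,Y)-\kappa_d(X,[A,Y]_-)$. $\partial$ is the Chevalley–Eilenberg coboundary for the adjoint action of $\mathfrak g_-$ on $\mathfrak g$. Filtered manifolds. A filtered manifold is a manifold $M$ with subbundles $F^p\subset TM$ ($p\in\mathbb Z$), $F^p\supset F^{p+1}$, $F^0=0$, $\bigcup_pF^p=TM$, such that the sheaves of sections satisfy $[\underline F^p,\underline F^q]\subset\underline F^{p+q}$. Brackets make $\mathrm{gr}F_x=\bigoplus_pF^p_x/F^{p+1}_x$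 a nilpotent graded Lie algebra. $(M,F)$ is of type $\mathfrak g_-$ (a fixed finite-dimensional graded Lie algebra) if $\mathrm{gr}F_x\cong\mathfrak g_-$ for all $x$. A graded space $V$ is filtered by $F^pV=\bigoplus_{i\ge p}V_i$; for filtered $V$, $F^p\mathrm{Hom}(V,V)=\{A: AF^qV\subset F^{p+q}V\ \forall q\}$ and $F^pGL(V)=\{a\in GL(V):a-1\in F^p\mathrm{Hom}(V,V)\}$. Geometric structures (defined inductively). A geometric structure of order $-1$ is a filtered manifold $Q^{(-1)}=(M,F)$ of type $\mathfrak g_-$. A geometric structure $Q^{(k)}$ of order $k\ge0$ of type $(\mathfrak g_-,G_0,\dots,G_k)$ is a sequence $Q^{(k)}\to\cdots\to Q^{(0)}\to Q^{(-1)}=M$ such that, for $0\le i\le k$, $Q^{(i)}\to Q^{(i-1)}$ is a principal $G_i$-bundle that is a principal subbundle of the universal frame bundle $\mathcal S^{(i)}Q^{(i-1)}\to Q^{(i-1)}$. Put $\mathfrak g_i=\mathrm{Lie}(G_i)$, $E^{(k)}=\mathfrak g_-\oplus\mathfrak g_0\oplus\dots\oplus\mathfrak g_k$, $E^{(-1)}=\mathfrak g_-$. $TQ^{(i)}$ is filtered by $F^{i+1}TQ^{(i)}=0$ and, for $\ell\le i$, $F^\ell TQ^{(i)}$ = preimage of $F^\ell TQ^{(i-1)}$. The universal linear frame bundle $\hat{\mathcal S}^{(k+1)}Q^{(k)}$ has as fibre over $z\in Q^{(k)}$ the set of filtration preserving linear isomorphisms $\zeta:E^{(k)}\to T_zQ^{(k)}$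 such that: if $k=-1$, $\mathrm{gr}\,\zeta:\mathfrak g_-\to\mathrm{gr}F_z$ is a graded Lie algebra isomorphism; if $k\ge0$, $\zeta(A)=\frac{d}{dt}|_{t=0}z\exp(tA)$ for $A\in\mathfrak g_k$ and the induced map $\bar\zeta:E^{(k-1)}\to TQ^{(k-1)}$ (at the projection of $z$) lies in $\hat{\mathcal S}^{(k)}Q^{(k-1)}$ with class $[\bar\zeta]=z$. Its structure group is the group of linear automorphisms of $E^{(k)}$ which by precomposition preserve these fibres; $\mathcal S^{(k+1)}Q^{(k)}$ is the quotient of $\hat{\mathcal S}^{(k+1)}Q^{(k)}$ by $F^{k+2}GL(E^{(k)})$, a geometric structure of order $k+1$. Set $\mathcal S^{(k)}Q^{(k)}=Q^{(k)}$, $\mathcal S^{(\ell+1)}Q^{(k)}=\mathcal S^{(\ell+1)}(\mathcal S^{(\ell)}Q^{(k)})$, $\mathcal SQ^{(k)}=\varprojlim_\ell\mathcal S^{(\ell)}Q^{(k)}$. Canonical forms. The canonical Pfaff class $[\theta^{(k-1)}]$ of $Q^{(k)}$ at $z=[\zeta]$ is the class, modulo $F^{k+1}GL(E^{(k-1)})$, of $T_zQ^{(k)}\to TQ^{(k-1)}\xrightarrow{\zeta^{-1}}E^{(k-1)}$. If $Q=\varprojlim Q^{(\ell)}$ is a limit of a tower of geometric structures of all orders, these classes determine a canonical form $\theta$ on $Q$ with values in $E=\varprojlim E^{(\ell)}$ (its $E^{(i)}$-component on $X$ is the $E^{(i)}$-component of any representative of $[\theta^{(j)}]$ on the projection of $X$,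 $j$ large). It is an absolute parallelism; its structure function $\gamma:Q\to\mathrm{Hom}(\wedge^2E,E)$ is defined by $d\theta+\frac12\gamma(\theta,\theta)=0$. Let $E_a$ be the degree $a$ component of $E$, $E_-=\bigoplus_{a<0}E_a=\mathfrak g_-$ and $E_+=\bigoplus_{a\ge0}E_a$ (completed); $\kappa,\tau,\sigma$ denote the restrictions of this $\gamma$ to $\wedge^2E_-$, $E_+\wedge E_-$, $\wedge^2E_+$ respectively, and $\kappa_m$ is the part of $\kappa$ of homogeneous degree $m$ (mapping $E_i\wedge E_j\to E_{i+j+m}$); $\kappa_{[m]}=\kappa_m$, and $\tau_{[m]}$ is the part of $\tau$ mapping $E_a\otimes\mathfrak g_x\to E_{x+m-1}$. Graded Lie algebras. A truncated transitive graded Lie algebra (TTGLA) of order $k$ is a graded space $\mathfrak g[k]=\bigoplus_{p\le k}\mathfrak g_p$ with $\mathfrak g_-$ finite dimensional and brackets $\mathfrak g_i\times\mathfrak g_j\to\mathfrak g_{i+j}$ for $i,j,i+j\le k$, satisfying Jacobi whenever it makes sense, and transitive: $X\in\mathfrak g_i$, $i\ge0$, $[X,\mathfrak g_-]=0$ imply $X=0$. Its prolongation $\mathfrak g=\bigoplus\mathfrak g_p$ is the unique maximal transitive graded Lie algebra with truncation $\mathfrak g[k]$: for $p\ge k$, $\mathfrak g_{p+1}$ is the space of degree $p+1$ maps $\alpha:\mathfrak g_-\to\bigoplus_{i\le p}\mathfrak g_i$ with $\alpha([u,v])=[\alpha(u),v]+[u,\alpha(v)]$. $Q^{(k)}$ is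 proper if $E^{(k)}$ forms a TTGLA $\mathfrak g[k]$: for $0\le i\le k$, $\mathfrak g_i\subset\bigoplus_{p<0}\mathrm{Hom}(\mathfrak g_p,E^{(i-1)}_{p+i})$ (inside the Lie algebra of the structure group of $\mathcal S^{(i)}Q^{(i-1)}$), $\mathfrak g_i$ lies in the degree $i$ part of the prolongation of $E^{(i-1)}$, and $E^{(i)}$ is closed under the bracket truncated at order $i$. Normal step prolongation of $Q^{(k)}$. Fix $W=\{W^1_\ell,W^2_{\ell+1}\}_{\ell\ge k}$ with $\mathrm{Hom}(\mathfrak g_-,\mathfrak g)_\ell=W^1_\ell\oplus\partial\mathfrak g_\ell$ and $\mathrm{Hom}(\wedge^2\mathfrak g_-,\mathfrak g)_{\ell+1}=W^2_{\ell+1}\oplus\partial\mathrm{Hom}(\mathfrak g_-,\mathfrak g)_{\ell+1}$ (subscripts: maps of that degree). $\mathcal S_W^{(k)}Q^{(k)}=Q^{(k)}$ and $\mathcal S_W^{(\ell+1)}Q^{(k)}$ is the set of $z\in\mathcal S^{(\ell+1)}(\mathcal S_W^{(\ell)}Q^{(k)})$ with $\kappa_{[\ell+1]}(z)\in W^2_{\ell+1}$ and $\tau_{[\ell+1]}(z)(A,\cdot)\in W^1_\ell$ for $A\in\bigoplus_{i=0}^{\ell-1}\mathfrak g_i$ (these components of the structure function of $\mathcal S(\mathcal S_W^{(\ell)}Q^{(k)})$ descend to $\mathcal S^{(\ell+1)}$). $\mathcal S_WQ^{(k)}=\varprojlim_\ell\mathcal S_W^{(\ell)}Q^{(k)}$,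 with $E=\mathfrak g$ (completed). *)

(* Defs.v *)
From HB Require Import structures.
From mathcomp Require Import all_boot all_order all_algebra.
From mathcomp Require Import all_classical all_reals all_analysis.

Set Implicit Arguments.
Unset Strict Implicit.
Unset Printing Implicit Defensive.
Import Order.TTheory GRing.Theory Num.Theory.
Import numFieldNormedType.Exports.
Local Open Scope classical_set_scope.
Local Open Scope ring_scope.

Definition irange (a b : int) : seq int :=
  if a <= b then [seq a + i%:Z | i <- iota 0 (absz (b - a)).+1] else [::].

Definition bilinear_map (R : realType) (V W : lmodType R) (c : V -> V -> W) : Prop :=
  (forall u, linear (c u)) /\ (forall v, linear (c ^~ v)).

Definition alternating_map (R : realType) (V W : lmodType R) (c : V -> V -> W) : Prop :=
  forall u, c u u = 0.

Definition subspace (R : realType) (V : lmodType R) (S : set V) : Prop :=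
  S 0 /\ forall (a : R) u v, S u -> S v -> S (a *: u + v).

Definition direct_sum (R : realType) (V : lmodType R) (H W B : set V) : Prop :=
  [/\ subspace W, W `<=` H, B `<=` H,
      W `&` B = [set 0] & forall h, H h -> exists w b, [/\ W w, B b & h = w + b]].

Section Manifolds.
Variable R : realType.

Fixpoint Ck (k n : nat) (U : set 'rV[R]_n) (f : 'rV[R]_n -> R) : Prop :=
  (forall x, U x -> {for x, continuous f}) /\
  match k with
  | 0%N => True
  | k'.+1 => forall i : 'I_n,
      (forall x, U x -> derivable f x (delta_mx 0 i)) /\
      Ck k' U (fun x => 'D_(delta_mx 0 i) f x)
  end.

Definition smooth_near (n : nat) (x : 'rV[R]_n) (f : 'rV[R]_n -> R) : Prop :=
  exists U : set 'rV[R]_n, [/\ open U, U x & forall k, Ck k U f].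

(* A smooth structure on M is given by its sheaf of functions: [sm x f] says   *)
(* that f is smooth on some neighbourhood of x.  phi is a chart of domain U    *)
(* and psi is its inverse.                                                     *)
Definition is_chart (M : topologicalType) (sm : M -> (M -> R) -> Prop) (n : nat)
    (U : set M) (phi : M -> 'rV[R]_n) (psi : 'rV[R]_n -> M) : Prop :=
  [/\ open U /\ open (phi @` U),
      forall x, U x -> psi (phi x) = x,
      forall x, U x -> {for x, continuous phi},
      forall a, (phi @` U) a -> {for a, continuous psi} &
      forall x f, U x -> (sm x f <-> smooth_near (phi x) (f \o psi))].

Record manifold := Manifold {
  mdim : nat;
  mspace :> topologicalType;
  smooth_at : mspace -> (mspace -> R) -> Prop;
  m_hausdorff : hausdorff_space mspace;
  m_second_countable : @second_countable mspace;
  m_chart : forall x, exists U phi psi,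
    U x /\ @is_chart mspace smooth_at mdim U phi psi }.

Definition smooth_map_at (M N : manifold) (x : M) (h : M -> N) : Prop :=
  {for x, continuous h} /\
  forall f, smooth_at (h x) f -> smooth_at x (f \o h).

Definition smooth2_at (M N : manifold) (x : M) (y : N) (f : M -> N -> R) : Prop :=
  exists U phi psi U' phi' psi',
    [/\ U x, is_chart (@smooth_at M) (n := mdim M) U phi psi,
        U' y, is_chart (@smooth_at N) (n := mdim N) U' phi' psi' &
        smooth_near (row_mx (phi x) (phi' y))
          (fun t => f (psi (lsubmx t)) (psi' (rsubmx t)))].

Definition smooth2_map_at (M N P : manifold) (x : M) (y : N) (h : M -> N -> P) : Prop :=
  {for (x, y), continuous (fun w : M * N => h w.1 w.2)} /\
  forall f, smooth_at (h x y) f -> smooth2_at x y (fun a b => f (h a b)).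

(* Tangent vectors at x are the derivations of the algebra of germs at x.  They *)
(* are extended by 0 to the functions that are not smooth at x, so that all the *)
(* tangent spaces of M are subspaces of one vector space.                       *)
Definition tvec (M : manifold) := (M -> R) -> R^o.
HB.instance Definition _ (M : manifold) := GRing.Lmodule.copy (tvec M) ((M -> R) -> R^o).

Definition tangent (M : manifold) (x : M) : set (tvec M) := [set v |
  [/\ forall f, ~ smooth_at x f -> v f = 0,
      forall (a : R) f g, smooth_at x f -> smooth_at x g ->
        v (fun y => a * f y + g y) = a * v f + v g,
      forall f g, smooth_at x f -> smooth_at x g ->
        v (fun y => f y * g y) = v f * g x + f x * v g &
      forall f g, smooth_at x f -> (\forall y \near x, f y = g y) -> v f = v g]].

Definition push (M N : manifold) (h : M -> N) (x : M) (v : tvec M) : tvec N :=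
  fun f => if `[< smooth_at (h x) f >] then v (f \o h) else 0.

Definition smooth_vf_at (M : manifold) (x : M) (X : M -> tvec M) : Prop :=
  (\forall y \near x, tangent y (X y)) /\
  forall f, smooth_at x f -> smooth_at x (fun y => X y f).

Definition vbracket (M : manifold) (X Y : M -> tvec M) (x : M) : tvec M :=
  fun f => if `[< smooth_at x f >]
           then X x (fun y => Y y f) - Y x (fun y => X y f) else 0.

Record lieGroup := LieGroup {
  lg_mfd :> manifold;
  lg_one : lg_mfd;
  lg_mul : lg_mfd -> lg_mfd -> lg_mfd;
  lg_inv : lg_mfd -> lg_mfd;
  lg_mulA : associative lg_mul;
  lg_mul1 : left_id lg_one lg_mul;
  lg_mulV : left_inverse lg_one lg_inv lg_mul;
  lg_mul_smooth : forall a b, smooth2_map_at a b lg_mul;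
  lg_inv_smooth : forall a, smooth_map_at a lg_inv }.

Definition sections (M : manifold) (F : int -> forall x : M, set (tvec M))
    (p : int) (x : M) (X : M -> tvec M) : Prop :=
  smooth_vf_at x X /\ \forall y \near x, F p y (X y).

Definition subbundle (M : manifold) (S : forall x : M, set (tvec M)) : Prop :=
  forall x, exists r (e : 'I_r -> M -> tvec M),
    (forall i, smooth_vf_at x (e i)) /\
    \forall y \near x, forall v,
      S y v <-> exists! c : 'rV[R]_r, v = \sum_i c 0 i *: e i y.

Record filtered_manifold (M : manifold)
    (F : int -> forall x : M, set (tvec M)) : Prop := {
  fm_subbundle : forall p, subbundle (F p);
  fm_tangent : forall p x, F p x `<=` tangent x;
  fm_decr : forall p x, F (p + 1) x `<=` F p x;
  fm_zero : forall x, F 0 x = [set 0];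
  fm_exhaust : forall x, \bigcup_p F p x = tangent x;
  fm_bracket : forall p q x X Y, sections F p x X -> sections F q x Y ->
    F (p + q) x (vbracket X Y x) }.

End Manifolds.

(* The completion prod_p g_p of a graded Lie algebra whose negative part is     *)
(* finite dimensional: [comp p] is the projection to g_p and [assemble c] is    *)
(* the element whose component of degree p is that of c p.                      *)
Record gradedLie (R : realType) := GradedLie {
  gl_space :> lmodType R;
  comp : int -> gl_space -> gl_space;
  depth : nat;
  assemble : (int -> gl_space) -> gl_space;
  br : gl_space -> gl_space -> gl_space;
  comp_linear : forall p, linear (comp p);
  comp_comp : forall p q v, comp p (comp q v) = if p == q then comp p v else 0;
  comp_depth : forall p v, p < - depth%:Z -> comp p v = 0;
  comp_sep : forall u v, (forall p, comp p u = comp p v) -> u = v;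
  comp_assemble : forall p c, comp p (assemble c) = comp p (c p);
  neg_findim : forall p, p < 0 -> exists r (e : 'I_r -> gl_space),
    forall v, exists c : 'rV[R]_r, comp p v = \sum_i c 0 i *: e i;
  br_bilinear : bilinear_map br;
  br_alternating : alternating_map br;
  br_jacobi : forall u v w, br u (br v w) + br v (br w u) + br w (br u v) = 0;
  br_comp : forall m u v, comp m (br u v) =
    \sum_(i <- irange (- depth%:Z) (m + depth%:Z)) br (comp i u) (comp (m - i) v) }.

Section Graded.
Variables (R : realType) (g : gradedLie R).

Definition homog (p : int) : set g := [set v | comp p v = v].
Definition filt (p : int) : set g := [set v | forall q, q < p -> comp q v = 0].
Definition neg (v : g) : g := assemble (fun p => if p < 0 then v else 0).
Definition pos (v : g) : g := assemble (fun p => if 0 <= p then v else 0).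

(* the part of homogeneous degree d of b : g x g -> g *)
Definition hpart (d : int) (b : g -> g -> g) (u v : g) : g :=
  assemble (fun m =>
    \sum_(i <- irange (- (depth g)%:Z) (m - d + (depth g)%:Z))
      comp m (b (comp i u) (comp (m - d - i) v))).

Definition transitive_gl : Prop := forall i (A : g), 0 <= i -> homog i A ->
  (forall p X, p < 0 -> homog p X -> br A X = 0) -> A = 0.

(* the degrees > k are obtained by prolongation of the truncation at order k *)
Definition is_prolongation (k : int) : Prop :=
  forall (p : int) (alpha : g -> g), k <= p -> linear alpha ->
    (forall q X, q < 0 -> homog q X -> homog (q + p + 1) (alpha X)) ->
    (forall i j X Y, i < 0 -> j < 0 -> homog i X -> homog j Y ->
      alpha (br X Y) = br (alpha X) Y + br X (alpha Y)) ->
    exists2 A, homog (p + 1) A &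
      forall q X, q < 0 -> homog q X -> alpha X = br A X.

(* Cochains on g_- are extended by 0 to g = g_- (+) g_+. *)
Definition Hom1 (l : int) : set (g -> g) := [set f |
  [/\ linear f, forall v, f v = f (neg v) &
      forall p X, p < 0 -> homog p X -> homog (p + l) (f X)]].
Definition Hom2 (l : int) : set (g -> g -> g) := [set c |
  [/\ bilinear_map c, alternating_map c, forall u v, c u v = c (neg u) (neg v) &
      forall p q X Y, p < 0 -> q < 0 -> homog p X -> homog q Y ->
        homog (p + q + l) (c X Y)]].

Definition cobd0 (A : g) : g -> g := fun X => br (neg X) A.
Definition cobd1 (f : g -> g) : g -> g -> g := fun X Y =>
  br (neg X) (f (neg Y)) - br (neg Y) (f (neg X)) - f (br (neg X) (neg Y)).
Definition cobd2 (c : g -> g -> g) : g -> g -> g -> g := fun X Y Z =>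
  br (neg X) (c (neg Y) (neg Z)) - br (neg Y) (c (neg X) (neg Z))
  + br (neg Z) (c (neg X) (neg Y))
  - c (br (neg X) (neg Y)) (neg Z) + c (br (neg X) (neg Z)) (neg Y)
  - c (br (neg Y) (neg Z)) (neg X).

Definition normal_complements (k : int)
    (W1 : int -> set (g -> g)) (W2 : int -> set (g -> g -> g)) : Prop :=
  forall l, k <= l ->
    direct_sum (Hom1 l) (W1 l) (cobd0 @` homog l) /\
    direct_sum (Hom2 (l + 1)) (W2 (l + 1)) (cobd1 @` Hom1 (l + 1)).

(* F^k GL(E) for E a quotient g / F^n g *)
Definition FGL (k : int) : set (g -> g) := [set a |
  linear a /\ forall q v, filt q v -> filt (q + k) (a v - v)].

(* a induces a linear automorphism of g / F^n g *)
Definition autom (n : int) (a : g -> g) : Prop :=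
  [/\ linear a, forall v, filt n v <-> filt n (a v) &
      forall w, exists v, filt n (a v - w)].

End Graded.

(* All indices are shifted by one: [tQ T n] is Q^(n-1), so tQ T 0 = M, and G_n  *)
(* is the structure group of tQ T n.+1 = Q^(n) over tQ T n = Q^(n-1).  The space *)
(* E^(n-1) = sum_(p < n) g_p is realised as g / F^n g, i.e. linear maps on       *)
(* E^(n-1) are linear maps on g.  A point z of Q^(n) is a class of frames on     *)
(* E^(n-1): [cls z] is the set of its representatives.  [rho a] is a             *)
(* representative modulo F^(n+1)GL(E^(n-1)) of a in G_n, and [lie] identifies    *)
(* g_n with the Lie algebra of G_n.                                              *)
Record towerData (R : realType) (g : gradedLie R) := TowerData {
  tQ : nat -> manifold R;
  tF : int -> forall x : tQ 0, set (tvec (tQ 0));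
  tG : nat -> lieGroup R;
  proj : forall n, tQ n.+1 -> tQ n;
  act : forall n, tQ n.+1 -> tG n -> tQ n.+1;
  cls : forall n, tQ n.+1 -> set (g -> tvec (tQ n));
  rho : forall n, tG n -> g -> g;
  lie : forall n, g -> tvec (tG n) }.
Arguments tF {R g} t p x.
Arguments proj {R g} t n z.
Arguments act {R g} t n z a.
Arguments cls {R g} t n z.
Arguments rho {R g} t n a v.
Arguments lie {R g} t n A.

Section Towers.
Variables (R : realType) (g : gradedLie R) (T : towerData g).

Fixpoint TF (n : nat) : int -> forall z : tQ T n, set (tvec (tQ T n)) :=
  match n with
  | 0%N => fun p z => tF T p z
  | m.+1 => fun p z => [set v | tangent z v /\
      if p <= m%:Z then @TF m p (proj T m z) (push (proj T m) z v)
      else v = 0]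
  end.

(* the vector d/dt z exp(tA) at t = 0, as the image of A under the differential *)
(* at 1 of a |-> z.a                                                            *)
Definition fund (n : nat) (z : tQ T n.+1) (A : g) : tvec (tQ T n.+1) :=
  push (act T n z) (lg_one (tG T n)) (lie T n A).

Definition filtered_iso (n : nat) (z : tQ T n) (zeta : g -> tvec (tQ T n)) : Prop :=
  [/\ linear zeta,
      forall v, zeta v = 0 <-> filt n%:Z v,
      zeta @` setT = tangent z &
      forall p : int, zeta @` filt p = @TF n p z].

(* gr zeta : g_- -> gr F_x preserves the brackets *)
Definition gr_morphism (x : tQ T 0) (zeta : g -> tvec (tQ T 0)) : Prop :=
  forall p q u v X Y, p < 0 -> q < 0 -> homog p u -> homog q v ->
    sections (tF T) p x X -> sections (tF T) q x Y ->
    X x = zeta u -> Y x = zeta v ->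
    tF T (p + q + 1) x (vbracket X Y x - zeta (br u v)).

(* the fibre over z of the universal linear frame bundle of tQ T n *)
Definition frame (n : nat) : forall z : tQ T n, set (g -> tvec (tQ T n)) :=
  match n with
  | 0%N => fun z => [set zeta | filtered_iso z zeta /\ gr_morphism z zeta]
  | m.+1 => fun z => [set zeta |
      [/\ filtered_iso z zeta,
          forall A, homog m%:Z A -> zeta A = fund z A &
          cls T m z (fun v => push (proj T m) z (zeta v))]]
  end.

Definition structure_group (n : nat) : set (g -> g) := [set a |
  autom n%:Z a /\
  forall (z : tQ T n) zeta, linear zeta -> (forall v, filt n%:Z v -> zeta v = 0) ->
    (frame z zeta <-> frame z (fun v => zeta (a v)))].

(* The derivative at 1 of rho in the direction A of Lie(G_n) is the class of B  *)
(* modulo the degrees > n.                                                      *)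
Definition drho (n : nat) (A : g) (B : g -> g) : Prop :=
  forall (q p : int) v (lam : g -> R^o), filt q v -> p < n%:Z -> p <= q + n%:Z ->
    linear lam ->
    lie T n A (fun a => lam (comp p (rho T n a v))) = lam (comp p (B v)).

(* [rho] embeds G_n as a Lie subgroup of the structure group of S^(n)Q^(n-1) *)
Record lie_subgroup (n : nat) : Prop := {
  ls_struct : forall a, structure_group n (rho T n a);
  ls_smooth : forall p v (lam : g -> R^o) a, linear lam ->
    smooth_at a (fun b => lam (comp p (rho T n b v)));
  ls_one : exists2 c, FGL n.+1%:Z c &
    forall v, filt n%:Z (rho T n (lg_one _) v - c v);
  ls_mul : forall a b, exists2 c, FGL n.+1%:Z c &
    forall v, filt n%:Z (rho T n (lg_mul a b) v - rho T n a (rho T n b (c v)));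
  ls_inj : forall a c, FGL n.+1%:Z c ->
    (forall v, filt n%:Z (rho T n a v - c v)) -> a = lg_one _;
  ls_lie_linear : linear (lie T n);
  ls_lie_tangent : forall A, homog n%:Z A -> tangent (lg_one (tG T n)) (lie T n A);
  ls_lie_bij : forall v, tangent (lg_one (tG T n)) v ->
    exists! A, homog n%:Z A /\ lie T n A = v;
  ls_immersion : forall A, homog n%:Z A -> drho n A (fun=> 0) -> A = 0 }.

(* tQ T n.+1 is a principal subbundle, with group G_n, of the quotient          *)
(* S^(n)Q^(n-1) of the frames by F^(n+1)GL(E^(n-1)): it has local sections s    *)
(* that lift to smooth frame fields, and (y, a) |-> s(y).a is a diffeomorphism  *)
(* with inverse w |-> (proj w, t w).                                            *)
Record principal_subbundle (n : nat) : Prop := {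
  ps_class : forall z : tQ T n.+1, exists2 zeta, frame (proj T n z) zeta &
    cls T n z = [set zeta' | exists2 a, FGL n.+1%:Z a & zeta' = (fun v => zeta (a v))];
  ps_inj : forall z z' : tQ T n.+1, proj T n z = proj T n z' -> cls T n z = cls T n z' -> z = z';
  ps_proj_smooth : forall z, smooth_map_at z (proj T n);
  ps_act_smooth : forall z a, smooth2_map_at z a (act T n);
  ps_act_one : forall z : tQ T n.+1, act T n z (lg_one _) = z;
  ps_act_mul : forall (z : tQ T n.+1) a b, act T n (act T n z a) b = act T n z (lg_mul a b);
  ps_act_proj : forall (z : tQ T n.+1) a, proj T n (act T n z a) = proj T n z;
  ps_act_cls : forall (z : tQ T n.+1) a zeta, cls T n z zeta ->
    cls T n (act T n z a) (fun v => zeta (rho T n a v));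
  ps_trivial : forall x : tQ T n, exists U (s : tQ T n -> tQ T n.+1)
      (Z : tQ T n -> g -> tvec (tQ T n)) (t : tQ T n.+1 -> tG T n),
    [/\ open U /\ U x,
        forall y, U y -> smooth_map_at y s /\ proj T n (s y) = y,
        forall y, U y -> cls T n (s y) (Z y) /\ forall v, smooth_vf_at y (Z^~ v),
        forall y a, U y -> t (act T n (s y) a) = a &
        forall w, U (proj T n w) -> smooth_map_at w t /\ w = act T n (s (proj T n w)) (t w)] }.

Record geometric_tower : Prop := {
  gt_filtered : filtered_manifold (tF T);
  gt_type : forall x : tQ T 0, exists zeta, frame x zeta;
  gt_group : forall n, lie_subgroup n;
  gt_bundle : forall n, principal_subbundle n }.

(* Lie(G_n) is the subspace g_n of Hom(g_-, E^(n-1)) acting by the bracket of g *)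
Definition acts_by_bracket (n : nat) : Prop :=
  forall A, homog n%:Z A -> drho n A (fun v => br A (neg v)).

Definition proper_structure (k : int) : Prop :=
  forall n : nat, n%:Z <= k -> acts_by_bracket n.

(* With n = l+1, the components kappa_[n] and tau_[n] of the structure function  *)
(* of S(Q^(l)) at a point over the class of zeta only depend on that class.  They *)
(* are computed by pulling back d theta = - (1/2) gamma(theta, theta) by a local  *)
(* section of S(Q^(l)), i.e. by a local frame field Z through zeta; c is the      *)
(* resulting torsion [Z u, Z v] = Z (c u v) at x, with values in E^(n-1).         *)
Definition normal_frame (W1 : int -> set (g -> g)) (W2 : int -> set (g -> g -> g))
    (n : nat) (x : tQ T n) (zeta : g -> tvec (tQ T n)) : Prop :=
  exists (Z : tQ T n -> g -> tvec (tQ T n)) (c : g -> g -> g),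
    [/\ Z x = zeta /\ (forall v, smooth_vf_at x (Z^~ v)),
        \forall y \near x, frame y (Z y),
        forall u v, vbracket (Z^~ u) (Z^~ v) x = zeta (c u v) /\
          forall p : int, n%:Z <= p -> comp p (c u v) = 0,
        W2 n%:Z (hpart n%:Z (fun u v => c (neg u) (neg v))) &
        forall (i : int) A, 0 <= i <= n%:Z - 2 -> homog i A ->
          W1 (n%:Z - 1) (hpart (n%:Z - 1 - i) (fun u v => c u (neg v)) A)].

(* The levels of order > k of T are the normal step prolongation of its level   *)
(* of order k, with E = g.                                                      *)
Definition normal_step_prolongation (k : int)
    (W1 : int -> set (g -> g)) (W2 : int -> set (g -> g -> g)) : Prop :=
  forall n : nat, k < n%:Z -> acts_by_bracket n /\
    forall (x : tQ T n) zeta, frame x zeta ->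
      ((exists2 z, proj T n z = x & cls T n z zeta) <-> normal_frame W1 W2 x zeta).

Record limQ := LimQ {
  lpt :> forall n, tQ T n;
  lpt_compat : forall n, proj T n (lpt n.+1) = lpt n }.

Definition ltangent (z : limQ) (X : forall n, tvec (tQ T n)) : Prop :=
  forall n, tangent (z n) (X n) /\ push (proj T n) (z n.+1) (X n.+1) = X n.

(* f is, near z, the pullback of h : tQ T n -> R smooth at z n *)
Definition lrep (z : limQ) (f : limQ -> R) (n : nat) (h : tQ T n -> R) : Prop :=
  smooth_at (z n) h /\
  exists2 N, nbhs (z n) N & forall w : limQ, N (w n) -> f w = h (w n).

Definition lsmooth_at (z : limQ) (f : limQ -> R) : Prop :=
  exists n h, @lrep z f n h.

Definition is_lderiv (z : limQ) (X : forall n, tvec (tQ T n)) (f : limQ -> R)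
    (r : R) : Prop :=
  exists n h, @lrep z f n h /\ r = X n h.
Definition lderiv z X f : R := xget 0 [set r | is_lderiv z X f r].

Definition is_drv (z : limQ) (X : forall n, tvec (tQ T n)) (f : limQ -> g)
    (w : g) : Prop :=
  forall p (lam : g -> R^o), linear lam ->
    is_lderiv z X (fun y => lam (comp p (f y))) (lam (comp p w)).
Definition drv z X f : g := xget 0 [set w | is_drv z X f w].

Definition lvfield := forall (z : limQ) n, tvec (tQ T n).
Definition smooth_lvf (X : lvfield) : Prop :=
  forall z, ltangent z (X z) /\
    forall n f, smooth_at (z n) f -> lsmooth_at z (fun w => X w n f).
Definition lbracket (X Y : lvfield) : lvfield := fun z n f =>
  if `[< smooth_at (z n) f >]
  then lderiv z (X z) (fun w => Y w n f) - lderiv z (Y z) (fun w => X w n f) else 0.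

(* w is the value on X of the canonical form: for n large, w and zeta^-1(X n)   *)
(* have the same component of degree p                                          *)
Definition is_theta (z : limQ) (X : forall n, tvec (tQ T n)) (w : g) : Prop :=
  forall p, exists N : nat, forall n, (N <= n)%N -> forall zeta u,
    cls T n (z n.+1) zeta -> zeta u = X n -> comp p u = comp p w.
Definition theta z X : g := xget 0 [set w | is_theta z X w].

(* d theta + (1/2) gamma(theta, theta) = 0 *)
Definition structure_function (gam : limQ -> g -> g -> g) : Prop :=
  (forall z, bilinear_map (gam z) /\ alternating_map (gam z)) /\
  forall X Y : lvfield, smooth_lvf X -> smooth_lvf Y -> forall z,
    drv z (X z) (fun w => theta w (Y w)) - drv z (Y z) (fun w => theta w (X w))
    - theta z (lbracket X Y z)
    + 2^-1 *: (gam z (theta z (X z)) (theta z (Y z))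
               - gam z (theta z (Y z)) (theta z (X z))) = 0.

(* D_V f : derivative along the vector X at z such that theta(X) = V *)
Definition Dv (V : g) (f : limQ -> g) (z : limQ) : g :=
  xget 0 [set w | exists X, [/\ ltangent z X, is_theta z X V & is_drv z X f w]].

Section Components.
Variable gam : limQ -> g -> g -> g.

Definition kappa (d : int) (z : limQ) : g -> g -> g :=
  hpart d (fun u v => gam z (neg u) (neg v)).
Definition tau (d : int) (z : limQ) : g -> g -> g :=
  hpart d (fun u v => gam z (pos u) (neg v) + gam z (neg u) (pos v)).
Definition sigma (d : int) (z : limQ) : g -> g -> g :=
  hpart d (fun u v => gam z (pos u) (pos v)).

Definition rho_kappa (A : g) (d : int) (z : limQ) (X Y : g) : g :=
  br A (kappa d z X Y) - kappa d z (neg (br A X)) Y - kappa d z X (neg (br A Y)).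

End Components.
End Towers.

(* Cyclic sum and skew-symmetrisation over vectors given with their degrees *)
Definition cycsum (G : zmodType) (V : Type)
    (F : int -> V -> int -> V -> int -> V -> G) x X y Y z Z : G :=
  F x X y Y z Z + F y Y z Z x X + F z Z x X y Y.
Definition skewsum (G : zmodType) (V : Type)
    (F : int -> V -> int -> V -> G) x X y Y : G :=
  F x X y Y - F y Y x X.

(* Main.v *)
(* For V in g let D_V be the derivation of the functions on Q defined by the
   vector field on which theta is V.  By definition of gamma,
   [D_U, D_V] = D_(gamma(U, V)), so the Jacobi identity for D_U, D_V, D_W is
   the Bianchi identity
     cyclic sum of (gamma(gamma(U, V), W) - D_W gamma(U, V)) = 0,
   of which the four identities are the homogeneous components.

   The summation ranges come from the vanishing of low components of gamma:
   - on g_- ^ g, gamma has no component of negative degree, and its component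
     of degree 0 is the bracket.  On g_- ^ g_- this is the compatibility of
     frames with gr F; on g_+ ^ g_- it holds because the field of A in g_a
     generates, on the a-th stage of the tower, the action of G_a, whose
     derivative is the bracket;
   - gamma(g_a, g_b) has degrees >= max(a, b) for a, b >= 0, since the field of
     A in g_a is vertical over the (a-1)-st stage. *)

From HB Require Import structures.
From mathcomp Require Import all_boot all_order all_algebra.
From mathcomp Require Import all_classical all_reals all_analysis.
From mathcomp Require Import zify ring lra.
Require Import Defs.

Set Implicit Arguments.
Unset Strict Implicit.
Unset Printing Implicit Defensive.
Import Order.TTheory GRing.Theory Num.Theory.
Import numFieldNormedType.Exports.
Local Open Scope classical_set_scope.
Local Open Scope ring_scope.

(** * Smooth functions *)

(** The limit Q is not a manifold, and g_n for n >= 0 is not assumed finite dimensional, so neither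
    the smoothness of gamma nor the passage through infinite sums of components is automatic.
    Transitivity repairs this: an element of degree n >= 0 is determined by its brackets with g_-,
    so every g / F^m is finite dimensional. Functions on Q come locally from finite levels, and
    Cramer's rule over their germs makes coordinates in a moving frame smooth. The second difficulty
    is that a finite level determines theta only in part. A point of [tQ T n.+1] is a frame at a
    point of [tQ T n] known modulo F^(n+1)GL, and this frame kills F^n; hence coordinates in F^q
    read in it agree with theta only modulo F^min(n, q+n+1). Every estimate of a leading part rests
    on this bound: [D_U, D_V] is computed in a local frame of one well chosen level, which gives
    gamma(U, V) with just the accuracy required. *)

Section SmoothFunctions.
Variable R : realType.

Lemma continuous_at_ext (S : topologicalType) (x : S) (f g : S -> R) :
  (\forall y \near x, f y = g y) ->
  {for x, continuous f} -> {for x, continuous g}.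
Proof.
move=> fg; rewrite /prop_for /continuous_at (nbhs_singleton fg) => cf.
by apply: cvg_trans cf; exact: near_eq_cvg.
Qed.

Lemma Ck_ext k n (U : set 'rV[R]_n) (f g : 'rV[R]_n -> R) :
  open U -> (forall x, U x -> f x = g x) -> Ck k U f -> Ck k U g.
Proof.
move=> oU; elim: k f g => [|k IH] f g fg.
  move=> [cf _]; split => // x Ux.
  apply: continuous_at_ext (cf x Ux).
  by apply: filterS (open_nbhs_nbhs (conj oU Ux)) => y /fg.
move=> [cf df]; split.
  move=> x Ux.
  apply: continuous_at_ext (cf x Ux).
  by apply: filterS (open_nbhs_nbhs (conj oU Ux)) => y /fg.
move=> i; have [d1 d2] := df i.
have nfg x : U x -> \forall y \near x, f y = g y.
  by move=> Ux; apply: filterS (open_nbhs_nbhs (conj oU Ux)) => y /fg.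
split.
  by move=> x Ux; apply: near_eq_derivable (d1 x Ux); exact: nfg.
apply: IH d2 => x Ux; apply: near_eq_derive; exact: nfg.
Qed.

Lemma Ck_sub k n (U V : set 'rV[R]_n) (f : 'rV[R]_n -> R) :
  V `<=` U -> Ck k U f -> Ck k V f.
Proof.
move=> VU; elim: k f => [|k IH] f [cf df]; split => //.
- by move=> x /VU; exact: cf.
- by move=> x /VU; exact: cf.
- by move=> i; have [d1 d2] := df i; split; [move=> x /VU; exact: d1|exact: IH].
Qed.

Lemma Ck_pred k n (U : set 'rV[R]_n) (f : 'rV[R]_n -> R) :
  Ck k.+1 U f -> Ck k U f.
Proof.
elim: k f => [|k IH] f; first by move=> [cf _]; split.
by move=> [cf df]; split => // i; have [d1 d2] := df i; split => //; exact: IH.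
Qed.

Lemma Ck_cst k n (U : set 'rV[R]_n) (a : R) : Ck k U (fun=> a).
Proof.
elim: k a => [|k IH] a; first by split => // x _; exact: cst_continuous.
split; first by move=> x _; exact: cst_continuous.
move=> i; split; first by move=> x _; exact: derivable_cst.
have -> : (fun x => 'D_(delta_mx 0 i) (fun=> a) x) = (fun=> 0) :> ('rV[R]_n -> R).
  by apply/funext => x; exact: derive_cst.
exact: IH.
Qed.

Lemma Ck_add k n (U : set 'rV[R]_n) (f g : 'rV[R]_n -> R) : open U ->
  Ck k U f -> Ck k U g -> Ck k U (fun x => f x + g x).
Proof.
move=> oU; elim: k f g => [|k IH] f g [cf df] [cg dg].
  by split => // x Ux; exact: (cvgD (cf x Ux) (cg x Ux)).
split; first by move=> x Ux; exact: (cvgD (cf x Ux) (cg x Ux)).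
move=> i; have [d1 d2] := df i; have [e1 e2] := dg i; split.
  by move=> x Ux; apply: derivableD; [exact: d1|exact: e1].
apply: Ck_ext (IH _ _ d2 e2) => // x Ux /=.
by rewrite [RHS](deriveD (d1 x Ux) (e1 x Ux)).
Qed.

Lemma Ck_mul k n (U : set 'rV[R]_n) (f g : 'rV[R]_n -> R) : open U ->
  Ck k U f -> Ck k U g -> Ck k U (fun x => f x * g x).
Proof.
move=> oU; elim: k f g => [|k IH] f g.
  by move=> [cf df] [cg dg]; split => // x Ux; exact: (cvgM (cf x Ux) (cg x Ux)).
move=> Hf Hg; have [cf df] := Hf; have [cg dg] := Hg.
split; first by move=> x Ux; exact: (cvgM (cf x Ux) (cg x Ux)).
move=> i; have [d1 d2] := df i; have [e1 e2] := dg i; split.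
  by move=> x Ux; apply: derivableM; [exact: d1|exact: e1].
have := Ck_add oU (IH _ _ (Ck_pred Hf) e2) (IH _ _ (Ck_pred Hg) d2).
apply: Ck_ext => // x Ux /=.
by rewrite [RHS](deriveM (d1 x Ux) (e1 x Ux)).
Qed.

Lemma Ck_inv k n (U : set 'rV[R]_n) (f : 'rV[R]_n -> R) : open U ->
  (forall x, U x -> f x != 0) -> Ck k U f -> Ck k U (fun x => (f x)^-1).
Proof.
move=> oU f0; elim: k => [|k IH].
  by move=> [cf df]; split => // x Ux; exact: (cvgV (f0 x Ux) (cf x Ux)).
move=> Hf; have [cf df] := Hf.
split; first by move=> x Ux; exact: (cvgV (f0 x Ux) (cf x Ux)).
move=> i; have [d1 d2] := df i; split.
  by move=> x Ux; apply: derivableV; [exact: f0|exact: d1].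
have HV := IH (Ck_pred Hf).
have := Ck_mul oU (Ck_mul oU (Ck_cst k U (-1)) (Ck_mul oU HV HV)) d2.
apply: Ck_ext => // x Ux /=.
rewrite [RHS](deriveV (f0 x Ux) (d1 x Ux)) /= expr2 invfM.
by rewrite mulN1r.
Qed.

Section Manifold.
Variable M : manifold R.
Implicit Types (x : M) (f g : M -> R).

(** [psi] is only controlled on the image of the chart. Shrinking the neighbourhood into this image
    allows all functions at x to be tested in the same chart. *)
Lemma smooth_chartP x : exists U phi psi,
  [/\ U x, @is_chart R M (@smooth_at R M) (mdim M) U phi psi &
   forall f, smooth_at x f <-> exists V, [/\ open V, V (phi x), V `<=` phi @` U &
     forall k, Ck k V (f \o psi)]].
Proof.
have [U [phi [psi [Ux ch]]]] := m_chart x.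
exists U, phi, psi; split => //= f.
case: ch => [[oU oP] pK cphi cpsi sm].
rewrite (sm x f Ux); split.
  move=> [V [oV Vx CV]]; exists (V `&` phi @` U); split => //.
  - exact: openI.
  - by move=> k; apply: Ck_sub (CV k) => y [].
by move=> [V [oV Vx _ CV]]; exists V; split.
Qed.

Lemma chart_ext x U (phi : M -> 'rV[R]_(mdim M)) psi (f g : M -> R) : U x ->
  is_chart (@smooth_at R M) U phi psi -> (\forall y \near x, f y = g y) ->
  exists W, [/\ open W, W (phi x) & forall a, W a -> (f \o psi) a = (g \o psi) a].
Proof.
move=> Ux [[oU oP] pK cphi cpsi sm] fg.
have Ix : (phi @` U) (phi x) by exists x.
have := cpsi (phi x) Ix; rewrite /prop_for /continuous_at (pK _ Ux) => H.
move/H: fg; rewrite /= nbhsE => -[W [oW Wx] Wfg].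
by exists W; split.
Qed.

Lemma smooth_ext x f g : smooth_at x f -> (\forall y \near x, f y = g y) ->
  smooth_at x g.
Proof.
have [U [phi [psi [Ux ch P]]]] := smooth_chartP x.
move=> /P [V [oV Vx VU CV]] /(chart_ext Ux ch) [W [oW Wx Wfg]].
apply/P; exists (V `&` W); split => //.
- exact: openI.
- by move=> a [/VU].
- move=> k; have := Ck_sub (@subIsetl _ V W) (CV k).
  by apply: Ck_ext; [exact: openI|move=> a [_ /Wfg]].
Qed.

Lemma smooth_cst x (a : R) : smooth_at x (fun=> a).
Proof.
have [U [phi [psi [Ux ch P]]]] := smooth_chartP x.
case: ch => [[oU oP] _ _ _ _].
apply/P; exists (phi @` U); split => //.
by move=> k; exact: Ck_cst.
Qed.

Lemma smooth_add x f g : smooth_at x f -> smooth_at x g ->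
  smooth_at x (fun y => f y + g y).
Proof.
have [U [phi [psi [Ux ch P]]]] := smooth_chartP x.
move=> /P [V [oV Vx VU CV]] /P [W [oW Wx WU CW]].
apply/P; exists (V `&` W); split => //.
- exact: openI.
- by move=> a [/VU].
- move=> k; apply: Ck_add; first exact: openI.
  + by apply: Ck_sub (CV k) => a [].
  + by apply: Ck_sub (CW k) => a [].
Qed.

Lemma smooth_mul x f g : smooth_at x f -> smooth_at x g ->
  smooth_at x (fun y => f y * g y).
Proof.
have [U [phi [psi [Ux ch P]]]] := smooth_chartP x.
move=> /P [V [oV Vx VU CV]] /P [W [oW Wx WU CW]].
apply/P; exists (V `&` W); split => //.
- exact: openI.
- by move=> a [/VU].
- move=> k; apply: Ck_mul; first exact: openI.
  + by apply: Ck_sub (CV k) => a [].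
  + by apply: Ck_sub (CW k) => a [].
Qed.

Lemma smooth_near_pt x f : smooth_at x f -> \forall y \near x, smooth_at y f.
Proof.
have [U [phi [psi [Ux ch P]]]] := smooth_chartP x.
move=> /P [V [oV Vx VU CV]].
case: ch => [[oU oP] pK cphi cpsi sm].
have nV : \forall y \near x, V (phi y).
  by apply: (cphi x Ux); exact: open_nbhs_nbhs.
have nU : \forall y \near x, U y by exact: open_nbhs_nbhs.
near=> y.
have Uy : U y by near: y.
by apply/(sm y f Uy); exists V; split => //; near: y.
Unshelve. all: by end_near. Qed.

Lemma smooth_continuous x f : smooth_at x f -> {for x, continuous f}.
Proof.
have [U [phi [psi [Ux ch P]]]] := smooth_chartP x.
move=> /P [V [oV Vx VU CV]].
case: ch => [[oU oP] pK cphi cpsi sm].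
have [cf _] := CV 0%N.
have nU : \forall y \near x, f y = (f \o psi \o phi) y.
  by apply: filterS (open_nbhs_nbhs (conj oU Ux)) => y Uy /=; rewrite pK.
have H : {for x, continuous (f \o psi \o phi)}.
  by apply: continuous_comp; [exact: cphi|exact: cf].
by apply: continuous_at_ext H; apply: filterS nU => y.
Qed.

Lemma smooth_inv x f : smooth_at x f -> f x != 0 ->
  smooth_at x (fun y => (f y)^-1).
Proof.
have [U [phi [psi [Ux ch P]]]] := smooth_chartP x.
move=> /P [V [oV Vx VU CV]] fx0.
have [cf _] := CV 0%N.
have fpx : (f \o psi) (phi x) != 0.
  by case: ch => [_ pK _ _ _]; rewrite /= pK.
have : nbhs (phi x) [set a | (f \o psi) a != 0].
  have N : nbhs ((f \o psi) (phi x)) [set y | y != 0].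
    by apply: open_nbhs_nbhs; split => //; exact: open_neq.
  exact: (cf _ Vx _ N).
rewrite nbhsE => -[W [oW Wx] Wf].
apply/P; exists (V `&` W); split => //.
- exact: openI.
- by move=> a [/VU].
- move=> k; apply: Ck_inv; [exact: openI|by move=> a [_ /Wf]|].
  by apply: Ck_sub (CV k) => a [].
Qed.

Lemma smooth_neq0 x f : smooth_at x f -> f x != 0 -> \forall y \near x, f y != 0.
Proof.
move=> /smooth_continuous cf fx0.
have N : nbhs (f x) [set y | y != 0].
  by apply: open_nbhs_nbhs; split => //; exact: open_neq.
exact: (cf _ N).
Qed.

End Manifold.
End SmoothFunctions.

(** * Linear algebra and Cramer's rule for germs *)

Section LinearMaps.
Variables (R : realType) (U V W : lmodType R) (f : U -> V).
Hypothesis lf : linear f.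

Lemma linD u v : f (u + v) = f u + f v.
Proof. by rewrite -[u in LHS]scale1r lf scale1r. Qed.
Lemma lin0 : f 0 = 0.
Proof. by apply: (@addrI _ (f 0)); rewrite -linD !addr0. Qed.
Lemma linZ a u : f (a *: u) = a *: f u.
Proof. by rewrite -[a *: u]addr0 lf lin0 addr0. Qed.
Lemma linN u : f (- u) = - f u.
Proof. by rewrite -scaleN1r linZ scaleN1r. Qed.
Lemma linB u v : f (u - v) = f u - f v.
Proof. by rewrite linD linN. Qed.
Lemma lin_sum I (r : seq I) (P : pred I) (F : I -> U) :
  f (\sum_(i <- r | P i) F i) = \sum_(i <- r | P i) f (F i).
Proof. by apply: big_morph; [exact: linD|exact: lin0]. Qed.
Lemma lin_comp (h : V -> W) : linear h -> linear (h \o f).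
Proof. by move=> lh a u v /=; rewrite lf lh. Qed.
End LinearMaps.

Section LinearAlgebra.
Variable R : realType.

(** Among the matrices whose rows lie in P take one of maximal rank: adjoining an element c of P
    cannot raise the rank, so c is already in the row space. *)
Lemma rV_subspace n (P : set 'rV[R]_n) : Defs.subspace P ->
  exists M : 'M[R]_n, forall c, P c <-> (c <= M)%MS.
Proof.
move=> [P0 Pl].
have PD u v : P u -> P v -> P (u + v) by move=> Pu Pv; rewrite -[u]scale1r; exact: Pl.
pose good k := `[< exists M : 'M[R]_n, (forall c : 'rV_n, (c <= M)%MS -> P c) /\ \rank M = k >].
have ex : exists k, good k.
  exists 0%N; apply/asboolP; exists 0; split; last by rewrite mxrank0.
  by move=> c; rewrite submx0 => /eqP ->.
have bd k : good k -> (k <= n)%N.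
  by move=> /asboolP[M [_ <-]]; exact: rank_leq_row.
case: (ex_maxnP ex bd) => k /asboolP[M [MP rM]] kmax.
exists M => c; split; last exact: MP.
move=> Pc.
have le : (M <= M + c)%MS by exact: addsmxSl.
have : good (\rank (M + c)%MS).
  apply/asboolP; exists (M + c)%MS; split => // c' /sub_addsmxP [[u1 u2] /= ->].
  apply: PD; first by apply: MP; exact: submxMl.
  have -> : u2 *m c = u2 0 0 *: c.
    by rewrite {1}(mx11_scalar u2) mul_scalar_mx.
  by rewrite -[_ *: c]addr0; exact: Pl.
move=> /kmax; rewrite -rM => rle.
have : (M == M + c)%MS by rewrite -(geq_leqif (mxrank_leqif_eq le)).
by move=> /andP[_] H; apply: submx_trans H; exact: addsmxSr.
Qed.

(** V modulo the common kernel of the L_i embeds in R^I. The e_i lift a basis of the image, and the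
    c_i are the coordinates along it. *)
Lemma fin_basis (V : lmodType R) (I : finType) (L : I -> V -> R^o) :
  (forall i, linear (L i)) ->
  exists r (e : 'I_r -> V) (c : 'I_r -> V -> R^o),
  [/\ forall i, linear (c i),
      forall v, (forall k, L k v = 0) -> forall i, c i v = 0,
      forall i j, c i (e j) = (i == j)%:R &
      forall v k, L k (v - \sum_i c i v *: e i) = 0].
Proof.
move=> lL.
pose vL v : 'rV[R]_#|I| := \row_j L (enum_val j) v.
have lvL : linear vL by move=> a u v; apply/rowP => j; rewrite !mxE lL.
have [|M MP] := @rV_subspace _ [set c | exists v, c = vL v].
  split; first by exists 0; rewrite lin0.
  by move=> a u v [u' ->] [v' ->]; exists (a *: u' + v'); rewrite lvL.
set r := \rank M; pose B := row_base M.
have Bi i : exists v, row i B = vL v.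
  by apply/MP; rewrite -(eq_row_base M); exact: row_sub.
have [e eP] := choice Bi.
exists r, e, (fun i v => (vL v *m pinvmx B) 0 i).
have fB : row_free B by exact: row_base_free.
split.
- by move=> i a u v; rewrite lvL mulmxDl -scalemxAl !mxE.
- move=> v Lv i; have -> : vL v = 0 by apply/rowP => j; rewrite !mxE Lv.
  by rewrite mul0mx mxE.
- move=> i j; rewrite -eP -row_mul mulmxVp // rowE mulmx1 mxE eqxx /=.
  by rewrite eq_sym.
move=> v k; set c := vL v *m pinvmx B.
suff : vL (v - \sum_i c 0 i *: e i) = 0.
  by move=> /rowP/(_ (enum_rank k)); rewrite !mxE enum_rankK.
rewrite linB // lin_sum //.
under eq_bigr do rewrite linZ // -eP.
have -> : \sum_i c 0 i *: row i B = c *m B by rewrite mulmx_sum_row.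
rewrite mulmxKpV ?subrr // (eq_row_base M).
by apply/MP; exists v.
Qed.

(** The e_i may be dependent, so the chosen coordinates s need not be linear. They are linear modulo
    the relations among the e_i, which [cokermx] factors out. *)
Lemma span_coords (V : lmodType R) (f : V -> V) r (e : 'I_r -> V) : linear f ->
  (forall v, exists c : 'rV[R]_r, f v = \sum_i c 0 i *: e i) ->
  exists c : 'I_r -> V -> R^o, (forall i, linear (c i)) /\
    forall v, (forall i, c i v = 0) <-> f v = 0.
Proof.
move=> lf /choice [s sP].
pose ev (c : 'rV[R]_r) := \sum_i c 0 i *: e i.
have lev : linear ev.
  move=> a u v; rewrite /ev scaler_sumr -big_split /=; apply: eq_bigr => i _.
  by rewrite !mxE scalerDl scalerA.
have [|M MP] := @rV_subspace _ [set c | ev c = 0].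
  split; first by rewrite /= lin0.
  by move=> a u v /= u0 v0; rewrite lev u0 v0 scaler0 addr0.
exists (fun i v => (s v *m cokermx M) 0 i); split.
  move=> i a u v.
  have : (s (a *: u + v) - (a *: s u + s v)) *m cokermx M = 0.
    apply/eqP; rewrite -submxE; apply/MP => /=.
    by rewrite linB // lev /ev -!sP lf subrr.
  rewrite mulmxBl => /eqP; rewrite subr_eq0 => /eqP ->.
  by rewrite mulmxDl -scalemxAl !mxE.
move=> v; rewrite sP -/(ev (s v)).
have -> : (ev (s v) = 0) = (s v *m cokermx M == 0).
  apply/propext; rewrite -submxE; exact: MP.
split=> [H|/eqP -> i]; last by rewrite mxE.
by apply/eqP/rowP => i; rewrite H mxE.
Qed.

(** Choose as many points as possible with independent rows. If there were fewer than r, some c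
    different from 0 would be orthogonal to all rows; independence gives a point t whose row is not
    orthogonal to c, and it could be added. *)
Lemma separating_points (T : Type) (Q : set T) r (v : 'I_r -> T -> R) :
  (forall c : 'rV[R]_r, (forall t, Q t -> \sum_i c 0 i * v i t = 0) -> c = 0) ->
  exists s : 'I_r -> T, (forall j, Q (s j)) /\
    (\matrix_(j, i) v i (s j)) \in unitmx.
Proof.
move=> indep.
pose mx k (s : 'I_k -> T) : 'M[R]_(k, r) := \matrix_(j, i) v i (s j).
pose good k := `[< exists s : 'I_k -> T, (forall j, Q (s j)) /\ row_free (mx k s) >].
have ex : exists k, good k.
  exists 0%N; apply/asboolP.
  exists (fun i : 'I_0 => False_rect T (notF (ltn_ord i))); split; first by move=> [].
  by rewrite /row_free -leqn0 rank_leq_row.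
have bd k : good k -> (k <= r)%N.
  move=> /asboolP[s [_ /eqP <-]]; exact: rank_leq_col.
case: (ex_maxnP ex bd) => k /asboolP[s [Qs fs]] kmax.
have rk : \rank (mx k s) = k by apply/eqP.
have [kr|kr] := eqVneq k r.
  by subst k; exists s; split => //; rewrite -row_free_unit.
have klt : (k < r)%N by rewrite ltn_neqAle kr -{1}rk rank_leq_col.
have /rowV0Pn [c /sub_kermxP cs c0] : kermx (mx k s)^T != 0.
  rewrite kermx_eq0 /row_free mxrank_tr rk.
  by rewrite neq_ltn klt.
have [t [Qt ct]] : exists t, Q t /\ \sum_i c 0 i * v i t <> 0.
  apply: contrapT => H; move/eqP: c0; apply; apply: indep => t Qt.
  by apply: contrapT => ct; apply: H; exists t.
pose a : 'rV[R]_r := \row_i v i t.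
have na : ~~ (a <= mx k s)%MS.
  apply/negP => /submxP [D aD]; apply: ct.
  have : a *m c^T = 0 by rewrite aD -mulmxA -[mx k s]trmxK -trmx_mul cs trmx0 mulmx0.
  move=> /rowP/(_ 0); rewrite !mxE; apply: etrans; apply: eq_bigr => i _.
  by rewrite !mxE mulrC.
have : good (k + 1)%N.
  apply/asboolP; exists (fun i : 'I_(k + 1) => match fintype.split i with inl j => s j | inr _ => t end).
  split; first by move=> j; case: (fintype.split j).
  have -> : mx (k + 1)%N (fun i : 'I_(k + 1) => match fintype.split i with inl j => s j | inr _ => t end)
      = col_mx (mx k s) a.
    apply/matrixP => i j; rewrite !mxE.
    by case: (fintype.split i) => i'; rewrite !mxE.
  rewrite -row_leq_rank -addsmxE addn1 -{1}rk.
  have : (mx k s < mx k s + a)%MS.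
    rewrite ltmxE addsmxSl /=; apply/negP => H; move/negP: na; apply.
    by apply: submx_trans H; exact: addsmxSr.
  by rewrite ltmxErank => /andP[].
by move=> /kmax; rewrite addn1 ltnn.
Qed.

End LinearAlgebra.

Section GermAlgebra.
Variable R : realType.

(** Common axioms for the germs at a point of a manifold and at a point of the limit of the tower,
    so that Cramer's rule is proved once for both. *)
Record germ_algebra (S : Type) (F : set_system S) (z : S) (sm : set (S -> R)) : Prop := {
  ga_filter : Filter F;
  ga_pt : forall P, F P -> P z;
  ga_ext : forall f h, sm f -> F [set y | f y = h y] -> sm h;
  ga_cst : forall a, sm (fun=> a);
  ga_add : forall f h, sm f -> sm h -> sm (fun y => f y + h y);
  ga_mul : forall f h, sm f -> sm h -> sm (fun y => f y * h y);
  ga_inv : forall f, sm f -> f z != 0 -> sm (fun y => (f y)^-1);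
  ga_neq0 : forall f, sm f -> f z != 0 -> F [set y | f y != 0] }.

Variables (S : Type) (F : set_system S) (z : S) (sm : set (S -> R)).
Hypothesis ga : germ_algebra F z sm.

Lemma ga_sum I (r : seq I) (P : pred I) (f : I -> S -> R) :
  (forall i, P i -> sm (f i)) -> sm (fun y => \sum_(i <- r | P i) f i y).
Proof.
move=> H; elim: r => [|i r IH].
  by under eq_fun do rewrite big_nil; exact: (ga_cst ga).
under eq_fun do rewrite big_cons.
case Pi: (P i) => //; apply: (ga_add ga) => //; exact: H.
Qed.

Lemma ga_prod I (r : seq I) (P : pred I) (f : I -> S -> R) :
  (forall i, P i -> sm (f i)) -> sm (fun y => \prod_(i <- r | P i) f i y).
Proof.
move=> H; elim: r => [|i r IH].
  by under eq_fun do rewrite big_nil; exact: (ga_cst ga).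
under eq_fun do rewrite big_cons.
case Pi: (P i) => //; apply: (ga_mul ga) => //; exact: H.
Qed.

Lemma ga_det n (A : S -> 'M[R]_n) : (forall i j, sm (fun y => A y i j)) ->
  sm (fun y => \det (A y)).
Proof.
move=> H; apply: ga_sum => s _; apply: (ga_mul ga); first exact: (ga_cst ga).
by apply: ga_prod => i _; exact: H.
Qed.

Lemma ga_invmx n (A : S -> 'M[R]_n) : (forall i j, sm (fun y => A y i j)) ->
  A z \in unitmx ->
  F [set y | A y \in unitmx] /\ forall i j, sm (fun y => invmx (A y) i j).
Proof.
move=> H Az; have dz : \det (A z) != 0 by move: Az; rewrite unitmxE unitfE.
have sd := ga_det H.
have Fd : F [set y | A y \in unitmx].
  have ff := ga_filter ga.
  by apply: filterS (ga_neq0 ga sd dz) => y /=; rewrite unitmxE unitfE.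
split => // i j.
apply: (ga_ext ga (f := fun y => (\det (A y))^-1 * (\adj (A y)) i j)); last first.
  have ff := ga_filter ga.
  by apply: filterS Fd => y /= Ay; rewrite /invmx Ay !mxE.
apply: (ga_mul ga); first exact: (ga_inv ga).
under eq_fun do rewrite mxE /cofactor.
apply: (ga_mul ga); first exact: (ga_cst ga).
apply: ga_det => a b; under eq_fun do rewrite !mxE; exact: H.
Qed.

(* Cramer's rule *)
Lemma ga_coords (V : lmodType R) (T : Type) (Q : set T) r (e : 'I_r -> V)
    (c : 'I_r -> V -> R^o) (N : set V) (Phi : S -> V -> T -> R^o) (u : S -> V) :
  (forall i j, c i (e j) = (i == j)%:R) -> (forall i, linear (c i)) ->
  (forall v, N v -> forall i, c i v = 0) ->
  (forall v, N (v - \sum_i c i v *: e i)) ->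
  F [set y | forall t, Q t -> linear ((Phi y) ^~ t) /\ forall v, N v -> Phi y v t = 0] ->
  (forall v, (forall t, Q t -> Phi z v t = 0) -> N v) ->
  (forall v t, Q t -> sm (fun y => Phi y v t)) ->
  (forall t, Q t -> sm (fun y => Phi y (u y) t)) ->
  forall lam : V -> R^o, linear lam -> (forall v, N v -> lam v = 0) ->
  sm (fun y => lam (u y)).
Proof.
move=> ce lc cN eN FL zN sP su lam ll lN.
have ff := ga_filter ga.
have zL := ga_pt ga FL.
(* The e_i are independent modulo N and [Phi z] detects N, so r test points make the linear system
   for the coordinates invertible at z, hence near z. *)
have [a a0|s [Qs us]] := @separating_points R T Q r (fun i t => Phi z (e i) t).
  apply/rowP => i; rewrite mxE.
  have Nv : N (\sum_i a 0 i *: e i).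
    apply: zN => t Qt; have [lt _] := zL t Qt.
    rewrite (lin_sum lt) -[RHS](a0 t Qt); apply: eq_bigr => j _.
    by rewrite (linZ lt).
  have := cN _ Nv i; rewrite (lin_sum (lc i)) (bigD1 i) //= big1 ?addr0.
    by rewrite (linZ (lc i)) ce eqxx => <-; rewrite /GRing.scale /= mulr1.
  by move=> j ji; rewrite (linZ (lc i)) ce eq_sym (negPf ji) scaler0.
pose A y : 'M[R]_r := \matrix_(j, i) Phi y (e i) (s j).
have sA i j : sm (fun y => A y i j) by under eq_fun do rewrite mxE; exact: sP.
have [FA sI] := ga_invmx sA us.
have lamE v : lam v = \sum_i c i v * lam (e i).
  apply/eqP; rewrite -subr_eq0; apply/eqP; rewrite -[RHS](lN _ (eN v)).
  rewrite (linB ll) (lin_sum ll); congr (_ - _); apply: eq_bigr => i _.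
  by rewrite (linZ ll).
under eq_fun do rewrite lamE.
apply: ga_sum => i _; apply: (ga_mul ga); last exact: (ga_cst ga).
apply: (ga_ext ga (f := fun y => \sum_j invmx (A y) i j * Phi y (u y) (s j))).
  by apply: ga_sum => j _; apply: (ga_mul ga) => //; exact: su.
apply: filterS2 FA FL => y Ay Ly /=.
pose b : 'cV[R]_r := \col_j Phi y (u y) (s j).
pose x : 'cV[R]_r := \col_j c j (u y).
have bE : b = A y *m x.
  apply/colP => j; rewrite !mxE; have [lt Nt] := Ly _ (Qs j).
  have := Nt _ (eN (u y)); rewrite (linB lt) => /eqP; rewrite subr_eq0 => /eqP ->.
  rewrite (lin_sum lt); apply: eq_bigr => k _.
  by rewrite !mxE (linZ lt) /GRing.scale /= mulrC.
have : invmx (A y) *m b = x by rewrite bE mulKmx.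
by move=> /colP/(_ i); rewrite !mxE => <-; apply: eq_bigr => j _; rewrite mxE.
Qed.

End GermAlgebra.

Lemma smooth_germ_algebra (R : realType) (M : manifold R) (x : M) :
  germ_algebra (nbhs x) x (smooth_at x).
Proof.
split.
- exact: nbhs_filter.
- by move=> P; exact: nbhs_singleton.
- exact: smooth_ext.
- exact: smooth_cst.
- exact: smooth_add.
- exact: smooth_mul.
- exact: smooth_inv.
- exact: smooth_neq0.
Qed.

(** * Graded Lie algebras *)

Section Ranges.

Lemma mem_irange (a b i : int) : (i \in irange a b) = (a <= i <= b).
Proof.
rewrite /irange; case: ifP => ab; last first.
  by rewrite in_nil; apply/esym/negbTE; lia.
apply/mapP/idP => [[j]|/andP[ai ib]].
  by rewrite mem_iota => H ->; lia.
exists (absz (i - a)); first by rewrite mem_iota; lia.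
lia.
Qed.

Lemma irange_uniq (a b : int) : uniq (irange a b).
Proof.
rewrite /irange; case: ifP => // _; rewrite map_inj_uniq ?iota_uniq //.
by move=> i j /addrI [].
Qed.

Lemma irange_sum_sub (G : nmodType) (r : seq int) (F : int -> G) (a b : int) :
  uniq r -> (forall i, i \in irange a b -> i \notin r -> F i = 0) ->
  (forall i, i \in r -> i \notin irange a b -> F i = 0) ->
  \sum_(i <- irange a b) F i = \sum_(i <- r) F i.
Proof.
move=> ur H1 H2.
have E (s t : seq int) : uniq s -> uniq t ->
    (forall i, i \in s -> i \notin t -> F i = 0) ->
    \sum_(i <- s) F i = \sum_(i <- s | i \in t) F i.
  move=> us ut H; rewrite big_seq (bigID (fun i => i \in t)) /= [X in _ + X]big1 ?addr0.
    by rewrite [RHS]big_seq_cond.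
  by move=> i /andP[]; exact: H.
rewrite (E _ r) ?irange_uniq // [RHS](E _ (irange a b)) ?irange_uniq //.
rewrite -[LHS]big_filter -[RHS]big_filter; apply: perm_big; apply: uniq_perm; rewrite ?filter_uniq ?irange_uniq //.
by move=> i; rewrite !mem_filter andbC.
Qed.

Lemma irange_sum1 (G : nmodType) (F : int -> G) (a b j : int) :
  (forall i, i \in irange a b -> i != j -> F i = 0) ->
  (~~ (a <= j <= b) -> F j = 0) ->
  \sum_(i <- irange a b) F i = F j.
Proof.
move=> H1 H2; rewrite (@irange_sum_sub _ [:: j]) ?big_seq1 //.
  by move=> i ir; rewrite inE; exact: H1.
by move=> i; rewrite inE mem_irange => /eqP ->.
Qed.

End Ranges.

Section GradedFacts.
Variables (R : realType) (g : gradedLie R).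
Implicit Types (u v w : g) (p q m : int).
Local Notation dp := (depth g)%:Z.

Lemma compD p u v : comp p (u + v) = comp p u + comp p v.
Proof. exact: linD (@comp_linear R g p) u v. Qed.
Lemma compB p u v : comp p (u - v) = comp p u - comp p v.
Proof. exact: linB (@comp_linear R g p) u v. Qed.
Lemma compN p u : comp p (- u) = - comp p u.
Proof. exact: linN (@comp_linear R g p) u. Qed.
Lemma compZ p a u : comp p (a *: u) = a *: comp p u.
Proof. exact: linZ (@comp_linear R g p) a u. Qed.
Lemma comp0 p : comp p (0 : g) = 0.
Proof. exact: lin0 (@comp_linear R g p). Qed.
Lemma comp_sum p I (r : seq I) (P : pred I) (F : I -> g) :
  comp p (\sum_(i <- r | P i) F i) = \sum_(i <- r | P i) comp p (F i).
Proof. exact: (lin_sum (@comp_linear R g p)). Qed.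

Lemma comp_id p v : comp p (comp p v) = comp p v.
Proof. by rewrite comp_comp eqxx. Qed.
Lemma homog_comp p v : homog p (comp p v).
Proof. exact: comp_id. Qed.
Lemma comp_homog p q v : homog p v -> comp q v = if q == p then v else 0.
Proof. by move=> hv; rewrite -{1}hv comp_comp; case: eqP => [->|]. Qed.
Lemma homog0 p : homog p (0 : g).
Proof. exact: comp0. Qed.
Lemma homog_depth p v : homog p v -> p < - dp -> v = 0.
Proof. by move=> hv pd; rewrite -hv comp_depth. Qed.

Lemma filt_lin q a u v : filt q u -> filt q v -> filt q (a *: u + v).
Proof. by move=> fu fv p pq; rewrite compD compZ fu // fv // scaler0 addr0. Qed.
Lemma filt0 q : filt q (0 : g).
Proof. by move=> p _; rewrite comp0. Qed.
Lemma filtD q u v : filt q u -> filt q v -> filt q (u + v).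
Proof. by move=> fu fv; rewrite -[u]scale1r; exact: filt_lin. Qed.
Lemma filtZ q a u : filt q u -> filt q (a *: u).
Proof. by move=> fu; rewrite -[_ *: _]addr0; apply: filt_lin => //; exact: filt0. Qed.
Lemma filtN q u : filt q u -> filt q (- u).
Proof. by move=> fu; rewrite -scaleN1r; exact: filtZ. Qed.
Lemma filtB q u v : filt q u -> filt q v -> filt q (u - v).
Proof. by move=> fu fv; apply: filtD => //; exact: filtN. Qed.
Lemma filtBC q u v : filt q (u - v) -> filt q (v - u).
Proof. by move=> /filtN; rewrite opprB. Qed.
Lemma filtB_trans q u v w : filt q (u - v) -> filt q (v - w) -> filt q (u - w).
Proof. by move=> /filtD H /H; rewrite addrA subrK. Qed.
Lemma filt_sum q I (r : seq I) (P : pred I) (F : I -> g) :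
  (forall i, P i -> filt q (F i)) -> filt q (\sum_(i <- r | P i) F i).
Proof. by move=> H; elim/big_ind : _ => //; [exact: filt0|exact: filtD]. Qed.
Lemma filt_le q q' v : q' <= q -> filt q v -> filt q' v.
Proof. by move=> qq fv p pq; apply: fv; apply: lt_le_trans qq. Qed.
Lemma filt_depth q v : q <= - dp -> filt q v.
Proof. by move=> qd p pq; apply: comp_depth; lia. Qed.
Lemma homog_filt p q v : homog p v -> q <= p -> filt q v.
Proof. by move=> hv qp r rq; rewrite (comp_homog _ hv); case: eqP => // E; lia. Qed.
Lemma filtS q v : filt q v -> comp q v = 0 -> filt (q + 1) v.
Proof.
move=> fv cv p pq; have [->//|pq'] := eqVneq p q.
by apply: fv; lia.
Qed.
Lemma filt_homog0 p q v : filt q v -> homog p v -> p < q -> v = 0.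
Proof. by move=> fv hv pq; rewrite -hv; exact: fv. Qed.

Lemma comp_neg p v : comp p (neg v) = if p < 0 then comp p v else 0.
Proof. by rewrite /neg comp_assemble; case: ifP => // _; rewrite comp0. Qed.
Lemma comp_pos p v : comp p (pos v) = if 0 <= p then comp p v else 0.
Proof. by rewrite /pos comp_assemble; case: ifP => // _; rewrite comp0. Qed.
Lemma neg_linear : linear (@neg R g).
Proof.
move=> a u v; apply: comp_sep => p; rewrite compD compZ !comp_neg compD compZ.
by case: ifP => // _; rewrite scaler0 addr0.
Qed.
Lemma pos_linear : linear (@pos R g).
Proof.
move=> a u v; apply: comp_sep => p; rewrite compD compZ !comp_pos compD compZ.
by case: ifP => // _; rewrite scaler0 addr0.
Qed.
Lemma neg_homog p v : homog p v -> neg v = if p < 0 then v else 0.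
Proof.
move=> hv; apply: comp_sep => q.
rewrite comp_neg (fun_if (comp q)) comp0 (comp_homog q hv).
by case: eqVneq => [->|_]; last by rewrite !if_same.
Qed.
Lemma pos_homog p v : homog p v -> pos v = if 0 <= p then v else 0.
Proof.
move=> hv; apply: comp_sep => q.
rewrite comp_pos (fun_if (comp q)) comp0 (comp_homog q hv).
by case: eqVneq => [->|_]; last by rewrite !if_same.
Qed.
Lemma filt_neg q v : filt q v -> filt q (neg v).
Proof. by move=> fv p pq; rewrite comp_neg fv // if_same. Qed.
Lemma negD_pos v : neg v + pos v = v.
Proof.
apply: comp_sep => p; rewrite compD comp_neg comp_pos.
by case: (ltP p 0); rewrite ?addr0 ?add0r.
Qed.
Lemma neg_filt0 v : filt 0 v -> neg v = 0.
Proof.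
move=> fv; apply: comp_sep => p; rewrite comp_neg comp0.
by case: ifP => // p0; exact: fv.
Qed.

Definition trunc (n : int) v : g := \sum_(p <- irange (- dp) (n - 1)) comp p v.

Lemma comp_trunc n p v : comp p (trunc n v) = if p < n then comp p v else 0.
Proof.
rewrite /trunc comp_sum.
have [pn|pn] := ltP p n.
  rewrite (irange_sum1 (j := p)) /= ?comp_id //.
  - by move=> i _ ip; rewrite comp_comp eq_sym (negPf ip).
  - by move=> H; rewrite comp_depth //; lia.
rewrite big_seq big1 // => i; rewrite mem_irange => H.
by rewrite comp_comp; case: eqP => // E; lia.
Qed.

Lemma trunc_filt n v : filt n (v - trunc n v).
Proof. by move=> p pn; rewrite compB comp_trunc pn subrr. Qed.

Lemma brDl u v w : br (u + v) w = br u w + br v w.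
Proof. exact: (linD ((@br_bilinear R g).2 w)). Qed.
Lemma br0l u : br 0 u = 0 :> g.
Proof. exact: (lin0 ((@br_bilinear R g).2 u)). Qed.
Lemma br0r u : br u 0 = 0 :> g.
Proof. exact: (lin0 ((@br_bilinear R g).1 u)). Qed.
Lemma brNl u v : br (- u) v = - br u v.
Proof. exact: (linN ((@br_bilinear R g).2 v)). Qed.
Lemma brNr u v : br u (- v) = - br u v.
Proof. exact: (linN ((@br_bilinear R g).1 u)). Qed.
Lemma brZl a u v : br (a *: u) v = a *: br u v.
Proof. exact: (linZ ((@br_bilinear R g).2 v)). Qed.
Lemma brZr a u v : br u (a *: v) = a *: br u v.
Proof. exact: (linZ ((@br_bilinear R g).1 u)). Qed.
Lemma br_sumr u I (r : seq I) (P : pred I) (F : I -> g) :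
  br u (\sum_(i <- r | P i) F i) = \sum_(i <- r | P i) br u (F i).
Proof. exact: (lin_sum ((@br_bilinear R g).1 u)). Qed.

Lemma altC (c : g -> g -> g) : bilinear_map c -> alternating_map c ->
  forall u v, c u v = - c v u.
Proof.
move=> [cl cr] ca u v; apply/eqP; rewrite -addr_eq0; apply/eqP.
have := ca (u + v); rewrite (linD (cl _)) !(linD (cr _)) !ca.
by rewrite addr0 add0r addrC.
Qed.
Lemma brC u v : br u v = - br v u.
Proof. exact: altC (@br_bilinear R g) (@br_alternating R g) u v. Qed.

Lemma filt_br p q u v : filt p u -> filt q v -> filt (p + q) (br u v).
Proof.
move=> fu fv m mpq; rewrite br_comp big1_seq // => i _.
have [ip|pi] := ltP i p; first by rewrite fu // br0l.
by rewrite (fv (m - i)) ?br0r //; lia.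
Qed.

Lemma comp_br p q u v : filt p u -> filt q v ->
  comp (p + q) (br u v) = br (comp p u) (comp q v).
Proof.
move=> fu fv; rewrite br_comp (irange_sum1 (j := p)); last 2 first.
- move=> i _ ip; have [ip'|pi] := ltP i p; first by rewrite fu // br0l.
  by rewrite (fv (p + q - i)) ?br0r //; lia.
- move=> H; have [pd|pd] := ltP p (- dp); first by rewrite comp_depth // br0l.
  by rewrite (comp_depth (p := p + q - p)) ?br0r //; lia.
by congr (br _ (comp _ _)); lia.
Qed.

Lemma homog_br p q u v : homog p u -> homog q v -> homog (p + q) (br u v).
Proof.
move=> hu hv; rewrite /homog /= comp_br; last 2 first.
- by apply: homog_filt hu _; lia.
- by apply: homog_filt hv _; lia.
by rewrite hu hv.
Qed.

(** * Unipotent maps of the filtered space *)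

Section FGL.
Implicit Types a b : g -> g.

Lemma FGL_filt k a q v : 0 <= k -> FGL k a -> filt q v -> filt q (a v).
Proof.
move=> k0 [la aF] fv; rewrite -[a v](subrK v); apply: filtD => //.
by apply: filt_le (aF _ _ fv); lia.
Qed.

Lemma FGL_le k k' a : k' <= k -> FGL k a -> FGL k' a.
Proof.
move=> kk [la aF]; split => // q v fv; apply: filt_le (aF _ _ fv); lia.
Qed.

Lemma FGL_id k : FGL k (@id g).
Proof. by split=> // q v fv; rewrite subrr; exact: filt0. Qed.

Lemma FGL_mul k a b : 0 <= k -> FGL k a -> FGL k b -> FGL k (a \o b).
Proof.
move=> k0 Ha Hb; split; first by apply: lin_comp; [exact: Hb.1|exact: Ha.1].
move=> q v fv /=; apply: (@filtB_trans _ _ (b v)); last exact: Hb.2.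
by apply: Ha.2; exact: FGL_filt Hb fv.
Qed.

(** Write v = a v - (a v - v): the correction gains k >= 1 degrees over v, so the degree of v climbs
    to q one step at a time, starting at -depth where every vector lies. *)
Lemma FGL_reflect k a q v : 1 <= k -> FGL k a -> filt q (a v) -> filt q v.
Proof.
move=> k1 Ha fav.
suff H (j : nat) : - dp + j%:Z <= q -> filt (- dp + j%:Z) v.
  have [qd|qd] := leP q (- dp); first exact: filt_depth.
  have := H (absz (q + dp)); have -> : - dp + (absz (q + dp))%:Z = q by lia.
  by apply.
elim: j => [|j IH] jq; first by apply: filt_depth; lia.
have fv : filt (- dp + j%:Z) v by apply: IH; lia.
have -> : v = a v - (a v - v) by rewrite subKr.
apply: filtB; first by apply: filt_le fav; lia.
by apply: filt_le (Ha.2 _ _ fv); lia.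
Qed.

(* Modulo F^n, the inverse of the unipotent map a is a finite Neumann series. *)
Lemma FGL_inv k a n : 1 <= k -> FGL k a -> exists b,
  [/\ FGL k b, forall v, filt n (a (b v) - v) & forall v, filt n (b (a v) - v)].
Proof.
move=> k1 Ha; pose N v := a v - v.
have lN : linear N.
  move=> c u v; rewrite /N Ha.1 scalerBr opprD addrACA; congr (_ + _).
have NF q v : filt q v -> filt (q + k) (N v) by move=> fv; exact: Ha.2.
pose L j : g -> g := iter j (fun b v => v - N (b v)) id.
have LF j : FGL k (L j).
  elim: j => [|j IH]; first exact: FGL_id.
  split.
    move=> c u v /=; rewrite -/(L j) IH.1 lN.
    by rewrite [c *: (u - _)]scalerBr opprD addrACA.
  move=> q v fv /=; rewrite -/(L j) addrC addKr; apply: filtN; apply: NF.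
  by apply: FGL_filt IH fv; lia.
have LS j v : filt (- dp + j%:Z) (L j.+1 v - L j v).
  elim: j => [|j IH]; first by apply: filt_depth; lia.
  have -> : L j.+2 v - L j.+1 v = - N (L j.+1 v - L j v).
    have LE i : L i.+1 v = v - N (L i v) by [].
    rewrite (linB lN) (LE j.+1) {2}(LE j) !opprB.
    by rewrite addrC addrA subrK.
  by apply: filtN; apply: filt_le (NF _ _ IH); lia.
(* The first difference of the partial sums lies in F^(-depth), and each application of N gains at
   least one degree; J steps therefore reach F^n. *)
pose J := absz (n + dp); pose b := L J.+1.
have rinv v : filt n (a (b v) - v).
  have bE : v - b v = N (L J v) by rewrite /b /= subKr.
  have -> : a (b v) - v = N (b v - L J v).
    by rewrite (linB lN) -bE -(opprB (b v) v) opprK addrA subrK.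
  apply: filt_le (NF _ _ (LS J v)); rewrite /J; lia.
exists b; split; [exact: LF|exact: rinv|move=> v].
apply: (FGL_reflect k1 Ha); rewrite (linB Ha.1).
exact: rinv.
Qed.

End FGL.

Section Basis.
Hypothesis tr : transitive_gl g.

(** The vectors spanning g_p need not be homogeneous, hence the projection [comp p] in the
    conclusion. Only the degrees -depth, ..., -1 occur, which keeps J finite. *)
Lemma neg_spanned : exists (J : finType) (d : J -> int) (e : J -> g),
  (forall j, d j < 0) /\ forall p X, p < 0 -> homog p X ->
    exists r (s : 'I_r -> J) (c : 'I_r -> R),
      (forall i, d (s i) = p) /\ X = \sum_i c i *: comp p (e (s i)).
Proof.
have H (q : 'I_(depth g)) : exists re : {r : nat & 'I_r -> g},
    forall v, exists c : 'rV[R]_(tag re),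
      comp (- (q.+1)%:Z) v = \sum_i c 0 i *: tagged re i.
  have [//|r [e He]] := @neg_findim R g (- (q.+1)%:Z).
  by exists (existT _ r e).
have [re reP] := choice H.
pose J := {q : 'I_(depth g) & 'I_(tag (re q))}.
exists J, (fun j : J => - ((nat_of_ord (tag j)).+1)%:Z),
  (fun j : J => tagged (re (tag j)) (tagged j)).
split; first by [].
move=> p X p0 hX.
have [pd|pd] := ltP p (- dp).
  exists 0%N, (fun i : 'I_0 => False_rect J (notF (ltn_ord i))),
    (fun=> 0).
  by split; [case|rewrite (homog_depth hX pd) big_ord0].
have ltq : ((absz p).-1 < depth g)%N by lia.
pose q := Ordinal ltq.
have qp : - (q.+1)%:Z = p by rewrite /=; lia.
have [c] := reP q X; rewrite qp hX => Xc.
exists (tag (re q)), (fun i => Tagged _ i), (fun i => c 0 i); split => //.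
rewrite -[LHS]hX {1}Xc comp_sum; apply: eq_bigr => i _.
by rewrite compZ.
Qed.

(* By transitivity an element of degree n >= 0 is determined by its brackets    *)
(* with a finite spanning set of g_-, which have degree < n.                   *)
Lemma finite_separation m : exists (I : finType) (L : I -> g -> R^o),
  (forall i, linear (L i)) /\ forall v, (forall i, L i v = 0) <-> filt m v.
Proof.
suff H (k : nat) : exists (I : finType) (L : I -> g -> R^o),
    (forall i, linear (L i)) /\
    forall v, (forall i, L i v = 0) <-> filt (- dp + k%:Z) v.
  have [md|md] := leP m (- dp).
    exists void, (fun i => of_void _ i); split; first by [].
    by move=> v; split => // _; exact: filt_depth.
  have := H (absz (m + dp)).
  by have -> : - dp + (absz (m + dp))%:Z = m by lia.
elim: k => [|k [I [L [lL LP]]]].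
  exists void, (fun i => of_void _ i); split; first by [].
  by move=> v; split => // _; apply: filt_depth; lia.
have -> : - dp + k.+1%:Z = (- dp + k%:Z) + 1 by lia.
move: LP; set n := (- dp + k%:Z) => LP.
have stepP (v : g) : filt (n + 1) v <-> filt n v /\ comp n v = 0.
  split=> [fv|[]]; last exact: filtS.
  by split; [apply: filt_le fv; lia|apply: fv; lia].
have [n0|n0] := ltP n 0.
  have [r [e He]] := @neg_findim R g n n0.
  have [c [lc cP]] := span_coords (@comp_linear R g n) He.
  exists (I + 'I_r)%type, (fun s => match s with inl i => L i | inr j => c j end).
  split; first by case.
  move=> v; rewrite stepP -LP -cP; split.
    by move=> H; split=> i; [exact: (H (inl i))|exact: (H (inr i))].
  by move=> [H1 H2] [i|j].
have [J [d [e [d0 eP]]]] := neg_spanned.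
exists (I + I * J)%type, (fun s v => match s with inl i => L i v
  | inr ij => L ij.1 (br (comp n v) (comp (d ij.2) (e ij.2))) end).
split.
  case=> [i|[i j]] //= a u v; rewrite compD compZ brDl brZl; exact: lL.
move=> v; rewrite stepP -LP; split; last first.
  by move=> [H1 H2] [i|[i j]] //=; rewrite H2 br0l (lin0 (lL i)).
move=> H; split => [i|]; first exact: (H (inl i)).
apply: (tr n0 (homog_comp n v)) => p X p0 hX.
have [r [s [c [ds ->]]]] := eP p X p0 hX.
rewrite br_sumr big1 // => i0 _; rewrite brZr.
have -> : br (comp n v) (comp p (e (s i0))) = 0; last by rewrite scaler0.
apply: (@filt_homog0 (n + p) n); last by lia.
  by apply/LP => i; have := H (inr (i, s i0)); rewrite /= ds.
by apply: homog_br; exact: homog_comp.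
Qed.

(** A dual basis of g / F^m, whose finite dimension in degrees >= 0 is a consequence of transitivity
    through [finite_separation]. *)
Lemma graded_basis m : exists r (e : 'I_r -> g) (c : 'I_r -> g -> R^o),
  [/\ forall i, linear (c i), forall v, filt m v -> forall i, c i v = 0,
      forall i j, c i (e j) = (i == j)%:R &
      forall v, filt m (v - \sum_i c i v *: e i)].
Proof.
have [I [L [lL LP]]] := finite_separation m.
have [r [e [c [lc cL ce cs]]]] := fin_basis lL.
exists r, e, c; split => //.
- by move=> v /LP; exact: cL.
- by move=> v; apply/LP => i; exact: cs.
Qed.

End Basis.
End GradedFacts.

(** * Frames *)

Section Frames.
Variables (R : realType) (g : gradedLie R) (T : towerData g).
Hypothesis tr : transitive_gl g.
Hypothesis gt : geometric_tower T.
Implicit Types (n : nat) (p q : int) (u v A : g).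

Lemma tvecE (M : manifold R) (a : R) (u v : tvec M) f :
  (a *: u + v) f = a * u f + v f.
Proof. reflexivity. Qed.

Lemma tvec_sum (M : manifold R) I (r : seq I) (P : pred I) (F : I -> tvec M) f :
  (\sum_(i <- r | P i) F i) f = \sum_(i <- r | P i) F i f.
Proof. by elim/big_rec2 : _ => [|i y1 y2 _ <-]. Qed.

Lemma push_linear (M N : manifold R) (h : M -> N) x : linear (push h x).
Proof.
move=> a u v; apply/funext => f; rewrite [RHS]tvecE /push.
by case: ifP => _; rewrite ?mulr0 ?addr0.
Qed.

Lemma pushE (M N : manifold R) (h : M -> N) x (v : tvec M) f :
  smooth_at (h x) f -> push h x v f = v (f \o h).
Proof. by move=> sf; rewrite /push asboolT. Qed.

Lemma frame_iso n (z : tQ T n) zeta : frame z zeta -> filtered_iso z zeta.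
Proof. by case: n z zeta => [|n] z zeta; [case|case]. Qed.

Lemma filtered_iso_FGL n (z : tQ T n) zeta a : FGL n.+1%:Z a ->
  filtered_iso z zeta -> filtered_iso z (zeta \o a).
Proof.
move=> Ha [lz kz tz Fz].
have n1 : (1 : int) <= n.+1%:Z by lia.
have [b [Hb ab _]] := FGL_inv n%:Z n1 Ha.
have zab u : zeta (a (b u)) = zeta u.
  by apply/eqP; rewrite -subr_eq0 -(linB lz); apply/eqP/kz.
split.
- by apply: lin_comp; [exact: Ha.1|].
- move=> v /=; rewrite kz; split => [|fv]; first exact: FGL_reflect Ha.
  by apply: FGL_filt Ha fv; lia.
- rewrite -tz; apply/seteqP; split=> w [u _ <-].
    by exists (a u).
  by exists (b u) => //=; rewrite zab.
- move=> p; rewrite -Fz; apply/seteqP; split=> w [u fu <-].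
    by exists (a u) => //; apply: FGL_filt Ha fu; lia.
  exists (b u); last by rewrite /= zab.
  by apply: FGL_filt Hb fu; lia.
Qed.

Lemma filtered_iso_eq n (z : tQ T n) zeta u v : filtered_iso z zeta ->
  zeta u = zeta v <-> filt n%:Z (u - v).
Proof.
move=> [lz kz _ _]; rewrite -kz (linB lz); split=> [->|/eqP]; first by rewrite subrr.
by rewrite subr_eq0 => /eqP.
Qed.

Lemma filtered_iso_TF n (z : tQ T n) zeta p v : filtered_iso z zeta ->
  p <= n%:Z -> TF p z (zeta v) <-> filt p v.
Proof.
move=> iz pn; have [lz kz _ Fz] := iz; rewrite -Fz; split; last by exists v.
move=> [u fu /(filtered_iso_eq _ _ iz) uv].
have -> : v = u - (u - v) by rewrite subKr.
by apply: filtB => //; exact: filt_le uv.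
Qed.

Section Classes.
Variable n : nat.
Implicit Types (w z : tQ T n.+1) (zeta : g -> tvec (tQ T n)).

Lemma cls_frame z : exists2 zeta, frame (proj T n z) zeta &
  cls T n z = [set zeta' | exists2 a, FGL n.+1%:Z a & zeta' = zeta \o a].
Proof.
by have [zeta fz E] := ps_class (gt_bundle gt n) z; exists zeta.
Qed.

Lemma cls_nonempty z : exists zeta, cls T n z zeta.
Proof.
have [zeta _ ->] := cls_frame z; exists zeta; exists id => //; exact: FGL_id.
Qed.

Lemma cls_iso z zeta : cls T n z zeta -> filtered_iso (proj T n z) zeta.
Proof.
have [zeta0 f0 ->] := cls_frame z => -[a Ha ->].
by apply: filtered_iso_FGL => //; exact: frame_iso.
Qed.

Lemma cls_FGL z zeta a : FGL n.+1%:Z a -> cls T n z zeta -> cls T n z (zeta \o a).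
Proof.
move=> Ha; have [zeta0 f0 ->] := cls_frame z => -[b Hb ->].
by exists (b \o a) => //; apply: FGL_mul.
Qed.

Lemma cls_rel z zeta zeta' : cls T n z zeta -> cls T n z zeta' ->
  exists2 a, FGL n.+1%:Z a & zeta' = zeta \o a.
Proof.
have [zeta0 /frame_iso f0 ->] := cls_frame z => -[a Ha ->] [a' Ha' ->].
have n1 : (1 : int) <= n.+1%:Z by lia.
have [b [Hb ab _]] := FGL_inv n%:Z n1 Ha.
exists (b \o a'); first by apply: FGL_mul.
apply/funext => v /=; apply/(filtered_iso_eq _ _ f0); apply: filtBC; exact: ab.
Qed.

Lemma proj_surj (x : tQ T n) : exists z, proj T n z = x.
Proof.
have [U [s [Z [t [[_ Ux] sP _ _ _]]]]] := ps_trivial (gt_bundle gt n) x.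
by exists (s x); exact: (sP x Ux).2.
Qed.

(* The class of frames at w is represented by Z (proj w) o rho (t w), which    *)
(* depends smoothly on w.                                                      *)
Lemma smooth_rep (x : tQ T n) : exists U (zeta : tQ T n.+1 -> g -> tvec (tQ T n)),
  [/\ open U, U x, forall w, U (proj T n w) -> cls T n w (zeta w) &
   forall w v f, U (proj T n w) -> smooth_at (proj T n w) f ->
     smooth_at w (fun w' => zeta w' v f)].
Proof.
have [U [s [Z [t [[oU Ux] sP ZP tP wP]]]]] := ps_trivial (gt_bundle gt n) x.
have zcls w : U (proj T n w) -> cls T n w (Z (proj T n w) \o rho T n (t w)).
  move=> Uw; have [_ {1}->] := wP w Uw.
  exact: (ps_act_cls (gt_bundle gt n)) (ZP _ Uw).1.
exists U, (fun w => Z (proj T n w) \o rho T n (t w)); split => // w v f Uw sf.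
have ga := smooth_germ_algebra w.
have [r [e [c [lc cF _ ce]]]] := graded_basis tr n%:Z.
have nU : \forall w' \near w, U (proj T n w').
  have [cp _] := ps_proj_smooth (gt_bundle gt n) w.
  by apply: cp; exact: open_nbhs_nbhs.
apply: (ga_ext ga (f := fun w' => \sum_i c i (rho T n (t w') v) * Z (proj T n w') (e i) f)).
  apply: (ga_sum ga) => i _; apply: (ga_mul ga); last first.
    apply: ((ps_proj_smooth (gt_bundle gt n) w).2 (fun y => Z y (e i) f)).
    exact: (((ZP _ Uw).2 (e i)).2 f sf).
  (* Smoothness of [rho] is given component by component; since c_i vanishes on F^n, finitely many
     components suffice. *)
  have lcF u : c i u = \sum_(p <- irange (- (depth g)%:Z) (n%:Z - 1)) c i (comp p u).
    rewrite -(lin_sum (lc i)); apply/eqP; rewrite -subr_eq0 -(linB (lc i)).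
    by rewrite cF //; exact: trunc_filt.
  under eq_fun do rewrite lcF.
  apply: (ga_sum ga) => p _.
  have [[st1 st2] _] := wP w Uw.
  exact: (st2 _ (ls_smooth (gt_group gt n) p v (t w) (lc i))).
near=> w'.
have Uw' : U (proj T n w') by near: w'.
have [lz kz _ _] : filtered_iso (proj T n (s (proj T n w'))) (Z (proj T n w')).
  rewrite (sP _ Uw').2.
  have := cls_iso (ZP _ Uw').1; by rewrite (sP _ Uw').2.
rewrite /=; set u := rho T n (t w') v.
have : Z (proj T n w') (u - \sum_i c i u *: e i) = 0 by apply/kz.
rewrite (linB lz) (lin_sum lz) => /eqP; rewrite subr_eq0 => /eqP ->.
by rewrite tvec_sum; apply: eq_bigr => i _; rewrite (linZ lz).
Unshelve. all: by end_near. Qed.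

(** The local section is moved through w by the constant group element t w, and then by a constant b
    of F^(n+1)GL so that its value at the base point is the prescribed representative. Constants do
    not affect smoothness. *)
Lemma local_frame w zeta : cls T n w zeta -> exists U (Z : tQ T n -> g -> tvec (tQ T n)),
  [/\ open U, U (proj T n w), Z (proj T n w) = zeta,
      forall y, U y -> exists2 w', proj T n w' = y & cls T n w' (Z y) &
      forall y v, U y -> smooth_vf_at y (Z^~ v)].
Proof.
move=> cz.
have [U [s [Z [t [[oU Ux] sP ZP tP wP]]]]] := ps_trivial (gt_bundle gt n) (proj T n w).
have c' y : U y -> cls T n (act T n (s y) (t w)) (Z y \o rho T n (t w)).
  by move=> Uy; exact: (ps_act_cls (gt_bundle gt n)) (ZP _ Uy).1.
have cw := c' _ Ux; rewrite -(wP w Ux).2 in cw.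
have [b Hb zE] := cls_rel cw cz.
exists U, (fun y => Z y \o rho T n (t w) \o b); split => //.
- move=> y Uy; exists (act T n (s y) (t w)).
    by rewrite (ps_act_proj (gt_bundle gt n)) (sP _ Uy).2.
  by apply: cls_FGL => //; exact: c'.
- by move=> y v Uy; exact: (ZP y Uy).2.
Qed.

End Classes.

Lemma cls_push n (z : tQ T n.+2) zeta : cls T n.+1 z zeta ->
  cls T n (proj T n.+1 z) (push (proj T n) (proj T n.+1 z) \o zeta).
Proof.
have [zeta0 f0 ->] := cls_frame z => -[a Ha ->].
have [_ _ c0] := f0.
apply: (@cls_FGL n _ (fun v => push (proj T n) (proj T n.+1 z) (zeta0 v)) a) => //.
by apply: FGL_le Ha; lia.
Qed.

(** Representatives differ by some a in F^(n+2)GL, and a A - A then lies in F^(2n+2), inside the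
    kernel F^(n+1) of the frames; so the normalisation on g_n holds for all of them. *)
Lemma cls_fund n (z : tQ T n.+2) zeta A : cls T n.+1 z zeta -> homog n%:Z A ->
  zeta A = fund (proj T n.+1 z) A.
Proof.
have [zeta0 f0 ->] := cls_frame z => -[a Ha ->] hA.
have [i0 F0 _] := f0; rewrite -F0 //=.
apply/(filtered_iso_eq _ _ i0).
by apply: filt_le (Ha.2 _ _ (homog_filt hA (lexx _))); lia.
Qed.

End Frames.

(** * The limit of the tower *)

Lemma dependent_choice_fun (I : Type) (Q : I -> Type) (P : forall i, Q i -> Prop) :
  (forall i, exists x, P i x) -> exists f, forall i, P i (f i).
Proof. by move=> H; exists (fun i => projT1 (cid (H i))) => i; case: cid. Qed.

(** Induction on m drops the bottom level of the tower, which avoids transports between levels; for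
    m = 0 the thread is built from sections of the projections. *)
Lemma tower_lift (Q : nat -> Type) (pr : forall n, Q n.+1 -> Q n) :
  (forall n x, exists y, pr n y = x) ->
  forall m (y : Q m), exists w : forall n, Q n, (forall n, pr n (w n.+1) = w n) /\ w m = y.
Proof.
move=> sP m; elim: m Q pr sP => [|m IH] Q pr sP y.
  have [s sK] : exists s : forall n, Q n -> Q n.+1, forall n x, pr n (s n x) = x.
    apply: (@dependent_choice_fun nat (fun n => Q n -> Q n.+1)
      (fun n s => forall x, pr n (s x) = x)) => n.
    by have [s sK] := choice (sP n); exists s.
  exists (nat_rect Q y s); split => // n; exact: sK.
have [w' [wc <-]] := IH (fun n => Q n.+1) (fun n => pr n.+1) (fun n => sP n.+1) y.
exists (fun n => match n with 0%N => pr 0%N (w' 0%N) | k.+1 => w' k end).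
by split => // -[|n].
Qed.

Section Limit.
Variables (R : realType) (g : gradedLie R) (T : towerData g).
Hypothesis tr : transitive_gl g.
Hypothesis gt : geometric_tower T.
Implicit Types (z w : limQ T) (X Y : forall n, tvec (tQ T n)).

Lemma limQ_surj m (y : tQ T m) : exists w : limQ T, w m = y.
Proof.
have [w [wc wm]] := tower_lift (@proj_surj R g T gt) y.
by exists (LimQ wc).
Qed.

(** The neighbourhood filter of z in the projective limit topology, with the preimages of
    neighbourhoods at finite levels as a base. *)
Definition lnear z : set_system (limQ T) := [set P | exists n (N : set (tQ T n)),
  nbhs (z n) N /\ forall w : limQ T, N (w n) -> P w].

Lemma proj_smooth z n : smooth_map_at (z n.+1) (proj T n).
Proof. exact: (ps_proj_smooth (gt_bundle gt n)). Qed.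

Lemma nbhs_up z n (N : set (tQ T n)) : nbhs (z n) N ->
  nbhs (z n.+1) (proj T n @^-1` N).
Proof. by rewrite -(lpt_compat z); apply: (proj_smooth z n).1. Qed.

Lemma lnear_up z (P : set (limQ T)) : lnear z P -> exists n0, forall n, (n0 <= n)%N ->
  exists N : set (tQ T n), nbhs (z n) N /\ forall w : limQ T, N (w n) -> P w.
Proof.
move=> [n0 [N0 [zN NP]]]; exists n0 => n; elim: n => [|n IH].
  by rewrite leqn0 => /eqP E; subst n0; exists N0.
rewrite leq_eqVlt => /predU1P[E|]; first by subst n0; exists N0.
rewrite ltnS => /IH[N [zN' NP']]; exists (proj T n @^-1` N).
split; first exact: nbhs_up.
by move=> w; rewrite /= lpt_compat; exact: NP'.
Qed.

Lemma lnear_filter z : Filter (lnear z).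
Proof.
split.
- by exists 0%N, setT; split => //; exact: filterT.
- move=> P Q /lnear_up[n Pn] /lnear_up[m Qm].
  have [N [zN NP]] := Pn (maxn n m) (leq_maxl _ _).
  have [N' [zN' NQ]] := Qm (maxn n m) (leq_maxr _ _).
  exists (maxn n m), (N `&` N'); split; first exact: filterI.
  by move=> w [/NP Pw /NQ Qw].
- by move=> P Q PQ [n [N [zN NP]]]; exists n, N; split => // w /NP /PQ.
Qed.
Local Existing Instance lnear_filter.

Lemma lnear_pt z P : lnear z P -> P z.
Proof. by move=> [n [N [zN NP]]]; apply: NP; exact: nbhs_singleton. Qed.

Lemma lnearW z (P : set (limQ T)) : (forall w, P w) -> lnear z P.
Proof. by move=> aP; exists 0%N, setT; split => //; exact: filterT. Qed.

Lemma lnear_nbhs z n (N : set (tQ T n)) : nbhs (z n) N -> lnear z [set w | N (w n)].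
Proof. by move=> zN; exists n, N. Qed.

Lemma lnear_near z P : lnear z P -> lnear z [set w | lnear w P].
Proof.
move=> [n [N [zN NP]]]; exists n, (interior N); split.
  exact: nbhs_interior.
by move=> w Nw; exists n, N.
Qed.

Lemma lrepS z f n h : lrep z f h -> @lrep R g T z f n.+1 (h \o proj T n).
Proof.
move=> [sh [N zN Nf]]; split.
  by apply: (proj_smooth z n).2; rewrite lpt_compat.
exists (proj T n @^-1` N); first exact: nbhs_up.
by move=> w; rewrite /= lpt_compat; exact: Nf.
Qed.

Lemma ltangent_proj z X n h : ltangent z X -> smooth_at (z n) h ->
  X n.+1 (h \o proj T n) = X n h.
Proof.
move=> tX sh; rewrite -[in RHS](tX n).2 pushE // lpt_compat //.
Qed.

Lemma lrep_up z f n m h : (n <= m)%N -> @lrep R g T z f n h ->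
  exists h', @lrep R g T z f m h' /\ forall X, ltangent z X -> X m h' = X n h.
Proof.
move=> nm Hh; elim: m nm => [|m IH].
  by rewrite leqn0 => /eqP E; subst n; exists h.
rewrite leq_eqVlt => /predU1P[E|]; first by subst n; exists h.
rewrite ltnS => /IH[h' [Hh' hX]]; exists (h' \o proj T m); split; first exact: lrepS.
by move=> X tX; rewrite (ltangent_proj tX Hh'.1); exact: hX.
Qed.

(** The limit maps onto every level, so a germ on the limit has at most one representing germ at a
    given level. *)
Lemma lrep_uniq z f n h h' : lrep z f h -> @lrep R g T z f n h' ->
  \forall y \near z n, h y = h' y.
Proof.
move=> [_ [N zN Nf]] [_ [N' zN' Nf']].
apply: filterS2 zN zN' => y; have [w <-] := limQ_surj y.
by move=> Nw Nw'; rewrite -Nf // Nf'.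
Qed.

Lemma is_lderiv_uniq z X f r r' : ltangent z X ->
  is_lderiv z X f r -> is_lderiv z X f r' -> r = r'.
Proof.
move=> tX [n [h [H ->]]] [m [k [K ->]]].
have [h' [H' <-//]] := lrep_up (leq_maxl n m) H.
have [k' [K' <-//]] := lrep_up (leq_maxr n m) K.
have [[_ _ _ tl] _] := tX (maxn n m).
apply: tl; [exact: H'.1|exact: lrep_uniq H' K'].
Qed.

Lemma lderivP z X f r : ltangent z X -> is_lderiv z X f r -> lderiv z X f = r.
Proof. by move=> tX H; apply: (is_lderiv_uniq tX _ H); exact: (xgetI 0 H). Qed.

Lemma lderivE z X f n h : ltangent z X -> @lrep R g T z f n h -> lderiv z X f = X n h.
Proof. by move=> tX H; apply: lderivP => //; exists n, h. Qed.

Lemma lderiv_is z X f : ltangent z X -> lsmooth_at z f -> is_lderiv z X f (lderiv z X f).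
Proof. by move=> tX [n [h H]]; exists n, h; split => //; exact: lderivE. Qed.

Lemma lsmooth_up z f : lsmooth_at z f -> exists n0, forall n, (n0 <= n)%N ->
  exists h, @lrep R g T z f n h.
Proof.
move=> [n0 [h H]]; exists n0 => n /lrep_up/(_ H)[h' [H' _]]; by exists h'.
Qed.

Lemma lrep2 z f f' : lsmooth_at z f -> lsmooth_at z f' ->
  exists n h h', @lrep R g T z f n h /\ @lrep R g T z f' n h'.
Proof.
move=> /lsmooth_up[n H] /lsmooth_up[m K].
have [h Hh] := H _ (leq_maxl n m); have [k Hk] := K _ (leq_maxr n m).
by exists (maxn n m), h, k.
Qed.

Lemma lrep_ext z f f' n h : @lrep R g T z f n h -> lnear z [set w | f w = f' w] ->
  exists m h', @lrep R g T z f' m h' /\ @lrep R g T z f m h'.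
Proof.
move=> H /lnear_up[m HN].
have [N [zN NP]] := HN _ (leq_maxl m n).
have [h' [H' _]] := lrep_up (leq_maxr m n) H.
exists (maxn m n), h'; split => //.
case: H' => sh [N' zN' Nf']; split => //.
exists (N `&` N'); first exact: filterI.
by move=> w [/NP <- /Nf' ->].
Qed.

Lemma lderiv_ext z X f f' : ltangent z X -> lsmooth_at z f ->
  lnear z [set w | f w = f' w] -> lderiv z X f' = lderiv z X f.
Proof.
move=> tX [n [h H]] /(lrep_ext H)[m [h' [H1 H2]]].
by rewrite (lderivE tX H1) (lderivE tX H2).
Qed.

Lemma lrep_add z f f' n h h' a : @lrep R g T z f n h -> @lrep R g T z f' n h' ->
  @lrep R g T z (fun w => a * f w + f' w) n (fun y => a * h y + h' y).
Proof.
move=> [sh [N zN Nf]] [sh' [N' zN' Nf']]; split.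
  by apply: smooth_add => //; apply: smooth_mul => //; exact: smooth_cst.
exists (N `&` N'); first exact: filterI.
by move=> w [Nw Nw']; rewrite Nf // Nf'.
Qed.

Lemma lrep_mul z f f' n h h' : @lrep R g T z f n h -> @lrep R g T z f' n h' ->
  @lrep R g T z (fun w => f w * f' w) n (fun y => h y * h' y).
Proof.
move=> [sh [N zN Nf]] [sh' [N' zN' Nf']]; split.
  exact: smooth_mul.
exists (N `&` N'); first exact: filterI.
by move=> w [Nw Nw']; rewrite Nf // Nf'.
Qed.

Lemma lrep_cst z n (a : R) : @lrep R g T z (fun=> a) n (fun=> a).
Proof. by split; [exact: smooth_cst|exists setT => //; exact: filterT]. Qed.

Lemma lderiv_add z X f f' a : ltangent z X -> lsmooth_at z f -> lsmooth_at z f' ->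
  lderiv z X (fun w => a * f w + f' w) = a * lderiv z X f + lderiv z X f'.
Proof.
move=> tX sf sf'; have [n [h [h' [H H']]]] := lrep2 sf sf'.
rewrite (lderivE tX (lrep_add a H H')) (lderivE tX H) (lderivE tX H').
by have [[_ tl _ _] _] := tX n; apply: tl; [exact: H.1|exact: H'.1].
Qed.

Lemma lderiv_mul z X f f' : ltangent z X -> lsmooth_at z f -> lsmooth_at z f' ->
  lderiv z X (fun w => f w * f' w) = lderiv z X f * f' z + f z * lderiv z X f'.
Proof.
move=> tX sf sf'; have [n [h [h' [H H']]]] := lrep2 sf sf'.
rewrite (lderivE tX (lrep_mul H H')) (lderivE tX H) (lderivE tX H').
have [[_ _ tm _] _] := tX n; rewrite tm; [|exact: H.1|exact: H'.1].
have [_ [N zN Nf]] := H; have [_ [N' zN' Nf']] := H'.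
by rewrite Nf ?Nf' //; exact: nbhs_singleton.
Qed.

Lemma lderiv_cst z X a : ltangent z X -> lderiv z X (fun=> a) = 0.
Proof.
move=> tX; have c1 : lsmooth_at z (fun=> 1) by exists 0%N, (fun=> 1); exact: lrep_cst.
have c0 : lderiv z X (fun=> 1) = 0.
  have := lderiv_mul tX c1 c1; rewrite !mulr1 mul1r => /eqP.
  by rewrite -subr_eq0 opprD addNKr oppr_eq0 => /eqP.
have c0' : lderiv z X (fun=> 0) = 0.
  have := lderiv_add (-1) tX c1 c1; under eq_fun do rewrite mulr1 addNr.
  by move=> ->; rewrite c0 mulr0 addr0.
have cz : lsmooth_at z (fun=> 0) by exists 0%N, (fun=> 0); exact: lrep_cst.
have := lderiv_add a tX c1 cz; under eq_fun do rewrite mulr1 addr0.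
by move=> ->; rewrite c0 c0' mulr0 addr0.
Qed.

Lemma lgerm_algebra z : germ_algebra (lnear z) z (@lsmooth_at R g T z).
Proof.
have smul f f' : lsmooth_at z f -> lsmooth_at z f' -> lsmooth_at z (fun w => f w * f' w).
  move=> sf sf'; have [n [h [h' [H H']]]] := lrep2 sf sf'.
  by exists n, (fun y => h y * h' y); exact: lrep_mul.
split=> //.
- exact: lnear_filter.
- exact: lnear_pt.
- by move=> f h [n [k H]] /(lrep_ext H)[m [k' [H1 _]]]; exists m, k'.
- by move=> a; exists 0%N, (fun=> a); exact: lrep_cst.
- move=> f f' sf sf'; have [n [h [h' [H H']]]] := lrep2 sf sf'.
  exists n, (fun y => 1 * h y + h' y); have := lrep_add 1 H H'.
  by under eq_fun do rewrite mul1r.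
- move=> f [n [h [sh [N zN Nf]]]] fz0.
  have hz : h (z n) != 0 by rewrite -Nf //; exact: nbhs_singleton.
  exists n, (fun y => (h y)^-1); split; first exact: smooth_inv.
  by exists N => // w Nw; rewrite Nf.
- move=> f [n [h [sh [N zN Nf]]]] fz0.
  have hz : h (z n) != 0 by rewrite -Nf //; exact: nbhs_singleton.
  exists n, (N `&` [set y | h y != 0]); split.
    by apply: filterI => //; exact: smooth_neq0.
  by move=> w [Nw hw] /=; rewrite Nf.
Qed.

Lemma lderiv_sum z X I (r : seq I) (c : I -> R) (f : I -> limQ T -> R) : ltangent z X ->
  (forall i, lsmooth_at z (f i)) ->
  lderiv z X (fun w => \sum_(i <- r) c i * f i w) = \sum_(i <- r) c i * lderiv z X (f i).
Proof.
move=> tX sf; elim: r => [|i r IH].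
  by rewrite big_nil; under eq_fun do rewrite big_nil; exact: lderiv_cst.
under eq_fun do rewrite big_cons.
rewrite big_cons lderiv_add // ?IH //.
apply: (ga_sum (lgerm_algebra z)) => j _; apply: (ga_mul (lgerm_algebra z)) => //.
exact: (ga_cst (lgerm_algebra z)).
Qed.

Lemma lderiv_sumM z X I (r : seq I) (f h : I -> limQ T -> R) : ltangent z X ->
  (forall i, lsmooth_at z (f i)) -> (forall i, lsmooth_at z (h i)) ->
  lderiv z X (fun w => \sum_(i <- r) f i w * h i w) =
  \sum_(i <- r) (lderiv z X (f i) * h i z + f i z * lderiv z X (h i)).
Proof.
move=> tX sf sh.
have sm i : lsmooth_at z (fun w => f i w * h i w).
  exact: (ga_mul (lgerm_algebra z)).
transitivity (lderiv z X (fun w => \sum_(i <- r) 1 * (f i w * h i w))).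
  congr lderiv; apply/funext => w; apply: eq_bigr => i _; by rewrite mul1r.
rewrite lderiv_sum //; apply: eq_bigr => i _.
by rewrite mul1r lderiv_mul.
Qed.

Lemma lrep_near z f n h : @lrep R g T z f n h -> lnear z [set w | @lrep R g T w f n h].
Proof.
move=> [sh [N zN Nf]].
exists n, ([set y | smooth_at y h] `&` interior N); split.
  by apply: filterI; [exact: smooth_near_pt|exact: nbhs_interior].
by move=> w [sw Nw]; split => //; exists N.
Qed.

Lemma lsmooth_near z f : lsmooth_at z f -> lnear z [set w | lsmooth_at w f].
Proof.
by move=> [n [h /lrep_near]]; apply: filterS => w Hw; exists n, h.
Qed.

Lemma lrep_level z n h : smooth_at (z n) h -> @lrep R g T z (fun w => h (w n)) n h.
Proof. by move=> sh; split => //; exists setT => //; exact: filterT. Qed.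

Lemma lsmooth_level z n h : smooth_at (z n) h -> lsmooth_at z (fun w => h (w n)).
Proof. by move=> sh; exists n, h; exact: lrep_level. Qed.

Lemma lderiv_level z X n h : ltangent z X -> smooth_at (z n) h ->
  lderiv z X (fun w => h (w n)) = X n h.
Proof. by move=> tX sh; apply: lderivE => //; exact: lrep_level. Qed.

Lemma TF_top z n v : TF n%:Z (z n) v -> v = 0.
Proof.
case: n v => [|n] v /=; first by rewrite (fm_zero (gt_filtered gt)).
by move=> [_]; case: ifP => //; lia.
Qed.

(** A vector of F^n at level k + n projects to zero at level n and so kills F. Raising the level
    thus makes the ambiguity of frames invisible to functions of level n. *)
Lemma pullback n k (f : tQ T n -> R) : exists F : tQ T (k + n) -> R, forall z,
  [/\ F (z (k + n)%N) = f (z n),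
      smooth_at (z n) f -> smooth_at (z (k + n)%N) F,
      smooth_at (z n) f -> forall X, ltangent z X -> X (k + n)%N F = X n f &
      smooth_at (z n) f -> forall v, TF n%:Z (z (k + n)%N) v -> v F = 0].
Proof.
elim: k => [|k [F FP]].
  by exists f => z; split => // sf v /TF_top ->.
exists (F \o proj T (k + n)) => z; have [F1 F2 F3 F4] := FP z; split.
- by rewrite /= (lpt_compat z).
- move=> sf; apply: (proj_smooth z (k + n)).2.
  by rewrite lpt_compat; exact: F2.
- by move=> sf X tX; rewrite (ltangent_proj tX (F2 sf)); exact: F3.
have le : n%:Z <= (k + n)%N%:Z by lia.
move=> sf v [tv]; rewrite le lpt_compat => /F4; rewrite pushE ?lpt_compat; first exact.
exact: F2.
Qed.

End Limit.

(** * The absolute parallelism *)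

Section Parallelism.
Variables (R : realType) (g : gradedLie R) (T : towerData g).
Hypothesis tr : transitive_gl g.
Hypothesis gt : geometric_tower T.
Implicit Types (z w : limQ T) (X Y : forall n, tvec (tQ T n)) (U V u v : g).
Local Notation dp := (depth g)%:Z.

Lemma lcls_iso z n zeta : cls T n (z n.+1) zeta -> filtered_iso (z n) zeta.
Proof. by move=> /(cls_iso gt); rewrite lpt_compat. Qed.

Lemma lcls_push z n zeta : cls T n.+1 (z n.+2) zeta ->
  cls T n (z n.+1) (push (proj T n) (z n.+1) \o zeta).
Proof. by move=> /(cls_push gt); rewrite lpt_compat. Qed.

Lemma ltangent_rep z X n zeta : ltangent z X -> cls T n (z n.+1) zeta ->
  exists u, zeta u = X n.
Proof.
move=> tX /lcls_iso [_ _ iz _]; have := (tX n).1.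
by rewrite -iz => -[u _ <-]; exists u.
Qed.

Lemma cls_descend z n m zeta : (n <= m)%N -> cls T m (z m.+1) zeta ->
  exists2 zeta', cls T n (z n.+1) zeta' &
    forall X u, ltangent z X -> zeta u = X m -> zeta' u = X n.
Proof.
move=> nm; elim: m nm zeta => [|m IH] nm zeta cz.
  by move: nm; rewrite leqn0 => /eqP E; subst n; exists zeta.
move: nm; rewrite leq_eqVlt => /predU1P[E|]; first by subst n; exists zeta.
rewrite ltnS => /IH/(_ _ (lcls_push cz))[zeta' cz' H]; exists zeta' => // X u tX zu.
by apply: H => //=; rewrite zu (tX m).2.
Qed.

(** Here zeta' = zeta o a with a in F^(n+1)GL, so b = a u modulo the kernel F^n of zeta, while a u -
    u lies in F^(q+n+1): whence the two bounds on s. *)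
Lemma cls_filt z n zeta zeta' b u : cls T n (z n.+1) zeta -> cls T n (z n.+1) zeta' ->
  zeta b = zeta' u -> forall q s, filt q u -> s <= n%:Z -> s <= q + n.+1%:Z ->
  filt s (b - u).
Proof.
move=> cz cz' zbu q s fu sn sq.
have [a Ha E] := cls_rel gt cz cz'.
rewrite E /= in zbu; move/(filtered_iso_eq _ _ (lcls_iso cz)): zbu => H.
apply: (@filtB_trans _ _ _ _ (a u)); first exact: filt_le H.
by apply: filt_le (Ha.2 _ _ fu).
Qed.

Lemma cls_filt_depth z n zeta zeta' b u : cls T n (z n.+1) zeta -> cls T n (z n.+1) zeta' ->
  zeta b = zeta' u -> filt (n%:Z - dp) (b - u).
Proof.
move=> cz cz' zbu; apply: (cls_filt cz cz' zbu (filt_depth u (lexx _))); lia.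
Qed.

(** The coordinates of X at levels n and n + 1 agree modulo F^(n-depth), so the component of degree
    p is stationary once n exceeds p + depth. *)
Lemma theta_exists z X : ltangent z X -> exists V, is_theta z X V.
Proof.
move=> tX.
have [Z cZ] := dependent_choice_fun (fun n => cls_nonempty gt (z n.+1)).
have [u uX] := choice (fun n => ltangent_rep tX (cZ n)).
have step n : filt (n%:Z - dp) (u n - u n.+1).
  apply: (cls_filt_depth (cZ n) (lcls_push (cZ n.+1))).
  by rewrite uX /= uX (tX n).2.
pose N (p : int) := (absz p + depth g).+1.
have stab p n : (N p <= n)%N -> comp p (u n) = comp p (u (N p)).
  elim: n => [//|n IH]; rewrite leq_eqVlt => /predU1P[<-//|].
  rewrite ltnS => Nn; rewrite -IH //; apply/eqP; rewrite eq_sym -subr_eq0 -compB.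
  by rewrite step //; move: Nn; rewrite /N; lia.
exists (assemble (fun p => u (N p))) => p; exists (N p) => n Nn zeta v cz zv.
rewrite comp_assemble -(stab p n Nn).
apply/eqP; rewrite -subr_eq0 -compB.
rewrite (cls_filt_depth cz (cZ n)) ?uX //.
by move: Nn; rewrite /N; lia.
Qed.

Lemma theta_uniq z X V V' : ltangent z X -> is_theta z X V -> is_theta z X V' -> V = V'.
Proof.
move=> tX tV tV'; apply: comp_sep => p.
have [N HN] := tV p; have [N' HN'] := tV' p.
pose n := maxn N N'; have [zeta cz] := cls_nonempty gt (z n.+1).
have [u zu] := ltangent_rep tX cz.
by rewrite -(HN n _ _ _ cz zu) ?leq_maxl // -(HN' n _ _ _ cz zu) ?leq_maxr.
Qed.

Lemma thetaP z X V : ltangent z X -> is_theta z X V -> theta z X = V.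
Proof.
by move=> tX tV; apply: (theta_uniq tX _ tV); exact: (xgetI 0 tV).
Qed.

(** [is_theta] provides one N for each degree; below P only the finitely many degrees >= -depth
    count, so a common N exists. *)
Lemma theta_filt z X V : is_theta z X V -> forall P : int, exists N : nat,
  forall n, (N <= n)%N -> forall zeta u, cls T n (z n.+1) zeta -> zeta u = X n ->
  filt P (u - V).
Proof.
move=> tV P.
suff H (k : nat) : exists N : nat,
    forall n, (N <= n)%N -> forall zeta u, cls T n (z n.+1) zeta -> zeta u = X n ->
    filt (- dp + k%:Z) (u - V).
  have [N HN] := H (absz (P + dp)).
  by exists N => n Nn zeta u cz zu; apply: filt_le (HN n Nn _ _ cz zu); lia.
elim: k => [|k [N HN]].
  by exists 0%N => *; apply: filt_depth; lia.
have [N' HN'] := tV (- dp + k%:Z).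
exists (maxn N N') => n; rewrite geq_max => /andP[Nn N'n] zeta u cz zu.
have -> : - dp + k.+1%:Z = - dp + k%:Z + 1 by lia.
apply: filtS; first exact: HN cz zu.
by rewrite compB (HN' _ N'n _ _ cz zu) subrr.
Qed.

(** At a high level m the coordinates u of X agree with V modulo F^n. The frame of level m descends
    to a representative of the same class as zeta, so [cls_filt] compares b with u. *)
Lemma theta_comp z X V n zeta b : ltangent z X -> is_theta z X V ->
  cls T n (z n.+1) zeta -> zeta b = X n ->
  forall q s, filt q V -> s <= n%:Z -> s <= q + n.+1%:Z -> filt s (b - V).
Proof.
move=> tX tV cz zb q s fV sn sq.
have [N HN] := theta_filt tV n%:Z.
pose m := maxn N n; have [zm cm] := cls_nonempty gt (z m.+1).
have [u zu] := ltangent_rep tX cm.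
have uV := HN m (leq_maxl _ _) _ _ cm zu.
have [z' cz' /(_ X u tX zu) z'u] := cls_descend (leq_maxr N n) cm.
apply: (@filtB_trans _ _ _ _ u); last exact: filt_le uV.
have fu : filt (Num.min q n%:Z) u.
  have -> : u = (u - V) + V by rewrite subrK.
  by apply: filtD; [apply: filt_le uV|apply: filt_le fV]; lia.
apply: (cls_filt cz cz' _ fu) => //; first by rewrite zb z'u.
lia.
Qed.

Lemma parallel_uniq z X Y V : ltangent z X -> ltangent z Y ->
  is_theta z X V -> is_theta z Y V -> X = Y.
Proof.
move=> tX tY tV tV'; apply: functional_extensionality_dep => n.
have [N HN] := theta_filt tV n%:Z; have [N' HN'] := theta_filt tV' n%:Z.
pose m := maxn n (maxn N N').
have nm : (n <= m)%N by exact: leq_maxl.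
have [zm cm] := cls_nonempty gt (z m.+1).
have [u zu] := ltangent_rep tX cm; have [u' zu'] := ltangent_rep tY cm.
have [z' cz' H] := cls_descend nm cm.
rewrite -(H X u) // -(H Y u') //; apply/(filtered_iso_eq _ _ (lcls_iso cz')).
apply: (@filtB_trans _ _ _ _ V); first by apply: (HN m) cm zu; rewrite /m; lia.
by apply: filtBC; apply: (HN' m) cm zu'; rewrite /m; lia.
Qed.

(* If zeta_n represents z_(n+1), then zeta_(n+1) induces zeta_n o a_n with      *)
(* a_n in F^(n+1)GL; hence the products a_n a_(n+1) ... a_(n+k-1) U are         *)
(* stationary modulo F^n, and zeta_n of the stable value is the component at   *)
(* level n of the vector with theta = U.                                       *)
Lemma parallel_exists z U : exists X, ltangent z X /\ is_theta z X U.
Proof.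
have [Z cZ] := dependent_choice_fun (fun n => cls_nonempty gt (z n.+1)).
have ex_a n : exists a, FGL n.+1%:Z a /\ push (proj T n) (z n.+1) \o Z n.+1 = Z n \o a.
  by have [a Ha ->] := cls_rel gt (cZ n) (lcls_push (cZ n.+1)); exists a.
have [a Ha] := choice ex_a.
pose fix P (k n : nat) {struct k} : g := if k is k'.+1 then a n (P k' n.+1) else U.
have P1 k n : filt (n%:Z + k%:Z + 1 - dp) (P k.+1 n - P k n).
  elim: k n => [|k IH] n.
    by apply: filt_le ((Ha n).1.2 _ _ (filt_depth U (lexx _))); lia.
  rewrite [P k.+2 n]/= [P k.+1 n]/= -(linB (Ha n).1.1).
  by apply: (FGL_filt _ (Ha n).1); [lia|apply: filt_le (IH n.+1); lia].
have P2 k n : filt (n%:Z + 1 - dp) (P k n - U).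
  elim: k n => [|k IH] n; first by rewrite subrr; exact: filt0.
  apply: (@filtB_trans _ _ _ _ (P k n.+1)); last by apply: filt_le (IH _); lia.
  by apply: filt_le ((Ha n).1.2 _ _ (filt_depth (P k n.+1) (lexx _))); lia.
(* By [P1] the k-th step changes the product by an element of F^(n+k+1-depth); after [depth g] steps
   it is stable modulo F^n, the kernel of [Z n]. *)
exists (fun n => Z n (P (depth g) n)); split.
  move=> n; have iz := lcls_iso (cZ n); split.
    by have [_ _ <- _] := iz; exists (P (depth g) n).
  have /(congr1 (fun h => h (P (depth g) n.+1))) /= -> := (Ha n).2.
  apply/(filtered_iso_eq _ _ iz).
  by apply: filt_le (P1 (depth g) n); lia.
move=> p; exists ((absz p + depth g).+1) => n Nn zeta u cz zu.
apply/eqP; rewrite -subr_eq0 -compB.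
have H : filt (n%:Z - dp) (u - U).
  apply: (@filtB_trans _ _ _ _ (P (depth g) n)).
    exact: cls_filt_depth cz (cZ n) zu.
  by apply: filt_le (P2 _ _); lia.
by rewrite H //; lia.
Qed.

Definition tilde U : lvfield T := fun z =>
  xget (fun n => 0) [set X | ltangent z X /\ is_theta z X U].

Arguments tilde U z n : clear implicits.

Lemma tildeP U z : ltangent z (tilde U z) /\ is_theta z (tilde U z) U.
Proof.
have [X HX] := parallel_exists z U.
exact: (@xgetI _ (fun n => 0) [set X | ltangent z X /\ is_theta z X U] X HX).
Qed.

Lemma tilde_tangent U z : ltangent z (tilde U z).
Proof. exact: (tildeP U z).1. Qed.

Lemma tilde_uniq z X U : ltangent z X -> is_theta z X U -> X = tilde U z.
Proof. by move=> tX tU; apply: parallel_uniq tX (tilde_tangent U z) tU (tildeP U z).2. Qed.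

Lemma tangent_lin (M : manifold R) (x : M) (a : R) (v v' : tvec M) :
  tangent x v -> tangent x v' -> tangent x (a *: v + v').
Proof.
move=> [v0 va vm vl] [v0' va' vm' vl']; split.
- by move=> f nf; rewrite tvecE v0 // v0' // mulr0 addr0.
- move=> b f h sf sh; rewrite !tvecE va // va' //.
  by rewrite !mulrDr !mulrA [a * b]mulrC addrACA.
- move=> f h sf sh; rewrite !tvecE vm // vm' //.
  by rewrite !mulrDr !mulrDl !mulrA [a * f x]mulrC addrACA.
- by move=> f h sf fh; rewrite !tvecE (vl f h) // (vl' f h).
Qed.

Lemma tilde_lin a U V z n : tilde (a *: U + V) z n = a *: tilde U z n + tilde V z n.
Proof.
have [tU hU] := tildeP U z; have [tV hV] := tildeP V z.
rewrite -(@tilde_uniq z (fun n => a *: tilde U z n + tilde V z n)) //.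
  move=> k; split; first by apply: tangent_lin; [exact: (tU k).1|exact: (tV k).1].
  by rewrite push_linear (tU k).2 (tV k).2.
move=> p; have [N HN] := hU p; have [N' HN'] := hV p.
exists (maxn (absz p).+1 (maxn N N')) => k; rewrite !geq_max => /and3P[pk Nk Nk'] zeta u cz zu.
have [u1 zu1] := ltangent_rep tU cz; have [u2 zu2] := ltangent_rep tV cz.
have iz := lcls_iso cz; have [lz _ _ _] := iz.
rewrite compD compZ -(HN k Nk _ _ cz zu1) -(HN' k Nk' _ _ cz zu2) -compZ -compD.
apply/eqP; rewrite -subr_eq0 -compB; apply/eqP.
have : zeta u = zeta (a *: u1 + u2) by rewrite zu lz zu1 zu2.
by move=> /(filtered_iso_eq _ _ iz); apply; lia.
Qed.

(** For the converse the degree of U is raised step by step: if U is in F^j with j < n, then b - U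
    is in F^(j+1) by [theta_comp], and b is in F^n. *)
Lemma tilde_filt U z n : filt n%:Z U <-> tilde U z n = 0.
Proof.
have [zeta cz] := cls_nonempty gt (z n.+1).
have [tU hU] := tildeP U z; have [b zb] := ltangent_rep tU cz.
have [lz kz _ _] := lcls_iso cz.
rewrite -zb kz; split.
  move=> fU; have H := theta_comp tU hU cz zb fU (lexx _).
  have -> : b = (b - U) + U by rewrite subrK.
  by apply: filtD => //; apply: H; lia.
move=> fb; suff H (k : nat) : - dp + k%:Z <= n%:Z -> filt (- dp + k%:Z) U.
  have := H (absz (n%:Z + dp)); have -> : - dp + (absz (n%:Z + dp))%:Z = n%:Z by lia.
  by apply.
elim: k => [|k IH] kn; first by apply: filt_depth; lia.
have fU : filt (- dp + k%:Z) U by apply: IH; lia.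
have -> : U = b - (b - U) by rewrite subKr.
apply: filtB; first exact: filt_le fb.
by apply: (theta_comp tU hU cz zb fU) => //; lia.
Qed.

(** In a frame of level n the coordinates of the field are not exactly U. At level m = depth + n the
    error lies in F^n even for the lowest degree of U, so it disappears on functions pulled back
    from level n, and the field may be replaced by the smooth representative applied to the constant
    U. *)
Lemma tilde_smooth U z n f : smooth_at (z n) f ->
  lsmooth_at z (fun w => tilde U w n f).
Proof.
move=> sf; pose m := (depth g + n)%N.
have [F FP] := pullback gt (depth g) f.
have [B [zeta [oO Oz cz sz]]] := smooth_rep tr gt (z m).
have Op : B (proj T m (z m.+1)) by rewrite lpt_compat.
have [_ sF _ _] := FP z.
apply: (ga_ext (lgerm_algebra gt z) (f := fun w => zeta (w m.+1) U F)).
  apply: (@lsmooth_level _ _ _ z m.+1 (fun y => zeta y U F)).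
  by apply: sz; rewrite // lpt_compat; exact: sF.
have ff := lnear_filter gt z.
have n1 := lnear_nbhs (open_nbhs_nbhs (conj oO Oz)).
have n2 := lnear_nbhs (smooth_near_pt sf).
apply: filterS2 n1 n2 => w Ow sw.
have cw : cls T m (w m.+1) (zeta (w m.+1)) by apply: cz; rewrite lpt_compat.
have [_ _ Ft Fk] := FP w.
have [tU hU] := tildeP U w; have [b zb] := ltangent_rep tU cw.
rewrite /= -(Ft sw _ tU) -zb.
have iw := lcls_iso cw; have [lw _ _ _] := iw.
apply/eqP; rewrite eq_sym -subr_eq0.
have -> : zeta (w m.+1) b F - zeta (w m.+1) U F = zeta (w m.+1) (b - U) F.
  by rewrite (linB lw).
apply/eqP; apply: Fk => //; apply/(filtered_iso_TF _ iw).
  by rewrite /m; lia.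
by apply: (theta_comp tU hU cw zb (filt_depth U (lexx _))); rewrite /m; lia.
Qed.

End Parallelism.
Arguments tilde {R g T} U z n.

(** * The Bianchi identity *)

Section Bianchi.
Variables (R : realType) (g : gradedLie R) (T : towerData g).
Hypothesis tr : transitive_gl g.
Hypothesis gt : geometric_tower T.
Implicit Types (z w : limQ T) (X Y : forall n, tvec (tQ T n)) (U V W u v : g).
Implicit Types (phi psi : limQ T -> R).
Local Notation dp := (depth g)%:Z.
Local Existing Instance lnear_filter.
Local Notation ltan U z := (tilde_tangent gt U z).

Definition derivation U phi : limQ T -> R := fun w => lderiv w (tilde U w) phi.
Local Notation DO := derivation.

Lemma DO_lrep U z phi n h : @lrep R g T z phi n h -> DO U phi z = tilde U z n h.
Proof. exact: (lderivE gt (ltan U z)). Qed.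

Lemma DO_near z phi n h : @lrep R g T z phi n h ->
  lnear z [set w | forall U, DO U phi w = tilde U w n h].
Proof.
have ff := lnear_filter gt z.
by move=> /lrep_near; apply: filterS => w Hw U; exact: DO_lrep.
Qed.

Lemma DO_smooth U z phi : lsmooth_at z phi -> lsmooth_at z (DO U phi).
Proof.
move=> [n [h H]]; apply: (ga_ext (lgerm_algebra gt z) (f := fun w => tilde U w n h)).
  by apply: tilde_smooth => //; exact: H.1.
have ff := lnear_filter gt z.
by apply: filterS (DO_near H) => w /= ->.
Qed.

Lemma DO_lin z phi : lsmooth_at z phi -> linear ((fun U => DO U phi z) : g -> R^o).
Proof. by move=> [n [h H]] a U V; rewrite !(DO_lrep _ H) tilde_lin. Qed.

Lemma DO_ext U z phi psi : lsmooth_at z phi -> lnear z [set w | phi w = psi w] ->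
  DO U psi z = DO U phi z.
Proof. by move=> sp; exact: (lderiv_ext gt (ltan U z) sp). Qed.

Lemma DO_add U z phi psi a : lsmooth_at z phi -> lsmooth_at z psi ->
  DO U (fun w => a * phi w + psi w) z = a * DO U phi z + DO U psi z.
Proof. exact: (lderiv_add gt _ (ltan U z)). Qed.

Lemma DO_mul U z phi psi : lsmooth_at z phi -> lsmooth_at z psi ->
  DO U (fun w => phi w * psi w) z = DO U phi z * psi z + phi z * DO U psi z.
Proof. exact: (lderiv_mul gt (ltan U z)). Qed.

Lemma DO_sub U z phi psi : lsmooth_at z phi -> lsmooth_at z psi ->
  DO U (fun w => phi w - psi w) z = DO U phi z - DO U psi z.
Proof.
move=> sp sq; have := DO_add U (-1) sq sp; rewrite mulN1r addrC => <-.
by congr (DO _ _ _); apply/funext => w; rewrite mulN1r addrC.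
Qed.

(** Near z the function comes from one level n, at which the fields of F^n vanish. This makes
    expansions of D_V phi over a basis of g / F^m finite. *)
Lemma DO_filt z phi : lsmooth_at z phi -> exists m0, forall m, (m0 <= m)%N ->
  lnear z [set w | forall U, filt m%:Z U -> DO U phi w = 0].
Proof.
have ff := lnear_filter gt z.
move=> [n [h H]]; exists n => m nm; apply: filterS (DO_near H) => w Hw U fU.
have H0 : tilde U w n = 0 by apply/(tilde_filt gt); apply: filt_le fU; lia.
by rewrite Hw H0.
Qed.

Lemma level_filt z n U : (forall f, smooth_at (z n) f -> tilde U z n f = 0) ->
  filt n%:Z U.
Proof.
move=> H; apply/(tilde_filt gt _ z); apply/funext => f.
have [sf|nsf] := pselect (smooth_at (z n) f); first exact: H.
by have [[t0 _ _ _] _] := ltan U z n; exact: t0.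
Qed.

Lemma DO_eq0 z U : (forall phi, lsmooth_at z phi -> DO U phi z = 0) -> U = 0.
Proof.
move=> H; apply: comp_sep => p; rewrite comp0.
have fU : filt (absz p).+1%:Z U.
  apply: (@level_filt z) => f sf.
  rewrite -(DO_lrep U (lrep_level sf)); apply: H; exact: lsmooth_level.
by apply: fU; lia.
Qed.

Definition bracket_op U V phi : limQ T -> R := fun w => DO U (DO V phi) w - DO V (DO U phi) w.
Local Notation BR := bracket_op.

Lemma BR_smooth U V z phi : lsmooth_at z phi -> lsmooth_at z (BR U V phi).
Proof.
move=> sp; have ga := lgerm_algebra gt z.
apply: (ga_ext ga (f := fun w => DO U (DO V phi) w + (-1) * DO V (DO U phi) w)).
  apply: (ga_add ga); first by do 2!apply: DO_smooth.
  apply: (ga_mul ga); first exact: (ga_cst ga).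
  by do 2!apply: DO_smooth.
have ff := lnear_filter gt z.
by apply: lnearW => w /=; rewrite mulN1r.
Qed.

Lemma BR_ext U V z phi psi : lsmooth_at z phi -> lnear z [set w | phi w = psi w] ->
  BR U V psi z = BR U V phi z.
Proof.
have ff := lnear_filter gt z.
move=> sp E.
have H U' V' : DO U' (DO V' psi) z = DO U' (DO V' phi) z.
  apply: DO_ext; first exact: DO_smooth.
  apply: filterS2 (lsmooth_near gt sp) (lnear_near E) => w sw Ew /=.
  by rewrite (DO_ext _ sw Ew).
by rewrite /bracket_op !H.
Qed.

Lemma BR_add U V z phi psi a : lsmooth_at z phi -> lsmooth_at z psi ->
  BR U V (fun w => a * phi w + psi w) z = a * BR U V phi z + BR U V psi z.
Proof.
have ff := lnear_filter gt z.
move=> sp sq.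
have H U' V' : DO U' (DO V' (fun w => a * phi w + psi w)) z =
    a * DO U' (DO V' phi) z + DO U' (DO V' psi) z.
  rewrite -DO_add; try exact: DO_smooth.
  have ga := lgerm_algebra gt z.
  apply: DO_ext.
    apply: (ga_add ga); last exact: DO_smooth.
    by apply: (ga_mul ga); [exact: (ga_cst ga)|exact: DO_smooth].
  apply: filterS2 (lsmooth_near gt sp) (lsmooth_near gt sq) => w pw qw /=.
  by rewrite DO_add.
by rewrite /bracket_op !H mulrBr opprD addrACA.
Qed.

Lemma BR_mul U V z phi psi : lsmooth_at z phi -> lsmooth_at z psi ->
  BR U V (fun w => phi w * psi w) z = BR U V phi z * psi z + phi z * BR U V psi z.
Proof.
have ff := lnear_filter gt z.
move=> sp sq; have ga := lgerm_algebra gt z.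
have H U' V' : DO U' (DO V' (fun w => phi w * psi w)) z =
    DO U' (DO V' phi) z * psi z + DO V' phi z * DO U' psi z
    + (DO U' phi z * DO V' psi z + phi z * DO U' (DO V' psi) z).
  have s1 : lsmooth_at z (fun w => DO V' phi w * psi w).
    by apply: (ga_mul ga) => //; exact: DO_smooth.
  have s2 : lsmooth_at z (fun w => phi w * DO V' psi w).
    by apply: (ga_mul ga) => //; exact: DO_smooth.
  rewrite -DO_mul //; last exact: DO_smooth.
  rewrite -DO_mul //; last exact: DO_smooth.
  rewrite -[X in X + _]mul1r -DO_add //.
  apply: DO_ext.
    by apply: (ga_add ga) => //; apply: (ga_mul ga) => //; exact: (ga_cst ga).
  apply: filterS2 (lsmooth_near gt sp) (lsmooth_near gt sq) => w pw qw /=.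
  by rewrite DO_mul // mul1r.
rewrite /bracket_op !H mulrBl mulrBr.
set a := DO U (DO V phi) z * _; set b := DO V (DO U phi) z * _.
set c := phi z * DO U (DO V psi) z; set d := phi z * DO V (DO U psi) z.
set e := DO V phi z * DO U psi z; set f := DO U phi z * DO V psi z.
by rewrite !opprD !addrA; ring.
Qed.

Lemma lbracket_BR U V z n f : smooth_at (z n) f ->
  lbracket (tilde U) (tilde V) z f = BR U V (fun w => f (w n)) z.
Proof.
move=> sf; rewrite /lbracket asboolT // /bracket_op.
have ff := lnear_filter gt z.
have H U' V' : lderiv z (tilde U' z) (fun w => tilde V' w n f) =
    DO U' (DO V' (fun w => f (w n))) z.
  apply: DO_ext; first by apply: DO_smooth; exact: lsmooth_level.
  apply: filterS (DO_near (lrep_level sf)) => w Hw /=; exact: Hw.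
by rewrite !H.
Qed.

Lemma lbracket_tangent U V z : ltangent z (lbracket (tilde U) (tilde V) z).
Proof.
have ff := lnear_filter gt z.
move=> n; split; last first.
  apply/funext => f; rewrite /push lpt_compat.
  case: ifPn => [/asboolP sf|/asboolPn nsf].
    rewrite !lbracket_BR //; last first.
      by apply: (proj_smooth gt z n).2; rewrite lpt_compat.
    by congr (BR _ _ _ _); apply/funext => w /=; rewrite lpt_compat.
  by rewrite /lbracket asboolF.
split.
- by move=> f nsf; rewrite /lbracket asboolF.
- move=> a f h sf sh; rewrite !lbracket_BR //; last first.
    by apply: smooth_add => //; apply: smooth_mul => //; exact: smooth_cst.
  by apply: BR_add; exact: lsmooth_level.
- move=> f h sf sh; rewrite !lbracket_BR //; last exact: smooth_mul.
  by apply: BR_mul; exact: lsmooth_level.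
- move=> f h sf fh; have sh := smooth_ext sf fh.
  rewrite !lbracket_BR //; apply/esym/BR_ext; first exact: lsmooth_level.
  exact: (lnear_nbhs fh).
Qed.

Section Derivatives.

(** The functionals of [finite_separation] already separate the points of each g / F^m. *)
Lemma functional_sep (v : g) : (forall p (lam : g -> R^o), linear lam -> lam (comp p v) = 0) ->
  v = 0.
Proof.
move=> H; apply: comp_sep => p; rewrite comp0.
have [I [L [lL LP]]] := finite_separation tr (p + 1).
have : filt (p + 1) (comp p v) by apply/LP => i; exact: H.
by move=> /(_ p); rewrite comp_id; apply; lia.
Qed.

Lemma drv_uniq z X f v v' : ltangent z X -> is_drv z X f v -> is_drv z X f v' -> v = v'.
Proof.
move=> tX dv dv'; apply/eqP; rewrite -subr_eq0; apply/eqP/functional_sep => p lam ll.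
rewrite compB (linB ll); apply/eqP; rewrite subr_eq0; apply/eqP.
exact: (is_lderiv_uniq gt tX (dv p lam ll) (dv' p lam ll)).
Qed.

Lemma drvP z X f v : ltangent z X -> is_drv z X f v -> drv z X f = v.
Proof. by move=> tX dv; apply: (drv_uniq tX _ dv); exact: (xgetI 0 dv). Qed.

Lemma DvP V f z v : is_drv z (tilde V z) f v -> Dv V f z = v.
Proof.
move=> dv; rewrite /Dv.
have [X [tX hX dX]] : [set u | exists X, [/\ ltangent z X, is_theta z X V & is_drv z X f u]]
    (Dv V f z).
  apply: (@xgetI _ 0 _ v); exists (tilde V z); split => //; first exact: (ltan V z).
  exact: (tildeP gt V z).2.
have E := tilde_uniq gt tX hX; subst X.
exact: (drv_uniq tX dX dv).
Qed.

Definition smooth_valued z (f : limQ T -> g) := forall p (lam : g -> R^o), linear lam ->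
  lsmooth_at z (fun w => lam (comp p (f w))).

Lemma drv_exists z X f : ltangent z X -> smooth_valued z f -> exists v, is_drv z X f v.
Proof.
move=> tX sf.
have H p : exists v, forall lam : g -> R^o, linear lam ->
    is_lderiv z X (fun y => lam (comp p (f y))) (lam (comp p v)).
  have [r [e [c [lc cF ce cs]]]] := graded_basis tr (p + 1).
  exists (\sum_i lderiv z X (fun w => c i (comp p (f w))) *: e i) => lam ll.
  have E w : lam (comp p (f w)) = \sum_i lam (comp p (e i)) * c i (comp p (f w)).
    have := cs (comp p (f w)) p; rewrite compB comp_id comp_sum => H.
    have /eqP : comp p (f w) - \sum_i comp p (c i (comp p (f w)) *: e i) = 0 by apply: H; lia.
    rewrite subr_eq0 => /eqP {1}->; rewrite (lin_sum ll); apply: eq_bigr => i _.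
    by rewrite compZ (linZ ll) mulrC.
  have -> : lam (comp p (\sum_i lderiv z X (fun w => c i (comp p (f w))) *: e i)) =
      lderiv z X (fun w => lam (comp p (f w))).
    under [in RHS]eq_fun do rewrite E.
    rewrite (lderiv_sum gt) //; last by move=> i; exact: sf.
    rewrite comp_sum (lin_sum ll); apply: eq_bigr => i _.
    by rewrite compZ (linZ ll) mulrC.
  by apply: (lderiv_is gt) => //; exact: sf.
have [v vP] := choice H.
by exists (assemble v) => p lam ll; rewrite comp_assemble; exact: vP.
Qed.

(** [is_drv] and [smooth_valued] only test functionals of a single component; a functional killing
    F^m is a finite sum of such. *)
Lemma trunc_functional (lam : g -> R^o) m v : linear lam ->
  (forall u, filt m u -> lam u = 0) ->
  lam v = \sum_(p <- irange (- dp) (m - 1)) lam (comp p v).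
Proof.
move=> ll lm; rewrite -(lin_sum ll); apply/eqP; rewrite -subr_eq0 -(linB ll).
by apply/eqP/lm; exact: trunc_filt.
Qed.

Lemma smooth_valued_functional z f (lam : g -> R^o) m : smooth_valued z f -> linear lam ->
  (forall u, filt m u -> lam u = 0) -> lsmooth_at z (fun w => lam (f w)).
Proof.
move=> sf ll lm; under eq_fun do rewrite (trunc_functional _ ll lm).
by apply: (ga_sum (lgerm_algebra gt z)) => p _; exact: sf.
Qed.

Lemma drv_functional z X f v (lam : g -> R^o) m : ltangent z X -> is_drv z X f v ->
  linear lam -> (forall u, filt m u -> lam u = 0) -> lderiv z X (fun w => lam (f w)) = lam v.
Proof.
move=> tX dv ll lm; under eq_fun do rewrite (trunc_functional _ ll lm).
have sf p : lsmooth_at z (fun w => lam (comp p (f w))).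
  by have [n [h [H _]]] := dv p lam ll; exists n, h.
rewrite (trunc_functional _ ll lm).
transitivity (lderiv z X (fun w => \sum_(p <- irange (- dp) (m - 1)) 1 * lam (comp p (f w)))).
  by congr lderiv; apply/funext => w; apply: eq_bigr => p _; rewrite mul1r.
rewrite (lderiv_sum gt) //; apply: eq_bigr => p _; rewrite mul1r.
exact: (lderivP gt tX (dv p lam ll)).
Qed.

Lemma Dv_comp V f z v m : is_drv z (tilde V z) f v ->
  Dv V (fun w => comp m (f w)) z = comp m v.
Proof.
move=> dv; apply: DvP => p lam ll.
have [->|pm] := eqVneq p m.
  rewrite comp_id; under eq_fun do rewrite comp_id; exact: dv.
rewrite comp_comp (negPf pm) (lin0 ll).
under eq_fun do rewrite comp_comp (negPf pm) (lin0 ll).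
exists 0%N, (fun=> 0); split; first exact: lrep_cst.
by rewrite -(lderivE gt (ltan V z) (lrep_cst z 0%N 0)) (lderiv_cst gt _ (ltan V z)).
Qed.

End Derivatives.

Variable gam : limQ T -> g -> g -> g.
Hypothesis sfun : structure_function gam.

Lemma gam_bilin z : bilinear_map (gam z).
Proof. exact: (sfun.1 z).1. Qed.

Lemma gam_alt z : alternating_map (gam z).
Proof. exact: (sfun.1 z).2. Qed.

Lemma tilde_slvf U : smooth_lvf (@tilde R g T U).
Proof. by move=> z; split; [exact: (ltan U z)|move=> n f; exact: tilde_smooth]. Qed.

(** On fields of constant theta the derivative terms of d theta vanish, and the skew half-sum of
    gamma is gamma(U, V) itself. *)
Lemma gam_theta U V z : is_theta z (lbracket (tilde U) (tilde V) z) (gam z U V).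
Proof.
have := sfun.2 _ _ (tilde_slvf U) (tilde_slvf V) z.
have tw U' w : theta w (tilde U' w) = U'.
  exact: (thetaP gt (ltan U' w) (tildeP gt U' w).2).
have dc U' V' : drv z (tilde U' z) (fun=> V') = 0.
  apply: (drvP (ltan U' z)) => p lam ll; rewrite comp0 (lin0 ll).
  exists 0%N, (fun=> lam (comp p V')); split; first exact: lrep_cst.
  rewrite -(lderivE gt (ltan U' z) (lrep_cst z 0%N (lam (comp p V')))).
  by rewrite (lderiv_cst gt _ (ltan U' z)).
have fE U' : (fun w => theta w (tilde U' w)) = (fun=> U').
  by apply/funext => w; exact: tw.
rewrite !fE !dc !tw subrr sub0r (altC (gam_bilin z) (gam_alt z) V U) opprK.
have half : 2^-1 + 2^-1 = 1 :> R by rewrite -[in LHS]div1r -splitr.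
rewrite scalerDr -scalerDl half scale1r.
rewrite addrC => /eqP; rewrite subr_eq0 => /eqP ->.
have [v vP] := theta_exists gt (lbracket_tangent U V z).
by rewrite (thetaP gt (lbracket_tangent U V z) vP).
Qed.

Lemma BR_gam U V z phi : lsmooth_at z phi -> BR U V phi z = DO (gam z U V) phi z.
Proof.
move=> sp; have [n [h H]] := sp.
rewrite (DO_lrep _ H) -(tilde_uniq gt (lbracket_tangent U V z) (gam_theta U V z)).
rewrite lbracket_BR; last exact: H.1.
apply/esym/BR_ext => //.
have ff := lnear_filter gt z.
by apply: filterS (lrep_near H) => w [_ [N wN Nf]] /=; rewrite Nf //; exact: nbhs_singleton.
Qed.

(** For t on level m the function [D_U, D_V] t is smooth and equals D_gamma(U,V) t. These equations
    have smooth coefficients and determine gamma(U, V) modulo F^m, so Cramer's rule applies. *)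
Lemma gam_smooth z U V : smooth_valued z (fun w => gam w U V).
Proof.
move=> p lam ll; pose m := (absz p).+1.
have [r [e [c [lc cF ce cs]]]] := graded_basis tr m%:Z.
have ff := lnear_filter gt z.
apply: (@ga_coords R _ _ _ _ (lgerm_algebra gt z) g (tQ T m -> R) (smooth_at (z m))
  r e c (filt m%:Z) (fun w v t => tilde v w m t) (fun w => gam w U V) ce lc cF cs
  _ _ _ _ (fun v => lam (comp p v))).
- apply: lnearW => w t _; split; first by move=> a u v; rewrite tilde_lin.
  by move=> v /(tilde_filt gt _ w) ->.
- by move=> v; exact: level_filt.
- by move=> v t; exact: tilde_smooth.
- move=> t st; apply: (ga_ext (lgerm_algebra gt z) (f := BR U V (fun w => t (w m)))).
    by apply: BR_smooth; exact: lsmooth_level.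
  have n2 := lnear_nbhs (smooth_near_pt st).
  apply: filterS n2 => w sw /=.
  by rewrite (BR_gam _ _ (lsmooth_level sw)) (DO_lrep _ (lrep_level sw)).
- by move=> a u v /=; rewrite compD compZ ll.
- by move=> v fv; rewrite fv ?(lin0 ll) // /m; lia.
Qed.

Definition dgam W U V z : g := Dv W (fun w => gam w U V) z.

Lemma dgamP W U V z : is_drv z (tilde W z) (fun w => gam w U V) (dgam W U V z).
Proof.
have [v dv] := drv_exists (ltan W z) (@gam_smooth z U V).
by rewrite /dgam (DvP dv).
Qed.

(** Leibniz rule for D_gamma(U,V) phi, expanded in a basis e_i of g / F^m, together with D_W D_(e_i)
    = D_(e_i) D_W - D_gamma(e_i,W). The level m is large enough for both phi and D_W phi. *)
Lemma DO_BR U V W z phi : lsmooth_at z phi -> DO W (BR U V phi) z =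
  DO (dgam W U V z) phi z + DO (gam z U V) (DO W phi) z - DO (gam z (gam z U V) W) phi z.
Proof.
move=> sp; have ff := lnear_filter gt z.
have sW := DO_smooth W sp.
have [m1 H1] := DO_filt sp; have [m2 H2] := DO_filt sW.
pose m := maxn m1 m2.
have {}H1 := H1 m (leq_maxl _ _); have {}H2 := H2 m (leq_maxr _ _).
have [r [e [c [lc cF ce cs]]]] := graded_basis tr m%:Z.
have expand w psi : lsmooth_at w psi -> (forall U, filt m%:Z U -> DO U psi w = 0) ->
    forall v, DO v psi w = \sum_i c i v * DO (e i) psi w.
  move=> sw k v; have := k _ (cs v); have l := DO_lin sw.
  rewrite (linB l) (lin_sum l) => /eqP; rewrite subr_eq0 => /eqP ->.
  by apply: eq_bigr => i _; rewrite (linZ l).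
have E : DO W (BR U V phi) z = DO W (fun w => \sum_i c i (gam w U V) * DO (e i) phi w) z.
  apply/esym/DO_ext; first exact: BR_smooth.
  apply: filterS2 H1 (lsmooth_near gt sp) => w kw sw /=.
  by rewrite BR_gam // expand.
have sc i : lsmooth_at z (fun w => c i (gam w U V)).
  by apply: (@smooth_valued_functional z _ (c i) m%:Z) => //; [exact: gam_smooth|move=> u /cF].
rewrite E {1}/derivation (lderiv_sumM gt _ (ltan W z)) //; last by move=> i; exact: DO_smooth.
have K1 := lnear_pt H1; have K2 := lnear_pt H2.
rewrite big_split /=.
have -> : \sum_i lderiv z (tilde W z) (fun w => c i (gam w U V)) * DO (e i) phi z =
    DO (dgam W U V z) phi z.
  rewrite (expand z phi) //; apply: eq_bigr => i _.
  by rewrite (drv_functional (m := m%:Z) (ltan W z) (dgamP W U V z)) // => u /cF.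
rewrite -addrA; congr (_ + _).
have EW i : lderiv z (tilde W z) (DO (e i) phi) =
    DO (e i) (DO W phi) z - DO (gam z (e i) W) phi z.
  by rewrite -BR_gam // /bracket_op opprB addrC subrK.
under eq_bigr do rewrite EW mulrBr.
rewrite sumrB -(expand z) //; congr (_ - _).
have l := DO_lin sp; have [gl gr] := gam_bilin z.
set v := gam z U V; set s := \sum_i c i v *: e i.
transitivity (DO (gam z s W) phi z).
  rewrite /s (lin_sum (gr W)) (lin_sum l); apply: eq_bigr => i _.
  by rewrite (linZ (gr W)) (linZ l).
(* The truncation error v - s lies in F^m. Instead of estimating gamma(v - s, W), one notes that its
   derivation is the commutator [D_(v-s), D_W], both terms of which vanish on phi. *)
apply/eqP; rewrite eq_sym -subr_eq0.
rewrite -[_ - _]/((fun U => DO U phi z : R^o) _ - (fun U => DO U phi z : R^o) _).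
rewrite -(linB l) -(linB (gr W)) -/(gam z (v - s) W) -BR_gam // /bracket_op.
rewrite K2; last exact: cs.
have -> : DO W (DO (v - s) phi) z = 0; last by rewrite subrr.
have <- : DO W (fun=> 0) z = 0 by exact: (lderiv_cst gt 0 (ltan W z)).
apply: DO_ext; first exact: (ga_cst (lgerm_algebra gt z)).
by apply: filterS H1 => w kw /=; rewrite kw //; exact: cs.
Qed.

(* The Jacobi identity for the vector fields of constant theta, i.e. d^2 = 0 *)
Theorem bianchi U V W z :
  (gam z (gam z U V) W - dgam W U V z) + (gam z (gam z V W) U - dgam U V W z)
  + (gam z (gam z W U) V - dgam V W U z) = 0.
Proof.
apply: (@DO_eq0 z) => phi sp.
have l := DO_lin sp.
rewrite (linD l) (linD l) !(linB l).
(* Each cyclic term becomes [D_A, D_B] D_C - D_C [D_A, D_B]; the twelve third order terms cancel in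
   pairs. *)
have J A B C : DO (gam z (gam z A B) C) phi z - DO (dgam C A B z) phi z =
    (DO A (DO B (DO C phi)) z - DO B (DO A (DO C phi)) z)
    - (DO C (DO A (DO B phi)) z - DO C (DO B (DO A phi)) z).
  have := DO_BR A B C sp.
  rewrite -(BR_gam A B (DO_smooth C sp)) /bracket_op.
  rewrite DO_sub; try by do 2!apply: DO_smooth.
  move=> ->; ring.
rewrite !J; ring.
Qed.

End Bianchi.

(** * Leading parts of the structure function *)

Section LeadingParts.
Variables (R : realType) (g : gradedLie R) (T : towerData g).
Hypothesis tr : transitive_gl g.
Hypothesis gt : geometric_tower T.
Variable gam : limQ T -> g -> g -> g.
Hypothesis sfun : structure_function gam.
Implicit Types (z w : limQ T) (A X Y u v : g).
Local Notation dp := (depth g)%:Z.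
Local Existing Instance lnear_filter.
Local Notation DO := derivation.

Lemma comp_functional p u v :
  (forall lam : g -> R^o, linear lam -> lam (comp p u) = lam (comp p v)) ->
  comp p u = comp p v.
Proof.
move=> H; apply/eqP; rewrite -subr_eq0 -compB; apply/eqP; apply: (functional_sep tr).
move=> q lam ll; rewrite comp_comp; case: eqP => [->|_]; last exact: lin0.
by rewrite compB (linB ll) H // subrr.
Qed.

(** [theta_comp] bounds the difference by the degree of V. Here the degree of b is known instead; it
    passes to V by induction, each application of [theta_comp] gaining at least one degree. *)
Lemma theta_comp_inv z (X : forall n, tvec (tQ T n)) n V zeta b : ltangent z X -> is_theta z X V ->
  cls T n (z n.+1) zeta -> zeta b = X n ->
  forall q s, filt q b -> s <= n%:Z -> s <= q + n.+1%:Z -> filt s (b - V).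
Proof.
move=> tX tV cz zb q s fb sn sq.
suff fV : filt (Num.min q n%:Z) V.
  by apply: (theta_comp gt tX tV cz zb fV) => //; lia.
suff H (k : nat) : - dp + k%:Z <= Num.min q n%:Z -> filt (- dp + k%:Z) V.
  have [qd|qd] := leP (Num.min q n%:Z) (- dp); first exact: filt_depth.
  have := H (absz (Num.min q n%:Z + dp)).
  have -> : - dp + (absz (Num.min q n%:Z + dp))%:Z = Num.min q n%:Z by lia.
  by apply.
elim: k => [|k IH] kn; first by apply: filt_depth; lia.
have fV : filt (- dp + k%:Z) V by apply: IH; lia.
have -> : V = b - (b - V) by rewrite subKr.
apply: filtB; first by apply: filt_le fb; lia.
by apply: (theta_comp gt tX tV cz zb fV); lia.
Qed.

Definition frame_field n (x : tQ T n) (Z : tQ T n -> g -> tvec (tQ T n)) : Prop :=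
  exists U, [/\ open U, U x, forall y, U y -> filtered_iso y (Z y) &
    forall y v, U y -> smooth_vf_at y (Z^~ v)].

Lemma frame_field_exists n z zeta : cls T n (z n.+1) zeta ->
  exists2 Z, frame_field (z n) Z & Z (z n) = zeta.
Proof.
move=> cz; have [U [Z [oU Uz Zz Zc Zs]]] := local_frame gt cz.
rewrite lpt_compat in Uz Zz; exists Z => //; exists U; split => // y Uy.
by have [w' <- cw] := Zc y Uy; exact: cls_iso cw.
Qed.

(** Independence is not demanded, so that the homogeneous family used in negative degrees qualifies
    as well as a basis. *)
Definition coord_family n (I : finType) (E : I -> g) (C : I -> g -> R^o) : Prop :=
  [/\ forall i, linear (C i), forall v, filt n v -> forall i, C i v = 0 &
   forall v, filt n (v - \sum_i C i v *: E i)].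

Lemma tangent_smooth_ext (M : manifold R) (x : M) (v v' : tvec M) :
  tangent x v -> tangent x v' -> (forall f, smooth_at x f -> v f = v' f) -> v = v'.
Proof.
move=> [v0 _ _ _] [v0' _ _ _] H; apply/funext => f.
by have [/H//|nf] := pselect (smooth_at x f); rewrite v0 // v0'.
Qed.

Lemma filtered_iso_tangent n (x : tQ T n) zeta v : filtered_iso x zeta ->
  tangent x (zeta v).
Proof. by move=> [_ _ <- _]; exists v. Qed.

(** Cramer's rule with the smooth functions at x as test points. The germ algebra stays abstract
    because coordinates are needed both on the limit and on a single level of the tower. *)
Lemma coords_smooth (S : Type) (F : set_system S) (s : S) (sm : set (S -> R))
    n (x : tQ T n) (Z : S -> g -> tvec (tQ T n)) (u : S -> g) :
  germ_algebra F s sm ->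
  filtered_iso x (Z s) -> F [set y | exists x', filtered_iso x' (Z y)] ->
  (forall v f, smooth_at x f -> sm (fun y => Z y v f)) ->
  (forall f, smooth_at x f -> sm (fun y => Z y (u y) f)) ->
  forall lam : g -> R^o, linear lam -> (forall v, filt n%:Z v -> lam v = 0) ->
  sm (fun y => lam (u y)).
Proof.
move=> ga iz FZ sZ su lam ll lF.
have [r [e [c [lc cF ce cs]]]] := graded_basis tr n%:Z.
have ff := ga_filter ga.
apply: (@ga_coords R _ _ _ _ ga g (tQ T n -> R) (smooth_at x)
  r e c (filt n%:Z) Z u ce lc cF cs) => //.
- apply: filterS FZ => y [x' [lz kz _ _]] f _; split.
    by move=> a v v'; rewrite lz.
  by move=> v /kz ->.
- move=> v H; have [lz kz tz _] := iz; apply/kz.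
  apply: (@tangent_smooth_ext _ x) => //.
    exact: filtered_iso_tangent.
  by rewrite -(lin0 lz); exact: filtered_iso_tangent.
Qed.

Lemma frame_field_near n z Z : frame_field (z n) Z ->
  lnear z [set w | filtered_iso (w n) (Z (w n)) /\ forall v, smooth_vf_at (w n) (Z^~ v)].
Proof.
have ff := lnear_filter gt z.
move=> [U [oU Uz Zi Zs]].
apply: filterS (lnear_nbhs (open_nbhs_nbhs (conj oU Uz))) => w Uw.
by split; [exact: Zi|move=> v; exact: Zs].
Qed.

(** The coordinates u are chosen pointwise and are determined only modulo F^n, so smoothness is
    claimed only for functionals vanishing there. *)
Lemma frame_coords n z (Z : tQ T n -> g -> tvec (tQ T n)) X : frame_field (z n) Z -> exists u : limQ T -> g,
  lnear z [set w : limQ T | Z (w n) (u w) = tilde X w n] /\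
  forall lam : g -> R^o, linear lam -> (forall v, filt n%:Z v -> lam v = 0) ->
  lsmooth_at z (fun w => lam (u w)).
Proof.
move=> ffZ; have ff := lnear_filter gt z; have nZ := frame_field_near ffZ.
have [iz sz] := lnear_pt nZ.
have ex w : exists v, filtered_iso (w n) (Z (w n)) -> Z (w n) v = tilde X w n.
  have [iw|] := pselect (filtered_iso (w n) (Z (w n))); last by move=> ?; exists 0.
  have [_ _ tw _] := iw; have := (tilde_tangent gt X w n).1.
  by rewrite -tw => -[v _ <-]; exists v.
have [u uP] := choice ex; exists u.
have nu : lnear z [set w : limQ T | Z (w n) (u w) = tilde X w n].
  by apply: filterS nZ => w [iw _]; exact: uP.
split => //; apply: (coords_smooth (Z := fun w => Z (w n)) (lgerm_algebra gt z) iz).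
- by apply: filterS nZ => w [iw _]; exists (w n).
- by move=> v f sf; apply: (@lsmooth_level _ _ _ z n (fun y => Z y v f)); exact: (sz v).2.
- move=> f sf; apply: (ga_ext (lgerm_algebra gt z) (f := fun w => tilde X w n f)).
    exact: tilde_smooth.
  by apply: filterS nu => w /= ->.
Qed.

Section Coordinates.
Variables (n : nat) (z : limQ T) (Z : tQ T n -> g -> tvec (tQ T n)).
Hypothesis ffZ : frame_field (z n) Z.
Variables (X : g) (u : limQ T -> g).
Hypothesis uX : lnear z [set w : limQ T | Z (w n) (u w) = tilde X w n].
Hypothesis su : forall lam : g -> R^o, linear lam ->
  (forall v, filt n%:Z v -> lam v = 0) -> lsmooth_at z (fun w => lam (u w)).
Variables (I : finType) (E : I -> g) (C : I -> g -> R^o).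
Hypothesis fam : coord_family n%:Z E C.

Definition coord_derivative A : g := \sum_i DO A (fun w => C i (u w)) z *: E i.

Lemma coord_expand (lam : g -> R^o) v : linear lam -> (forall v, filt n%:Z v -> lam v = 0) ->
  lam v = \sum_i C i v * lam (E i).
Proof.
move=> ll lF; have [lC CF Cs] := fam.
have := lF _ (Cs v); rewrite (linB ll) (lin_sum ll) => /eqP; rewrite subr_eq0 => /eqP ->.
by apply: eq_bigr => i _; rewrite (linZ ll).
Qed.

Lemma coord_smooth i : lsmooth_at z (fun w => C i (u w)).
Proof. by have [lC CF _] := fam; apply: su => // v /CF. Qed.

Lemma coord_derivativeP A (lam : g -> R^o) : linear lam ->
  (forall v, filt n%:Z v -> lam v = 0) ->
  lam (coord_derivative A) = DO A (fun w => lam (u w)) z.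
Proof.
move=> ll lF; under [in RHS]eq_fun do rewrite (coord_expand _ ll lF).
have Ec : (fun w => \sum_i C i (u w) * lam (E i)) = (fun w => \sum_i lam (E i) * C i (u w)).
  by apply/funext => w; apply: eq_bigr => i _; rewrite mulrC.
rewrite Ec {1}/derivation (lderiv_sum gt _ _ (tilde_tangent gt A z)); last exact: coord_smooth.
rewrite (lin_sum ll); apply: eq_bigr => i _; by rewrite (linZ ll) mulrC.
Qed.

(** Leibniz rule for D_X f = sum of C_i(u) Z(E_i) f: one part differentiates the coordinates, the
    other the frame. *)
Lemma second_derivative A f : smooth_at (z n) f ->
  DO A (DO X (fun w => f (w n))) z = Z (z n) (coord_derivative A) f +
  \sum_i C i (u z) * tilde A z n (fun y => Z y (E i) f).
Proof.
move=> sf; have ff := lnear_filter gt z.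
have nZ := frame_field_near ffZ; have [[lz _ _ _] sz] := lnear_pt nZ.
have sE i : smooth_at (z n) (fun y => Z y (E i) f) by exact: (sz (E i)).2.
transitivity (DO A (fun w => \sum_i C i (u w) * Z (w n) (E i) f) z).
  apply/esym/(DO_ext gt); first by apply: DO_smooth => //; exact: lsmooth_level.
  apply: filterS3 uX nZ (DO_near gt (lrep_level sf)) => w uw [[lw kw _ _] _] Dw /=.
  rewrite Dw -uw.
  have lt : linear ((fun v => Z (w n) v f) : g -> R^o).
    by move=> a v v'; rewrite lw.
  by rewrite (coord_expand (u w) lt) // => v /kw ->.
rewrite {1}/derivation (lderiv_sumM gt _ (tilde_tangent gt A z)); last 2 first.
- exact: coord_smooth.
- by move=> i; apply: (@lsmooth_level _ _ _ z n (fun y => Z y (E i) f)).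
rewrite big_split /=; congr (_ + _).
  rewrite (lin_sum lz) tvec_sum; apply: eq_bigr => i _.
  by rewrite (linZ lz).
apply: eq_bigr => i _; congr (_ * _).
by rewrite (lderiv_level gt (tilde_tangent gt A z) (sE i)).
Qed.

End Coordinates.

Lemma basis_family m : exists (I : finType) (E : I -> g) (C : I -> g -> R^o),
  coord_family m E C.
Proof.
by have [r [e [c [lc cF _ cs]]]] := graded_basis tr m; exists 'I_r, e, c.
Qed.

Hypothesis abb : forall n, acts_by_bracket T n.

Section Vertical.
Variables (a : nat) (z : limQ T) (A : g).
Hypothesis fA : filt a%:Z A.
Local Notation y0 := (z a.+1).

Lemma tilde_fund : tilde A z a.+1 = fund y0 (comp a%:Z A).
Proof.
have [zeta cz] := cls_nonempty gt (z a.+2).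
have [tA hA] := tildeP gt A z.
have [b zb] := ltangent_rep gt tA cz.
have iz := lcls_iso gt cz.
have := cls_fund gt cz (homog_comp a%:Z A); rewrite lpt_compat => <-.
rewrite -zb; apply/(filtered_iso_eq _ _ iz).
apply: (@filtB_trans _ _ _ _ A).
  by apply: (theta_comp gt tA hA cz zb fA); lia.
have -> : (a.+1)%:Z = a%:Z + 1 by lia.
apply: filtS; last by rewrite compB comp_id subrr.
by apply: filtB => //; exact: homog_filt (homog_comp _ _) _.
Qed.

(** Along the orbit of y0 the function h is the matrix coefficient b |-> lam (comp p (rho b X)),
    whose derivative at 1 is prescribed by [acts_by_bracket]. *)
Lemma act_derivative x p X (lam : g -> R^o) (zeta0 : g -> tvec (tQ T a))
    (h : tQ T a.+1 -> R) : filt x X -> p <= x + a%:Z -> p < a%:Z -> linear lam ->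
  cls T a y0 zeta0 -> smooth_at y0 h ->
  (forall y zeta v, proj T a y = z a -> cls T a y zeta -> zeta0 v = zeta X ->
    h y = lam (comp p v)) ->
  tilde A z a.+1 h = lam (comp p (br (comp a%:Z A) (neg X))).
Proof.
move=> fX px pa ll c0 sh hP; rewrite tilde_fund /fund pushE; last first.
  by rewrite (ps_act_one (gt_bundle gt a)).
have -> : h \o act T a y0 = (fun b => lam (comp p (rho T a b X))).
  apply/funext => b /=.
  apply: (hP _ (zeta0 \o rho T a b)) => //.
    by rewrite (ps_act_proj (gt_bundle gt a)) lpt_compat.
  exact: (ps_act_cls (gt_bundle gt a)).
exact: (abb (homog_comp a%:Z A) fX pa px ll).
Qed.

(* At level a the field with theta = A vanishes, and at level a.+1 it is the    *)
(* generator of the action of G_a.  In a frame Z of level a, the coordinates of *)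
(* degree <= x + a of the field with theta = X only depend on level a.+1, where *)
(* G_a acts on them by rho; so the derivative along A is given by drho.        *)
Lemma gam_vertical x X p : filt x X -> p <= x + a%:Z -> p < a%:Z ->
  comp p (gam z A X) = comp p (br (comp a%:Z A) (neg X)).
Proof.
move=> fX; have [zeta0 c0] := cls_nonempty gt y0.
have [Z ffZ Zz] := frame_field_exists c0.
have [u [uX su]] := frame_coords X ffZ.
have [I [E [C fam]]] := basis_family a%:Z.
have i0 := lcls_iso gt c0; have [l0 k0 _ _] := i0.
have ff := lnear_filter gt z; have nZ := frame_field_near ffZ.
have [tg hg] := tildeP gt (gam z A X) z.
pose du := coord_derivative z u E C A.
(* Since the field of A vanishes at level a, only the derivative along A of the coordinates of X
   survives in the commutator. *)
have zdu : zeta0 du = tilde (gam z A X) z a.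
  apply: (@tangent_smooth_ext _ (z a)); first exact: filtered_iso_tangent.
    exact: (tg a).1.
  move=> f sf; rewrite -(DO_lrep gt _ (lrep_level sf)) -(BR_gam tr gt sfun); last first.
    exact: lsmooth_level.
  rewrite /bracket_op (second_derivative ffZ uX su fam) // Zz.
  have tA0 w : tilde A w a = 0 by apply/(tilde_filt gt).
  have -> : DO X (DO A (fun w => f (w a))) z = 0.
    have <- : DO X (fun=> 0) z = 0 by exact: (lderiv_cst gt 0 (tilde_tangent gt X z)).
    apply: (DO_ext gt); first exact: (ga_cst (lgerm_algebra gt z)).
    by apply: filterS (DO_near gt (lrep_level sf)) => w /= ->; rewrite tA0.
  by rewrite tA0 big1 ?subr0 ?addr0 // => i _; rewrite mulr0.
have key q (lam : g -> R^o) : q <= x + a%:Z -> q < a%:Z -> linear lam ->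
    lam (comp q du) = lam (comp q (br (comp a%:Z A) (neg X))).
  move=> qx qa ll.
  have llq : linear ((fun v => lam (comp q v)) : g -> R^o).
    by move=> b v v'; rewrite compD compZ ll.
  have lF v : filt a%:Z v -> lam (comp q v) = 0 by move=> /(_ q qa) ->; rewrite (lin0 ll).
  rewrite (coord_derivativeP su fam A llq lF).
  have [B [zeta [oB Bz cz sz]]] := smooth_rep tr gt (z a).
  have [U [oU Uz Zi Zs]] := ffZ.
  pose good y := [/\ U (proj T a y), B (proj T a y) & cls T a y (zeta y)].
  have gy0 : U (proj T a y0) /\ B (proj T a y0) by rewrite lpt_compat.
  have ng : \forall y \near y0, good y.
    have [cp _] := proj_smooth gt z a.
    have nU : nbhs (proj T a y0) (U `&` B).
      by apply: open_nbhs_nbhs; split; [exact: openI|].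
    have np : \forall y \near y0, (U `&` B) (proj T a y) by apply: cp.
    by apply: filterS np => y [Uy By]; split => //; exact: cz.
  (* v y are the coordinates in Z of the constant X in the representative at y. They depend on level
     a + 1 alone, and by [theta_comp] they agree with those of the field of X modulo F^min(x+a+1,
     a), hence in degree q. *)
  have ex y : exists v, good y -> Z (proj T a y) v = zeta y X.
    have [[Uy By cy]|] := pselect (good y); last by move=> ?; exists 0.
    have [_ _ ty _] := Zi _ Uy; have := filtered_iso_tangent X (cls_iso gt cy).
    by rewrite -ty => -[v _ <-]; exists v.
  have [v vP] := choice ex.
  have sv : smooth_at y0 (fun y => lam (comp q (v y))).
    apply: (coords_smooth (x := z a) (Z := fun y => Z (proj T a y)) (u := v)
        (smooth_germ_algebra y0) _ _ _ _ llq lF).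
    - by rewrite lpt_compat Zz.
    - by apply: filterS ng => y [Uy _ _]; exists (proj T a y); exact: Zi.
    - move=> v' f sf; apply: ((proj_smooth gt z a).2 (fun y => Z y v' f)).
      by rewrite lpt_compat; apply: (Zs _ v' Uz).2.
    - move=> f sf; apply: (smooth_ext (f := fun y => zeta y X f)).
        by apply: sz; rewrite lpt_compat.
      by apply: filterS ng => y gy; rewrite vP.
  have vE y zeta1 v1 : U (proj T a y) -> B (proj T a y) -> cls T a y zeta1 ->
      Z (proj T a y) v1 = zeta1 X -> comp q (v y) = comp q v1.
    move=> Uy By c1 zv1; have cy := cz _ By.
    have iy := cls_iso gt cy; have iZ := Zi _ Uy; have [ly _ _ _] := iy.
    have [c Hc E1] := cls_rel gt cy c1.
    have zv : Z (proj T a y) (v y) = zeta y X by apply: vP.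
    have [lZ _ _ _] := iZ.
    pose s := Num.min (x + a%:Z + 1) a%:Z.
    have : filt s (v y - v1).
      have sa : s <= a%:Z by rewrite /s; lia.
      apply/(filtered_iso_TF _ iZ sa); rewrite (linB lZ) zv zv1 E1 /= -(linB ly).
      apply/(filtered_iso_TF _ iy sa); apply: filtBC.
      by apply: filt_le (Hc.2 _ _ fX); rewrite /s; lia.
    move=> /(_ q); rewrite compB => H; apply/eqP; rewrite -subr_eq0 H //.
    by rewrite /s; lia.
  rewrite -(act_derivative fX qx qa ll c0 sv); last first.
    move=> y zeta1 v1 py c1 zv1; congr lam.
    by apply: (@vE y zeta1); rewrite ?py ?Zz.
  rewrite -(DO_lrep gt A (lrep_level sv)).
  apply: (DO_ext gt); first exact: (lsmooth_level sv).
  have nw := lnear_nbhs ng.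
  apply: filterS3 uX nw nZ => w uw [Uw Bw cw] [iw _] /=.
  rewrite (lpt_compat w) in Uw Bw.
  have [tX hX] := tildeP gt X w; have [b zb] := ltangent_rep gt tX cw.
  have := theta_comp gt tX hX cw zb fX.
  have [ly _ _ _] := lcls_iso gt cw; have [lZ _ _ _] := iw => H.
  pose s := Num.min (x + a%:Z + 1) a%:Z.
  have sa : s <= a%:Z by rewrite /s; lia.
  have gw : good (w a.+1) by split; rewrite ?lpt_compat.
  have zv := vP _ gw; rewrite lpt_compat in zv.
  have : filt s (u w - v (w a.+1)).
    apply/(filtered_iso_TF _ iw sa); rewrite (linB lZ) uw zv -zb -(linB ly).
    by apply/(filtered_iso_TF _ (lcls_iso gt cw) sa); apply: H => //; rewrite /s; lia.
  move=> /(_ q); rewrite compB => K; congr lam; apply/eqP.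
  by rewrite eq_sym -subr_eq0 K // /s; lia.
move=> px pa.
have cdu q : q <= x + a%:Z -> q < a%:Z -> comp q du = comp q (br (comp a%:Z A) (neg X)).
  by move=> qx qa; apply: comp_functional => lam ll; exact: key.
have fbr : filt (a%:Z + x) (br (comp a%:Z A) (neg X)).
  by apply: filt_br; [exact: homog_filt (homog_comp _ _) _|exact: filt_neg].
have fdu : filt (Num.min (x + a%:Z) a%:Z) du.
  by move=> q qm; rewrite cdu; [apply: fbr|..]; lia.
(* As du lies in F^min(x+a, a), it agrees with gamma(A, X) modulo F^min(x+a+1, a), and p is below
   this bound. *)
have := theta_comp_inv tg hg c0 zdu fdu.
move=> /(_ (Num.min (x + a%:Z + 1) a%:Z)) H.
have : filt (Num.min (x + a%:Z + 1) a%:Z) (du - gam z A X) by apply: H; lia.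
move=> /(_ p); rewrite compB -cdu // => K; apply/eqP.
by rewrite eq_sym -subr_eq0 K //; lia.
Qed.

End Vertical.

End LeadingParts.

(** * The leading part of gamma on two negative arguments *)

Section NegativePart.
Variables (R : realType) (g : gradedLie R) (T : towerData g).
Hypothesis tr : transitive_gl g.
Hypothesis gt : geometric_tower T.
Variable gam : limQ T -> g -> g -> g.
Hypothesis sfun : structure_function gam.
Implicit Types (z w : limQ T) (A X Y u v : g).
Local Notation dp := (depth g)%:Z.
Local Existing Instance lnear_filter.
Local Notation DO := derivation.

(** [gr_morphism] speaks of homogeneous vectors only. Projecting a basis of g / F^0 onto every
    negative degree gives a homogeneous family that still spans. *)
Lemma homogeneous_family : exists (I : finType) (E : I -> g) (C : I -> g -> R^o) (d : I -> int),
  coord_family 0 E C /\ forall i,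
  [/\ d i < 0, homog (d i) (E i) & forall v, comp (d i) v = 0 -> C i v = 0].
Proof.
have [r [e [c [lc cF _ cs]]]] := graded_basis tr 0.
pose d (k : 'I_(depth g)) : int := - (k.+1)%:Z.
have d0 k : d k < 0 by rewrite /d; lia.
exists ('I_(depth g) * 'I_r)%type, (fun k => comp (d k.1) (e k.2)),
  (fun k v => c k.2 (comp (d k.1) v)), (fun k => d k.1).
split; last first.
  move=> k; split; [exact: d0|exact: homog_comp|by move=> v ->; exact: lin0].
split.
- by move=> k a u v; rewrite compD compZ lc.
- by move=> v fv k; rewrite fv ?(lin0 (lc _)) // d0.
move=> v.
have -> : \sum_k c k.2 (comp (d k.1) v) *: comp (d k.1) (e k.2) = \sum_k comp (d k) v.
  rewrite -(pair_bigA _ (fun k i => c i (comp (d k) v) *: comp (d k) (e i))) /=.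
  apply: eq_bigr => k _; have := cs (comp (d k) v) (d k) (d0 k).
  rewrite compB comp_id comp_sum => /eqP; rewrite subr_eq0 => /eqP H; rewrite [RHS]H.
  by apply: eq_bigr => i _; rewrite compZ.
move=> p p0; rewrite compB comp_sum.
have [pd|pd] := ltP p (- dp).
  by rewrite comp_depth // big1 ?subr0 // => k _; rewrite comp_depth.
have lk : ((absz p).-1 < depth g)%N by lia.
rewrite (bigD1 (Ordinal lk)) //= big1 ?addr0.
  have <- : p = d (Ordinal lk) by rewrite /d /=; lia.
  by rewrite comp_id subrr.
move=> k; rewrite -val_eqE /= => kp; rewrite comp_comp ifF //; apply/eqP.
by rewrite /d => E; move/eqP: kp; apply; lia.
Qed.

(* In a frame field Z of level 0 the coordinates of the two fields lie in F^x   *)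
(* and F^y, so modulo F^(x+y+1) their bracket is that of sections of F^x and    *)
(* F^y, which is the bracket of g because gr Z preserves brackets.              *)
Lemma gam_negative x y X Y z : x < 0 -> y < 0 -> homog x X -> homog y Y ->
  filt (x + y) (gam z X Y) /\ comp (x + y) (gam z X Y) = br X Y.
Proof.
move=> x0 y0 hX hY.
have [zeta0 f0 cE] := cls_frame gt (z 1%N).
have c0 : cls T 0 (z 1%N) zeta0 by rewrite cE; exists id => //; exact: FGL_id.
rewrite lpt_compat in f0; have [i0 grm] := f0.
have [Z ffZ Zz] := frame_field_exists gt c0.
have [u [uX su]] := frame_coords tr gt X ffZ.
have [v [vY sv]] := frame_coords tr gt Y ffZ.
have [I [E [C [d [fam dP]]]]] := homogeneous_family.
have [lC CF Cs] := fam.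
have ff := lnear_filter gt z; have nZ := frame_field_near gt ffZ.
have [l0 k0 _ F0] := i0.
have [tg hg] := tildeP gt (gam z X Y) z.
pose du := coord_derivative z u E C Y; pose dv := coord_derivative z v E C X.
pose br0 i j := vbracket (fun y => Z y (E i)) (fun y => Z y (E j)) (z 0%N).
have sE i : smooth_vf_at (z 0%N) (fun y => Z y (E i)) by exact: (lnear_pt nZ).2.
have u_filt q A a (uA : lnear z [set w : limQ T | Z (w 0%N) (a w) = tilde A w 0]) :
    homog q A -> q < 0 -> lnear z [set w | filt q (a w)].
  move=> hA q0; apply: filterS2 uA nZ => w aw [iw _] /=.
  apply/(filtered_iso_TF _ iw (ltW q0)); rewrite aw.
  have [zeta cz] := cls_nonempty gt (w 1%N).
  have [tA hA'] := tildeP gt A w; have [b zb] := ltangent_rep gt tA cz.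
  rewrite -zb; apply/(filtered_iso_TF _ (lcls_iso gt cz) (ltW q0)).
  have fA : filt q A by exact: homog_filt hA _.
  rewrite -[b](subrK A); apply: filtD => //.
  by apply: (theta_comp gt tA hA' cz zb fA); lia.
have u_lead q A a (uA : lnear z [set w : limQ T | Z (w 0%N) (a w) = tilde A w 0]) :
    homog q A -> q < 0 -> comp q (a z) = A.
  move=> hA q0; have aw := lnear_pt uA; rewrite /= Zz in aw.
  have [tA hA'] := tildeP gt A z.
  have H := theta_comp gt tA hA' c0 aw (homog_filt hA (lexx _)).
  have : filt (q + 1) (a z - A) by apply: H; lia.
  move=> /(_ q); rewrite compB hA => K; apply/eqP; rewrite -subr_eq0 K //; lia.
(* Near z the coordinates of a field of degree q have no component below q, so neither have their
   derivatives. *)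
have d_filt q A B a (uA : lnear z [set w : limQ T | Z (w 0%N) (a w) = tilde A w 0])
    (sa : forall lam : g -> R^o, linear lam ->
      (forall v, filt 0 v -> lam v = 0) -> lsmooth_at z (fun w => lam (a w))) :
    homog q A -> q < 0 -> filt q (coord_derivative z a E C B).
  move=> hA q0 p pq; rewrite -(comp0 g p); apply: (comp_functional tr) => lam ll.
  have llp : linear ((fun v => lam (comp p v)) : g -> R^o).
    by move=> b v1 v2; rewrite compD compZ ll.
  have lF v1 : filt 0 v1 -> lam (comp p v1) = 0.
    by move=> ->; rewrite ?(lin0 ll) //; lia.
  rewrite (@coord_derivativeP _ _ _ gt 0 z a sa I E C fam B _ llp lF).
  rewrite comp0 (lin0 ll).
  have <- : DO B (fun=> 0) z = 0 by exact: (lderiv_cst gt 0 (tilde_tangent gt B z)).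
  apply: (DO_ext gt); first exact: (ga_cst (lgerm_algebra gt z)).
  by apply: filterS (u_filt q A a uA hA q0) => w fw /=; rewrite fw // (lin0 ll).
have fu := lnear_pt (u_filt x X u uX hX x0); have fv := lnear_pt (u_filt y Y v vY hY y0).
have eu := u_lead x X u uX hX x0; have ev := u_lead y Y v vY hY y0.
pose us := \sum_i C i (u z) *: E i; pose vs := \sum_i C i (v z) *: E i.
have Cu i : d i < x -> C i (u z) = 0 by move=> dx; have [_ _ H] := dP i; apply: H; exact: fu.
have Cv i : d i < y -> C i (v z) = 0 by move=> dx; have [_ _ H] := dP i; apply: H; exact: fv.
have fus : filt x us.
  by rewrite -(subrK (u z) us); apply: filtD => //; apply: filtBC; apply: filt_le (Cs _); exact: ltW.
have fvs : filt y vs.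
  by rewrite -(subrK (v z) vs); apply: filtD => //; apply: filtBC; apply: filt_le (Cs _); exact: ltW.
have cus : comp x us = X.
  by apply/eqP; rewrite eq_sym -{1}eu -subr_eq0 -compB Cs.
have cvs : comp y vs = Y.
  by apply/eqP; rewrite eq_sym -{1}ev -subr_eq0 -compB Cs.
have err i j : exists2 rho, filt (d i + d j + 1) rho & br0 i j = zeta0 (br (E i) (E j) + rho).
  have [di hi _] := dP i; have [dj hj _] := dP j.
  have sec k : homog (d k) (E k) -> sections (tF T) (d k) (z 0%N) (fun y => Z y (E k)).
    move=> hk; split; first exact: sE.
    have [U [oU Uz Zi _]] := ffZ.
    apply: filterS (open_nbhs_nbhs (conj oU Uz)) => y' Uy'.
    have [_ _ _ Fy] := Zi _ Uy'; rewrite -[tF T (d k) y']/(TF (n := 0) (d k) y') -Fy.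
    by exists (E k) => //; exact: homog_filt hk _.
  have := grm _ _ _ _ _ _ di dj hi hj (sec i hi) (sec j hj).
  rewrite Zz => /(_ erefl erefl); rewrite -/(br0 i j).
  rewrite -[tF T _ _]/(TF (n := 0) (d i + d j + 1) (z 0%N)) -F0 => -[rho fr E1].
  by exists rho => //; rewrite (linD l0) E1 addrC subrK.
have [rho rhoP] := choice (fun ij : I * I => let: ex_intro2 r a b := err ij.1 ij.2 in
  ex_intro (fun r => filt (d ij.1 + d ij.2 + 1) r /\ br0 ij.1 ij.2 =
    zeta0 (br (E ij.1) (E ij.2) + r)) r (conj a b)).
pose rest := \sum_i \sum_j (C i (u z) * C j (v z)) *: rho (i, j).
(* Leibniz rule for the bracket of sum C_i(u) Z(E_i) and sum C_j(v) Z(E_j) at z: derivatives of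
   coordinates, the algebraic bracket, and the errors of higher degree allowed by gr Z. *)
pose b := dv - du + br us vs + rest.
have zb : zeta0 b = tilde (gam z X Y) z 0.
  apply: (@tangent_smooth_ext _ _ (z 0%N)); first exact: filtered_iso_tangent.
    exact: (tg 0%N).1.
  move=> f sf; rewrite -(DO_lrep gt _ (lrep_level sf)) -(BR_gam tr gt sfun); last first.
    exact: lsmooth_level.
  rewrite /bracket_op (second_derivative tr gt ffZ vY sv fam) //.
  rewrite (second_derivative tr gt ffZ uX su fam) // Zz.
  have tE (A : g) a (uA : lnear z [set w : limQ T | Z (w 0%N) (a w) = tilde A w 0]) h :
      tilde A z 0 h = \sum_i C i (a z) * zeta0 (E i) h.
    have := lnear_pt uA; rewrite /= Zz => <-.
    have : zeta0 (a z - \sum_i C i (a z) *: E i) = 0 by apply/k0.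
    rewrite (linB l0) => /eqP; rewrite subr_eq0 => /eqP ->.
    by rewrite (lin_sum l0) tvec_sum; apply: eq_bigr => i _; rewrite (linZ l0).
  have -> : zeta0 b = zeta0 dv - zeta0 du + \sum_i \sum_j (C i (u z) * C j (v z)) *: br0 i j.
    rewrite /b (linD l0) (linD l0) (linB l0) -addrA; congr (_ + _).
    have -> : br us vs = \sum_i \sum_j (C i (u z) * C j (v z)) *: br (E i) (E j).
      rewrite /us brC br_sumr -sumrN; apply: eq_bigr => i _.
      rewrite brZr -scalerN -brC /vs br_sumr scaler_sumr; apply: eq_bigr => j _.
      by rewrite brZr scalerA.
    rewrite -(linD l0) /rest -big_split /= (lin_sum l0); apply: eq_bigr => i _.
    rewrite -big_split /= (lin_sum l0); apply: eq_bigr => j _.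
    have [_ /= ->] := rhoP (i, j).
    by rewrite -scalerDr (linZ l0).
  have -> : (zeta0 dv - zeta0 du + \sum_i \sum_j (C i (u z) * C j (v z)) *: br0 i j) f =
     zeta0 dv f - zeta0 du f + \sum_i \sum_j (C i (u z) * C j (v z)) * br0 i j f.
    rewrite -[LHS]/((zeta0 dv f - zeta0 du f) + (\sum_i _) f); congr (_ + _).
    rewrite tvec_sum; apply: eq_bigr => i _; rewrite tvec_sum; exact: eq_bigr.
  have bE i j : br0 i j f = zeta0 (E i) (fun y => Z y (E j) f) - zeta0 (E j) (fun y => Z y (E i) f).
    by rewrite /br0 /vbracket asboolT // Zz.
  rewrite -/dv -/du opprD addrACA; congr (_ + _).
  under eq_bigr do under eq_bigr do rewrite bE mulrBr.
  under eq_bigr do rewrite sumrB.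
  rewrite sumrB; congr (_ - _).
    rewrite exchange_big /=; apply: eq_bigr => j _.
    rewrite (tE X u uX) mulr_sumr; apply: eq_bigr => i _; ring.
  apply: eq_bigr => i _.
  rewrite (tE Y v vY) mulr_sumr; apply: eq_bigr => j _; ring.
have frest : filt (x + y + 1) rest.
  apply: filt_sum => i _; apply: filt_sum => j _.
  have [dx|dx] := ltP (d i) x; first by rewrite Cu // mul0r scale0r; exact: filt0.
  have [dy|dy] := ltP (d j) y; first by rewrite Cv // mulr0 scale0r; exact: filt0.
  by apply: filtZ; have [fr _] := rhoP (i, j); apply: filt_le fr => /=; lia.
(* The derivatives only lie in F^y and F^x, but x, y <= -1 puts both inside F^(x+y+1). *)
have fdd : filt (x + y + 1) (dv - du).
  apply: filtB.
    by apply: filt_le (d_filt y Y X v vY sv hY y0); lia.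
  by apply: filt_le (d_filt x X Y u uX su hX x0); lia.
have fb : filt (x + y) b.
  apply: filtD; last by apply: filt_le frest; lia.
  by apply: filtD; [apply: filt_le fdd; lia|exact: filt_br].
have cb : comp (x + y) b = br X Y.
  by rewrite /b 2!compD fdd ?frest ?addr0 ?add0r ?comp_br ?cus ?cvs //; lia.
have := theta_comp_inv gt tg hg c0 zb fb.
move=> /(_ (x + y + 1)) H; have {}H : filt (x + y + 1) (b - gam z X Y) by apply: H; lia.
split.
  have -> : gam z X Y = b - (b - gam z X Y) by rewrite subKr.
  by apply: filtB => //; apply: filt_le H; lia.
rewrite -cb; apply/eqP; rewrite eq_sym -subr_eq0 -compB H //; lia.
Qed.

End NegativePart.

(** * Homogeneous components *)

Section HomogeneousParts.
Variables (R : realType) (g : gradedLie R).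
Implicit Types (b : g -> g -> g) (f h : g -> g) (U V W : g).
Local Notation dp := (depth g)%:Z.

Lemma bilinear_comp b f h : bilinear_map b -> linear f -> linear h ->
  bilinear_map (fun u v => b (f u) (h v)).
Proof.
move=> [bl br] lf lh; split.
  by move=> u a v w; rewrite lh bl.
by move=> v a u w; rewrite lf br.
Qed.

Lemma bilinear_add b b' : bilinear_map b -> bilinear_map b' ->
  bilinear_map (fun u v => b u v + b' u v).
Proof.
move=> [bl br] [bl' br']; split.
  by move=> u a v w; rewrite bl bl' scalerDr addrACA.
by move=> v a u w; rewrite br br' scalerDr addrACA.
Qed.

(** Turns [kappa], [tau] and [sigma] on homogeneous arguments into components of [gam], the form in
    which the Bianchi identity is split. *)
Lemma hpartE (d u v : int) b U V : bilinear_map b -> homog u U -> homog v V ->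
  hpart d b U V = comp (u + v + d) (b U V).
Proof.
move=> [bl br] hU hV; apply: comp_sep => m; rewrite /hpart comp_assemble comp_comp.
have b0 W : b 0 W = 0 by exact: (lin0 (br W)).
have b0' W : b W 0 = 0 by exact: (lin0 (bl W)).
rewrite comp_sum (irange_sum1 (j := u)).
- rewrite comp_id hU (comp_homog _ hV).
  have -> : (m - d - u == v) = (m == u + v + d) by lia.
  by case: ifP; rewrite ?b0' ?comp0.
- by move=> i _ iu; rewrite (comp_homog _ hU) (negPf iu) b0 !comp0.
- move=> H; have [ud|ud] := ltP u (- dp).
    by rewrite (homog_depth hU ud) !comp0 b0 !comp0.
  by rewrite (comp_depth (p := m - d - u)) ?b0' ?comp0 //; lia.
Qed.

(** The alternative F a = 0 covers the empty range, where splitting off a first term would otherwise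
    add F a. *)
Lemma irange_recl (G : nmodType) (F : int -> G) (a b : int) : a <= b \/ F a = 0 ->
  \sum_(i <- irange a b) F i = F a + \sum_(i <- irange (a + 1) b) F i.
Proof.
move=> H; have [ab|ab] := leP a b.
  rewrite -[RHS](big_cons _ _ _ _ (fun=> true)); apply: irange_sum_sub.
  - by rewrite /= irange_uniq mem_irange andbT; lia.
  - by move=> i; rewrite inE !mem_irange; lia.
  - by move=> i; rewrite inE !mem_irange; lia.
have nil c e : e < c -> irange c e = [::] by rewrite /irange => ec; rewrite ifF //; lia.
rewrite !nil ?big_nil; [|lia..].
by case: H => [|->]; [lia|rewrite addr0].
Qed.

Lemma irange_recr (G : nmodType) (F : int -> G) (a b : int) : a <= b ->
  \sum_(i <- irange a b) F i = \sum_(i <- irange a (b - 1)) F i + F b.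
Proof.
move=> ab; rewrite addrC -[RHS](big_cons _ _ _ _ (fun=> true)); apply: irange_sum_sub.
- by rewrite /= irange_uniq mem_irange andbT; lia.
- by move=> i; rewrite inE !mem_irange; lia.
- by move=> i; rewrite inE !mem_irange; lia.
Qed.

End HomogeneousParts.

(** * Components of gamma and of the Bianchi identity *)

Section Components.
Variables (R : realType) (g : gradedLie R) (T : towerData g).
Hypothesis tr : transitive_gl g.
Hypothesis gt : geometric_tower T.
Hypothesis abb : forall n, acts_by_bracket T n.
Variable gam : limQ T -> g -> g -> g.
Hypothesis sfun : structure_function gam.
Implicit Types (z : limQ T) (U V W A B X Y : g) (u v w a b x y m d e : int).
Local Notation dp := (depth g)%:Z.

(* Reduces additive identities in g to linear arithmetic over R. *)
Lemma additive_ext U V :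
  (forall lam : g -> R, {morph lam : s t / s + t} -> {morph lam : s / - s} -> lam U = lam V) ->
  U = V.
Proof.
move=> H; apply/eqP; rewrite -subr_eq0; apply/eqP/(functional_sep tr) => p lam ll.
have E := H (fun s => lam (comp p s)).
rewrite compB (linB ll) E ?subrr //.
  by move=> u v; rewrite compD (linD ll).
by move=> u; rewrite compN (linN ll).
Qed.

Lemma gam_linl z V : linear (gam z ^~ V).
Proof. exact: (gam_bilin sfun z).2. Qed.
Lemma gamC z U V : gam z U V = - gam z V U.
Proof. exact: altC (gam_bilin sfun z) (gam_alt sfun z) U V. Qed.
Lemma gam0l z V : gam z 0 V = 0. Proof. exact: (lin0 (gam_linl z V)). Qed.
Lemma gamNl z U V : gam z (- U) V = - gam z U V.
Proof. exact: (linN (gam_linl z V)). Qed.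

Section Values.
Variables (z : limQ T) (u v : int) (U V : g).
Hypotheses (hU : homog u U) (hV : homog v V).

Lemma kappaE d m : u < 0 -> v < 0 -> u + v + d = m ->
  kappa gam d z U V = comp m (gam z U V).
Proof.
move=> u0 v0 <-; rewrite /kappa (hpartE _ _ hU hV).
  by rewrite (neg_homog hU) (neg_homog hV) u0 v0.
apply: bilinear_comp; [exact: gam_bilin|exact: neg_linear..].
Qed.

Lemma tau_bilinear : bilinear_map
  (fun s t => gam z (pos s) (neg t) + gam z (neg s) (pos t)).
Proof.
apply: bilinear_add; apply: bilinear_comp; first [exact: gam_bilin|
  exact: neg_linear|exact: pos_linear].
Qed.

Lemma tauE d m : 0 <= u -> v < 0 -> u + v + d = m ->
  tau gam d z U V = comp m (gam z U V).
Proof.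
move=> u0 v0 <-; rewrite /tau (hpartE _ tau_bilinear hU hV).
rewrite (pos_homog hU) (neg_homog hV) (neg_homog hU) (pos_homog hV) u0 v0.
by rewrite ltNge u0 /= gam0l addr0.
Qed.

Lemma tauCE d m : u < 0 -> 0 <= v -> u + v + d = m ->
  tau gam d z U V = comp m (gam z U V).
Proof.
move=> u0 v0 <-; rewrite /tau (hpartE _ tau_bilinear hU hV).
rewrite (pos_homog hU) (neg_homog hV) (neg_homog hU) (pos_homog hV) u0 v0.
by rewrite leNgt u0 /= gam0l add0r.
Qed.

Lemma sigmaE d m : 0 <= u -> 0 <= v -> u + v + d = m ->
  sigma gam d z U V = comp m (gam z U V).
Proof.
move=> u0 v0 <-; rewrite /sigma (hpartE _ _ hU hV).
  by rewrite (pos_homog hU) (pos_homog hV) u0 v0.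
apply: bilinear_comp; [exact: gam_bilin|exact: pos_linear..].
Qed.

Lemma hpart0l d (b : g -> g -> g) : bilinear_map b -> hpart d b 0 V = 0.
Proof.
move=> bb; rewrite (hpartE (u := 0) _ bb (homog0 _ 0) hV).
by rewrite (lin0 (bb.2 V)) comp0.
Qed.

Lemma hpart0r d (b : g -> g -> g) : bilinear_map b -> hpart d b U 0 = 0.
Proof.
move=> bb; rewrite (hpartE (v := 0) _ bb hU (homog0 _ 0)).
by rewrite (lin0 (bb.1 U)) comp0.
Qed.

(** For homogeneous U one of [neg U], [pos U] is U and the other is 0. Thus each pair of terms under
    a sum of the theorem is a single component of gamma; the next two lemmas do the same for the
    other pairs. *)
Lemma kappa_tauE d m : v < 0 -> u + v + d = m ->
  kappa gam d z (neg U) V + tau gam d z (pos U) V = comp m (gam z U V).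
Proof.
move=> v0 E; rewrite (neg_homog hU) (pos_homog hU).
have [u0|u0] := ltP u 0; rewrite ?ltNge ?u0 /=.
  rewrite (kappaE u0 v0 E) /tau hpart0l ?addr0 //; exact: tau_bilinear.
rewrite (tauE u0 v0 E) /kappa hpart0l ?add0r //.
by apply: bilinear_comp; [exact: gam_bilin|exact: neg_linear..].
Qed.

Lemma tau_sigmaE d m : 0 <= v -> u + v + d = m ->
  tau gam d z (neg U) V + sigma gam d z (pos U) V = comp m (gam z U V).
Proof.
move=> v0 E; rewrite (neg_homog hU) (pos_homog hU).
have [u0|u0] := ltP u 0.
  rewrite (tauCE u0 v0 E) /sigma hpart0l ?addr0 //.
  by apply: bilinear_comp; [exact: gam_bilin|exact: pos_linear..].
rewrite (sigmaE u0 v0 E) /tau hpart0l ?add0r //; exact: tau_bilinear.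
Qed.

Lemma sigma_tauE d m : 0 <= u -> u + v + d = m ->
  sigma gam d z U (pos V) + tau gam d z U (neg V) = comp m (gam z U V).
Proof.
move=> u0 E; rewrite (neg_homog hV) (pos_homog hV).
have [v0|v0] := ltP v 0.
  rewrite (tauE u0 v0 E) /sigma hpart0r ?add0r //.
  by apply: bilinear_comp; [exact: gam_bilin|exact: pos_linear..].
rewrite (sigmaE u0 v0 E) /tau hpart0r ?addr0 //; exact: tau_bilinear.
Qed.

Lemma gam_lead : u < 0 \/ v < 0 ->
  (forall m, m < u + v -> comp m (gam z U V) = 0) /\ comp (u + v) (gam z U V) = br U V.
Proof.
have vert u1 v1 (U1 V1 : g) m : homog u1 U1 -> homog v1 V1 -> 0 <= u1 -> v1 < 0 ->
    m <= u1 + v1 -> comp m (gam z U1 V1) = comp m (br U1 V1).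
  move=> h1 h2 u0 v0 mle.
  have E : u1 = (absz u1)%:Z by lia.
  have f1 : filt (absz u1)%:Z U1 by apply: homog_filt h1 _; lia.
  rewrite (gam_vertical tr gt sfun abb z f1 (homog_filt h2 (lexx _))); [|lia|lia].
  by rewrite -E h1 (neg_homog h2) v0.
have low u1 v1 (U1 V1 : g) m : homog u1 U1 -> homog v1 V1 -> m < u1 + v1 ->
    comp m (br U1 V1) = 0.
  by move=> h1 h2 mlt; rewrite (comp_homog _ (homog_br h1 h2)) ifF //; lia.
have [u0|u0] := ltP u 0; have [v0|v0] := ltP v 0 => H.
- have [f1 ->] := gam_negative tr gt sfun z u0 v0 hU hV.
  by split => // m; exact: f1.
- split.
    move=> m mlt; rewrite gamC compN (vert v u V U m) ?(low v u V U m) ?oppr0 //; lia.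
  rewrite gamC compN (vert v u V U) //; last by lia.
  by rewrite [u + v]addrC (homog_br hV hU) -brC.
- split.
    by move=> m mlt; rewrite (vert u v U V m) ?(low u v U V m) //; lia.
  by rewrite (vert u v U V) // (homog_br hU hV).
- by exfalso; lia.
Qed.

(** With V in F^0 the bracket in [gam_vertical] has the argument neg V = 0, so all components below
    u vanish; skew-symmetry gives the same for v. *)
Lemma gam_pos m : 0 <= u -> 0 <= v -> m < Num.max u v -> comp m (gam z U V) = 0.
Proof.
have vert u1 v1 (U1 V1 : g) : homog u1 U1 -> homog v1 V1 -> 0 <= u1 -> 0 <= v1 ->
    m < u1 -> comp m (gam z U1 V1) = 0.
  move=> h1 h2 u0 v0 mlt.
  have f1 : filt (absz u1)%:Z U1 by apply: homog_filt h1 _; lia.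
  have f2 : filt 0 V1 by exact: homog_filt h2 _.
  rewrite (gam_vertical tr gt sfun abb z f1 f2); [|lia|lia].
  by rewrite (neg_filt0 f2) br0r comp0.
move=> u0 v0; have [uv|uv] := leP u v => mlt.
  by rewrite gamC compN (vert v u V U) ?oppr0.
by rewrite (vert u v U V).
Qed.

Lemma gam_low m : (u < 0 \/ v < 0 -> m < u + v) ->
  (0 <= u -> 0 <= v -> m < Num.max u v) -> comp m (gam z U V) = 0.
Proof.
move=> H1 H2; have [u0|u0] := ltP u 0; first by apply: (gam_lead _).1; [left|apply: H1; left].
have [v0|v0] := ltP v 0; first by apply: (gam_lead _).1; [right|apply: H1; right].
by apply: gam_pos => //; exact: H2.
Qed.

End Values.

(** [gam z] is merely linear on the completion, so an expansion over all components of its argument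
    needs continuity. For W in F^N the component of degree m is that of [W_N, neg V], which lives in
    degrees at least N - |v| > m. *)
Lemma gam_continuous z v V m : homog v V -> exists N : nat, forall W,
  filt N%:Z W -> comp m (gam z W V) = 0.
Proof.
move=> hV; pose N := (absz m + absz v).+1; exists N => W fW.
have fV : filt (Num.min v 0) V by apply: homog_filt hV _; lia.
rewrite (gam_vertical tr gt sfun abb z fW fV); [|by rewrite /N; lia..].
have f1 : filt N%:Z (comp N%:Z W) by exact: homog_filt (homog_comp _ _) _.
by apply: (filt_br f1 (filt_neg fV)); rewrite /N; lia.
Qed.

Lemma gam_gam_sum z w W m V (r : seq int) : homog w W -> uniq r ->
  (forall e, e \notin r -> comp m (gam z (comp e V) W) = 0) ->
  comp m (gam z V W) = \sum_(e <- r) comp m (gam z (comp e V) W).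
Proof.
move=> hW ur r0; have [N HN] := gam_continuous z m hW.
have -> : comp m (gam z V W) = comp m (gam z (trunc N%:Z V) W).
  apply/eqP; rewrite -subr_eq0 -compB -(linB (gam_linl z W)) HN //.
  exact: trunc_filt.
rewrite /trunc (lin_sum (gam_linl z W)) comp_sum; apply: irange_sum_sub => //.
  by move=> e _; exact: r0.
move=> e _; rewrite mem_irange => H.
have [ed|ed] := ltP e (- dp); first by rewrite (comp_depth (p := e)) // gam0l comp0.
by rewrite HN //; apply: homog_filt (homog_comp e V) _; lia.
Qed.

(** The map s turns the summation index of the theorem, a degree of homogeneity, into the degree of
    a component of V. *)
Lemma gam_gam_irange z w W m V (s : int -> int) a b : homog w W -> injective s ->
  (forall e, (forall k, a <= k <= b -> e != s k) -> comp m (gam z (comp e V) W) = 0) ->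
  comp m (gam z V W) = \sum_(k <- irange a b) comp m (gam z (comp (s k) V) W).
Proof.
move=> hW si H; rewrite (@gam_gam_sum z w W m V (map s (irange a b))) ?big_map //.
  by rewrite map_inj_uniq // irange_uniq.
move=> e /mapP ne; apply: H => k ak; apply/eqP => E.
by apply: ne; exists k; rewrite ?mem_irange.
Qed.

Lemma dgamC z W U V : dgam gam W U V z = - dgam gam W V U z.
Proof.
apply: (drv_uniq tr gt (tilde_tangent gt W z) (dgamP tr gt sfun W U V z)) => p lam ll.
have [n [h [H E]]] := dgamP tr gt sfun W V U z p ll.
(* Negation is put in the shape that [lrep_add] handles. *)
exists n, (fun t => (-1) * h t + 0); split.
  have := lrep_add (-1) H (lrep_cst z n 0).
  have -> // : (fun z' : limQ T => -1 * lam (comp p (gam z' V U)) + 0) =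
      (fun z' => lam (comp p (gam z' U V))).
  by apply/funext => w; rewrite (gamC w U) compN (linN ll) addr0 mulN1r.
rewrite compN (linN ll) E.
have [[_ ta _ _] _] := tilde_tangent gt W z n.
rewrite ta; [|exact: H.1|exact: smooth_cst].
have -> : tilde W z n (fun=> 0) = 0.
  by rewrite -(lderivE gt (tilde_tangent gt W z) (lrep_cst z n 0)) (lderiv_cst gt _ (tilde_tangent gt W z)).
by rewrite addr0 mulN1r.
Qed.

Lemma dgam_comp z W U V m (f : limQ T -> g) : (forall z', f z' = comp m (gam z' U V)) ->
  Dv W f z = comp m (dgam gam W U V z).
Proof.
move=> E; have -> : f = (fun z' => comp m (gam z' U V)) by apply/funext => w; exact: E.
exact: (Dv_comp tr gt _ (dgamP tr gt sfun W U V z)).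
Qed.

Lemma bianchi_comp z U V W m :
  (comp m (gam z (gam z U V) W) - comp m (dgam gam W U V z))
  + (comp m (gam z (gam z V W) U) - comp m (dgam gam U V W z))
  + (comp m (gam z (gam z W U) V) - comp m (dgam gam V W U z)) = 0.
Proof. by rewrite -!compB -!compD (bianchi tr gt sfun) comp0. Qed.

End Components.

(** * The four identities *)

Section StructureEquations.
Variables (R : realType) (g : gradedLie R) (T : towerData g).
Hypothesis tr : transitive_gl g.
Hypothesis gt : geometric_tower T.
Hypothesis abb : forall n, acts_by_bracket T n.
Variable gam : limQ T -> g -> g -> g.
Hypothesis sfun : structure_function gam.
Variable q : limQ T.
Implicit Types (X Y Z A B C : g) (x y z a b c d k : int).
Local Notation K d := (kappa gam d q).
Local Notation Ta d := (tau gam d q).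
Local Notation S d := (sigma gam d q).
Local Notation G := (gam q).
Local Notation DG W U V := (dgam gam W U V q).

Definition kk_sum k X Y Z := \sum_(d2 <- irange 1 (k - 1)) (let d1 := k - d2 in
  K d1 (neg (K d2 X Y)) Z + Ta d1 (pos (K d2 X Y)) Z).

Ltac additive :=
  apply: (additive_ext tr) => lam lD lN;
  have l0 : lam 0 = 0 by (have := lD 0 0; rewrite addr0; lra).

Lemma kk_sum0 X Y Z : kk_sum 0 X Y Z = 0.
Proof. by rewrite /kk_sum /irange big_nil. Qed.

(** Both ends of the range are degree bounds: the inner gamma has no part of negative degree, and
    neither has the outer one since z < 0, so d2 >= 0 and k - d2 >= 0. *)
Lemma gam_gam_irange0 k m x y z X Y Z : x < 0 \/ y < 0 -> z < 0 ->
  homog x X -> homog y Y -> homog z Z -> x + y + z + k = m ->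
  comp m (G (G X Y) Z) =
  \sum_(d2 <- irange 0 k) comp m (G (comp (x + y + d2) (G X Y)) Z).
Proof.
move=> xy0 z0 hX hY hZ E.
have [low _] := gam_lead tr gt abb sfun q hX hY xy0.
apply: (gam_gam_irange tr gt abb sfun hZ); first by move=> i j /addrI.
move=> e He; have [elow|elow] := ltP e (x + y).
  by rewrite low // (gam0l sfun) comp0.
have ek : x + y + k < e.
  rewrite ltNge; apply/negP => ek; move: (He (e - (x + y))) => /=; lia.
have [low2 _] := gam_lead tr gt abb sfun q (homog_comp e (G X Y)) hZ (or_intror z0).
by apply: low2; lia.
Qed.

Lemma gam_gam_neg0 m x y z X Y Z : x < 0 \/ y < 0 -> z < 0 ->
  homog x X -> homog y Y -> homog z Z -> x + y + z = m ->
  comp m (G (G X Y) Z) = br (br X Y) Z.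
Proof.
move=> xy0 z0 hX hY hZ E.
have [_ lead] := gam_lead tr gt abb sfun q hX hY xy0.
rewrite (gam_gam_irange0 (k := 0) xy0 z0 hX hY hZ) ?addr0 // /irange /= big_seq1 addr0 lead.
have [_ <-] := gam_lead tr gt abb sfun q (homog_br hX hY) hZ (or_intror z0).
by rewrite E.
Qed.

(** At d2 = 0 the inner gamma is the bracket and at d2 = k the outer one is; these two ends are the
    terms of the coboundary of kappa_k. The hypothesis 0 < k keeps them apart. *)
Lemma gam_gam_neg k m x y z X Y Z : x < 0 -> y < 0 -> z < 0 ->
  homog x X -> homog y Y -> homog z Z -> 0 < k -> x + y + z + k = m ->
  comp m (G (G X Y) Z) = K k (br X Y) Z + kk_sum k X Y Z + br (K k X Y) Z.
Proof.
move=> x0 y0 z0 hX hY hZ k0 E.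
have [low lead] := gam_lead tr gt abb sfun q hX hY (or_introl x0).
rewrite (gam_gam_irange0 (or_introl x0) z0 hX hY hZ E).
rewrite irange_recl; last by left; lia.
rewrite irange_recr ?add0r; last by lia.
rewrite addr0 lead addrA; congr (_ + _ + _).
- by rewrite (kappaE sfun q (homog_br hX hY) hZ (m := m)) //; lia.
- rewrite /kk_sum !big_seq; apply: eq_bigr => d2; rewrite mem_irange => H /=.
  rewrite (kappaE sfun q hX hY (m := x + y + d2)) //.
  by rewrite (kappa_tauE sfun q (homog_comp _ _) hZ (m := m)) //; lia.
- rewrite (kappaE sfun q hX hY (m := x + y + k)) //.
  have [_ <-] := gam_lead tr gt abb sfun q (homog_comp (x + y + k) (G X Y)) hZ (or_intror z0).
  by congr comp; lia.
Qed.

Lemma kappaC d x y X Y : x < 0 -> y < 0 -> homog x X -> homog y Y ->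
  K d X Y = - K d Y X.
Proof.
move=> x0 y0 hX hY; rewrite (kappaE sfun q hX hY (m := x + y + d)) //.
by rewrite (kappaE sfun q hY hX (m := x + y + d)) // ?(gamC sfun q X Y) ?compN //; lia.
Qed.

Lemma kappaNl d x y X Y : x < 0 -> y < 0 -> homog x X -> homog y Y ->
  K d (- X) Y = - K d X Y.
Proof.
move=> x0 y0 hX hY; have hNX : homog x (- X) by rewrite /homog /= compN hX.
rewrite (kappaE sfun q hNX hY (m := x + y + d)) //.
by rewrite (kappaE sfun q hX hY (m := x + y + d)) // (gamNl sfun) compN.
Qed.

Lemma kappa0 x y X Y : x < 0 -> y < 0 -> homog x X -> homog y Y -> K 0 X Y = br X Y.
Proof.
move=> x0 y0 hX hY; rewrite (kappaE sfun q hX hY (m := x + y)) ?addr0 //.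
by have [_] := gam_lead tr gt abb sfun q hX hY (or_introl x0).
Qed.

Lemma structure_equation1 x y z X Y Z k :
  x < 0 -> y < 0 -> z < 0 -> homog x X -> homog y Y -> homog z Z -> 0 <= k ->
  cobd2 (K k) X Y Z =
  cycsum (fun x X y Y z Z => kk_sum k X Y Z
    - Dv X (fun w => kappa gam (k + x) w Y Z) q) x X y Y z Z.
Proof.
move=> x0 y0 z0 hX hY hZ k0.
pose m := x + y + z + k.
have EXY : comp m (DG Z X Y) = Dv Z (fun w => kappa gam (k + z) w X Y) q.
  apply/esym/(dgam_comp tr gt sfun) => w; apply: (kappaE sfun w hX hY) => //; rewrite /m; lia.
have EYZ : comp m (DG X Y Z) = Dv X (fun w => kappa gam (k + x) w Y Z) q.
  apply/esym/(dgam_comp tr gt sfun) => w; apply: (kappaE sfun w hY hZ) => //; rewrite /m; lia.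
have EZX : comp m (DG Y Z X) = Dv Y (fun w => kappa gam (k + y) w Z X) q.
  apply/esym/(dgam_comp tr gt sfun) => w; apply: (kappaE sfun w hZ hX) => //; rewrite /m; lia.
have := bianchi_comp tr gt sfun q X Y Z m; rewrite EXY EYZ EZX /cycsum.
rewrite /cobd2 (neg_homog hX) (neg_homog hY) (neg_homog hZ) x0 y0 z0.
have yx : y + x < 0 by lia.
have hXZ := homog_br hX hZ.
rewrite (kappaC k x0 z0 hX hZ) (brC X Z) brNr.
rewrite (kappaNl k _ y0 (homog_br hZ hX) hY); last by lia.
have [k1|k1] := ltP 0 k.
  rewrite (@gam_gam_neg k m x y z) // (@gam_gam_neg k m y z x) //; try by rewrite /m; lia.
  rewrite (@gam_gam_neg k m z x y) //; try by rewrite /m; lia.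
  rewrite (brC X (K k Y Z)) (brC Y (K k Z X)) (brC Z (K k X Y)) => H.
  additive; have := congr1 lam H; rewrite !lD !lN ?lD ?l0; lra.
(* In degree 0 the two ends are one and the same term. As kappa_0 is the bracket, the Jacobi
   identity kills the coboundary and the iterated brackets, so the derivatives cancel among
   themselves. *)
have {k1 k0} E0 : k = 0 by lia.
subst k; rewrite !kk_sum0.
rewrite (@gam_gam_neg0 m x y z) //; try by [left|rewrite /m; lia].
rewrite (@gam_gam_neg0 m y z x) //; try by [left|rewrite /m; lia].
rewrite (@gam_gam_neg0 m z x y) //; try by [left|rewrite /m; lia].
rewrite (kappa0 y0 z0 hY hZ) (kappa0 z0 x0 hZ hX) (kappa0 x0 y0 hX hY).
rewrite (kappa0 _ z0 (homog_br hX hY) hZ); last by lia.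
rewrite (kappa0 _ y0 (homog_br hZ hX) hY); last by lia.
rewrite (kappa0 _ x0 (homog_br hY hZ) hX); last by lia.
have := br_jacobi X Y Z.
rewrite (brC X (br Y Z)) (brC Y (br Z X)) (brC Z (br X Y)) => J H.
additive; have := congr1 lam H; have := congr1 lam J; rewrite !lD !lN ?lD ?l0; lra.
Qed.

Lemma kappa_bilinear : bilinear_map (fun s t => G (neg s) (neg t)).
Proof. by apply: bilinear_comp; [exact: gam_bilin|exact: neg_linear..]. Qed.

Lemma kappa_negC d x e X W : x < 0 -> homog x X -> homog e W ->
  K d X (neg W) = - K d (neg W) X.
Proof.
move=> x0 hX hW; rewrite (neg_homog hW); case: ifP => e0; first exact: kappaC hX hW.
by rewrite /kappa (hpart0r hX) ?(hpart0l hX) ?oppr0 //; exact: kappa_bilinear.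
Qed.

Lemma tau0_neg a e A W : 0 <= a -> homog a A -> homog e W -> Ta 0 (neg W) A = br (neg W) A.
Proof.
move=> a0 hA hW; rewrite (neg_homog hW); case: ifP => e0.
  rewrite (tauCE sfun q hW hA (m := e + a)) ?addr0 //.
  by have [_] := gam_lead tr gt abb sfun q hW hA (or_introl e0).
by rewrite /tau (hpart0l hA) ?br0l //; exact: tau_bilinear.
Qed.

(** For A in g_a and an argument of degree e, gamma has components only in degrees >= e + a if e <
    0, and >= max(e, a) otherwise. Hence e <= m, which is d2 <= d + a. *)
Lemma gam_gam_irange1 d m u v a U V A : u < 0 \/ v < 0 -> 0 <= a ->
  homog u U -> homog v V -> homog a A -> u + v + a + d = m ->
  comp m (G (G U V) A) =
  \sum_(d2 <- irange 0 (d + a)) comp m (G (comp (u + v + d2) (G U V)) A).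
Proof.
move=> uv0 a0 hU hV hA E.
have [low _] := gam_lead tr gt abb sfun q hU hV uv0.
apply: (gam_gam_irange tr gt abb sfun hA); first by move=> i j /addrI.
move=> e He; have [elow|elow] := ltP e (u + v).
  by rewrite low // (gam0l sfun) comp0.
have me : m < e.
  rewrite ltNge; apply/negP => em; move: (He (e - (u + v))) => /=; lia.
by apply: (gam_low tr gt abb sfun q (homog_comp e (G U V)) hA); lia.
Qed.

Definition ks_sum d a X Y A := \sum_(e2 <- irange 1 (d + a) |
    let e1 := d - e2 in [&& - a <= e1, e1 < d & e1 != 0])
  (let e1 := d - e2 in Ta e1 (neg (K e2 X Y)) A + S e1 (pos (K e2 X Y)) A).

Definition tk_sum d A X Y := \sum_(d2 <- irange 1 (d - 1)) (let d1 := d - d2 in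
  K d1 (neg (Ta d2 A X)) Y + Ta d1 (pos (Ta d2 A X)) Y).

(** The term d2 = 0 is tau_d([X, Y], A). The term d2 = d, left out of [ks_sum], consists of tau_0,
    which is a bracket, and sigma_0; when d = 0 it coincides with the first term, hence the
    conditional. *)
Lemma gam_gam_kappa_pos d m x y a X Y A : x < 0 -> y < 0 -> 0 <= a -> 0 <= d ->
  homog x X -> homog y Y -> homog a A -> x + y + a + d = m ->
  comp m (G (G X Y) A) = - Ta d A (br X Y) +
    (if 0 < d then br (neg (K d X Y)) A + S 0 (pos (K d X Y)) A else 0) + ks_sum d a X Y A.
Proof.
move=> x0 y0 a0 d0 hX hY hA E.
have [low lead] := gam_lead tr gt abb sfun q hX hY (or_introl x0).
rewrite (gam_gam_irange1 (or_introl x0) a0 hX hY hA E) irange_recl; last by left; lia.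
rewrite addr0 lead -addrA; congr (_ + _).
  rewrite (tauE sfun q hA (homog_br hX hY) (m := m)) //; try lia.
  by rewrite (gamC sfun) compN.
pose F e2 := Ta (d - e2) (neg (K e2 X Y)) A + S (d - e2) (pos (K e2 X Y)) A.
transitivity (\sum_(e2 <- irange 1 (d + a)) F e2).
  rewrite add0r !big_seq; apply: eq_bigr => d2; rewrite mem_irange => H.
  rewrite /F (kappaE sfun q hX hY (m := x + y + d2)) //.
  by rewrite (tau_sigmaE sfun q (homog_comp _ _) hA (m := m)) //; lia.
have E1 : \sum_(e2 <- irange 1 (d + a) | e2 != d) F e2 = ks_sum d a X Y A.
  rewrite /ks_sum big_seq_cond [RHS]big_seq_cond; apply: eq_bigl => e2.
  by rewrite mem_irange /=; lia.
case: ifP => d1.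
  rewrite (bigD1_seq d) ?irange_uniq ?mem_irange /=; [|lia|by []].
  rewrite E1; congr (_ + _); rewrite /F subrr; congr (_ + _).
  by rewrite (kappaE sfun q hX hY (m := x + y + d)) // (tau0_neg a0 hA (homog_comp _ _)).
rewrite add0r -E1 big_seq [RHS]big_seq_cond; apply: eq_bigl => e2.
by rewrite mem_irange; lia.
Qed.

(** The end d2 = 0 gives the terms in [A, X], and the end d2 = d the bracket with Y, which belongs
    to the coboundary of tau_d(A, .). *)
Lemma gam_gam_tau_neg d m x y a X Y A : x < 0 -> y < 0 -> 0 <= a -> 0 < d ->
  homog x X -> homog y Y -> homog a A -> x + y + a + d = m ->
  comp m (G (G A X) Y) = K d (neg (br A X)) Y + Ta d (pos (br A X)) Y
    + tk_sum d A X Y + br (Ta d A X) Y.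
Proof.
move=> x0 y0 a0 d0 hX hY hA E.
have [low lead] := gam_lead tr gt abb sfun q hA hX (or_intror x0).
rewrite (@gam_gam_irange0 d m a x y A X Y (or_intror x0) y0 hA hX hY); last by lia.
rewrite irange_recl; last by left; lia.
rewrite irange_recr ?add0r; last by lia.
rewrite addr0 lead addrA; congr (_ + _ + _).
- by rewrite (kappa_tauE sfun q (homog_br hA hX) hY (m := m)) //; lia.
- rewrite /tk_sum !big_seq; apply: eq_bigr => d2; rewrite mem_irange => H /=.
  rewrite (tauE sfun q hA hX (m := a + x + d2)) //.
  by rewrite (kappa_tauE sfun q (homog_comp _ _) hY (m := m)) //; lia.
- rewrite (tauE sfun q hA hX (m := a + x + d)) //.
  have [_ <-] := gam_lead tr gt abb sfun q (homog_comp (a + x + d) (G A X)) hY (or_intror y0).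
  by congr comp; lia.
Qed.

Lemma tk_sum0 A X Y : tk_sum 0 A X Y = 0.
Proof. by rewrite /tk_sum /irange big_nil. Qed.

Lemma structure_equation2 x y a X Y A d :
  x < 0 -> y < 0 -> 0 <= a -> homog x X -> homog y Y -> homog a A -> 0 <= d ->
  cobd1 (Ta d A) X Y =
  (Dv A (fun w => kappa gam (d + a) w X Y) q + rho_kappa gam A d q X Y)
  - skewsum (fun x X y Y => Ta d (pos (br A X)) Y) x X y Y
  + br (pos (K d X Y)) A - S 0 (pos (K d X Y)) A
  - ks_sum d a X Y A
  - skewsum (fun x X y Y => tk_sum d A X Y) x X y Y
  + skewsum (fun x X y Y => Dv Y (fun w => tau gam (d + y) w A X) q) x X y Y.
Proof.
move=> x0 y0 a0 hX hY hA d0.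
pose m := x + y + a + d.
have EA : comp m (DG A X Y) = Dv A (fun w => kappa gam (d + a) w X Y) q.
  apply/esym/(dgam_comp tr gt sfun) => w; apply: (kappaE sfun w hX hY) => //; rewrite /m; lia.
have EY : comp m (DG Y A X) = Dv Y (fun w => tau gam (d + y) w A X) q.
  apply/esym/(dgam_comp tr gt sfun) => w; apply: (tauE sfun w hA hX) => //; rewrite /m; lia.
have EX : comp m (DG X A Y) = Dv X (fun w => tau gam (d + x) w A Y) q.
  apply/esym/(dgam_comp tr gt sfun) => w; apply: (tauE sfun w hA hY) => //; rewrite /m; lia.
have := bianchi_comp tr gt sfun q X Y A m.
rewrite (gamC sfun q Y A) (gamNl sfun) (dgamC tr gt sfun q X Y A) !compN EA EY EX.
rewrite /skewsum /cobd1 /rho_kappa (neg_homog hX) (neg_homog hY) x0 y0.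
rewrite (kappa_negC d x0 hX (homog_br hA hY)).
rewrite (@gam_gam_kappa_pos d m x y a) //.
have [d1|d1] := ltP 0 d.
  rewrite (@gam_gam_tau_neg d m x y a X Y A) //.
  rewrite (@gam_gam_tau_neg d m y x a Y X A) //; last by rewrite /m; lia.
  (* The bracket [A, kappa_d(X, Y)] of rho(A) kappa_d loses its positive half against
     [kappa_d(X, Y)_+, A]; the negative half matches the tau_0 term. *)
  rewrite (brC A (K d X Y)) -[in br (K d X Y) A](negD_pos (K d X Y)) brDl.
  rewrite (brC X (Ta d A Y)) (brC Y (Ta d A X)) => H.
  additive; have := congr1 lam H; rewrite !lD !lN ?lD ?lN ?l0; lra.
(* In degree 0 gamma with a negative argument is the bracket, so kappa_0 and tau_0 on the two halves
   of [A, X] recombine, and the Jacobi identity for A, X, Y concludes. *)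
have {d1 d0} E0 : d = 0 by lia.
subst d; rewrite !tk_sum0.
rewrite (@gam_gam_neg0 m a x y A X Y (or_intror x0)) //; last by rewrite /m; lia.
rewrite (@gam_gam_neg0 m a y x A Y X (or_intror y0)) //; last by rewrite /m; lia.
have T0 z Z : z < 0 -> homog z Z -> Ta 0 A Z = br A Z.
  move=> z0 hZ; rewrite (tauE sfun q hA hZ (m := a + z)) ?addr0 //.
  by have [_] := gam_lead tr gt abb sfun q hA hZ (or_intror z0).
have KT0 e W z Z : z < 0 -> homog z Z -> homog e W ->
    K 0 (neg W) Z + Ta 0 (pos W) Z = br W Z.
  move=> z0 hZ hW; rewrite (kappa_tauE sfun q hW hZ (m := e + z)) ?addr0 //.
  by have [_] := gam_lead tr gt abb sfun q hW hZ (or_intror z0).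
have H1 := KT0 _ _ _ _ y0 hY (homog_br hA hX).
have H2 := KT0 _ _ _ _ x0 hX (homog_br hA hY).
have xy0 : x + y < 0 by lia.
rewrite (kappa0 x0 y0 hX hY) (pos_homog (homog_br hX hY)) leNgt xy0 /= br0l.
rewrite {1}/sigma (hpart0l hA); last first.
  by apply: bilinear_comp; [exact: gam_bilin|exact: pos_linear..].
rewrite (T0 _ _ x0 hX) (T0 _ _ y0 hY) (T0 _ _ xy0 (homog_br hX hY)) => H.
have := br_jacobi A X Y.
rewrite (brC X (br Y A)) (brC Y A) brNl opprK (brC Y (br A X)) (brC X (br A Y)) => J.
additive; have := congr1 lam H; have := congr1 lam J; have := congr1 lam H1.
by have := congr1 lam H2; rewrite !lD !lN ?lD ?lN ?l0; lra.
Qed.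

Definition st_sum d a A B X := \sum_(d2 <- irange 0 (d + a)) (let d1 := d - d2 in
  S d1 A (pos (Ta d2 B X)) + Ta d1 A (neg (Ta d2 B X))).

(** No end of the range is singled out here: sigma and tau on the two halves of tau(B, X) make up
    all of gamma(A, gamma(B, X)), and exchanging the arguments gives the sign. *)
Lemma st_sumE d m a b x A B X : 0 <= a -> 0 <= b -> x < 0 ->
  homog a A -> homog b B -> homog x X -> a + b + x + d = m ->
  st_sum d a A B X = - comp m (G (G B X) A).
Proof.
move=> a0 b0 x0 hA hB hX E.
rewrite (@gam_gam_irange1 d m b x a B X A (or_intror x0) a0 hB hX hA); last by lia.
rewrite -sumrN /st_sum; apply: eq_bigr => d2 _ /=.
rewrite (tauE sfun q hB hX (m := b + x + d2)) //.
rewrite (sigma_tauE sfun q hA (homog_comp _ _) (m := m)) //; last by lia.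
by rewrite (gamC sfun) compN.
Qed.

(** The index e1 is the degree of the outer tau. Since gamma(A, B) starts in degree max(a, b), e1 is
    at most d + min(a, b); since x < 0, e1 >= 0, and e1 = 0 gives the bracket. If d + min(a, b) < 0
    the range is empty and that bracket vanishes. *)
Lemma gam_gam_sigma_neg d m a b x A B X : 0 <= a -> 0 <= b -> x < 0 ->
  homog a A -> homog b B -> homog x X -> a + b + x + d = m ->
  comp m (G (G A B) X) = br (S d A B) X
    - \sum_(e1 <- irange 1 (d + Num.min a b)) (let e2 := d - e1 in Ta e1 X (S e2 A B)).
Proof.
move=> a0 b0 x0 hA hB hX E.
have SE e : S e A B = comp (a + b + e) (G A B).
  exact: (sigmaE sfun q hA hB).
rewrite (gam_gam_irange tr gt abb sfun (w := x) (s := fun e1 => a + b + (d - e1))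
  (a := 0) (b := d + Num.min a b)) //.
- have F0 : comp m (G (comp (a + b + (d - 0)) (G A B)) X) = br (S d A B) X.
    rewrite subr0 SE.
    have [_ <-] := gam_lead tr gt abb sfun q (homog_comp (a + b + d) (G A B)) hX (or_intror x0).
    by congr comp; lia.
  rewrite irange_recl F0.
    congr (_ + _); rewrite add0r -sumrN !big_seq; apply: eq_bigr => e1.
    rewrite mem_irange => H /=; rewrite SE.
    rewrite (tauCE sfun q hX (homog_comp _ _) (m := m)) //; [|lia..].
    by rewrite (gamC sfun q X) compN opprK.
  have [dm|dm] := leP 0 (d + Num.min a b); [by left|right].
  by rewrite SE (gam_pos tr gt abb sfun q hA hB) ?br0l //; lia.
- by move=> i j; lia.
move=> e He; have [elow|elow] := ltP e (Num.max a b).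
  by rewrite (gam_pos tr gt abb sfun q hA hB) // (gam0l sfun) comp0.
have me : a + b + d < e.
  rewrite ltNge; apply/negP => em; move: (He (a + b + d - e)) => /=; lia.
have [low2 _] := gam_lead tr gt abb sfun q (homog_comp e (G A B)) hX (or_intror x0).
by apply: low2; lia.
Qed.

Lemma structure_equation3 a b x A B X d :
  0 <= a -> 0 <= b -> x < 0 -> homog a A -> homog b B -> homog x X ->
  br (S d A B) X =
  skewsum (fun a A b B => st_sum d a A B X) a A b B
  + \sum_(e1 <- irange 1 (d + Num.min a b)) (let e2 := d - e1 in Ta e1 X (S e2 A B))
  + Dv X (fun w => sigma gam (d + x) w A B) q
  + skewsum (fun a A b B => Dv A (fun w => tau gam (d + a) w B X) q) a A b B.
Proof.
move=> a0 b0 x0 hA hB hX.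
pose m := a + b + x + d.
have EX : comp m (DG X A B) = Dv X (fun w => sigma gam (d + x) w A B) q.
  apply/esym/(dgam_comp tr gt sfun) => w; apply: (sigmaE sfun w hA hB) => //; rewrite /m; lia.
have EA : comp m (DG A B X) = Dv A (fun w => tau gam (d + a) w B X) q.
  apply/esym/(dgam_comp tr gt sfun) => w; apply: (tauE sfun w hB hX) => //; rewrite /m; lia.
have EB : comp m (DG B A X) = Dv B (fun w => tau gam (d + b) w A X) q.
  apply/esym/(dgam_comp tr gt sfun) => w; apply: (tauE sfun w hA hX) => //; rewrite /m; lia.
have := bianchi_comp tr gt sfun q A B X m.
rewrite (gamC sfun q X A) (gamNl sfun) (dgamC tr gt sfun q B X A) !compN EX EA EB.
rewrite (@gam_gam_sigma_neg d m a b x) // /skewsum.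
rewrite (@st_sumE d m a b x) // (@st_sumE d m b a x) //; last by rewrite /m; lia.
move=> H; additive; have := congr1 lam H; rewrite !lD !lN ?lD ?lN ?l0; lra.
Qed.

(** The inner gamma starts in degree max(a, b), which is d2 = -min(a, b); the outer one never goes
    below the degree of its first argument, which is d2 <= d + c. *)
Lemma structure_equation4 a b c A B C d :
  0 <= a -> 0 <= b -> 0 <= c -> homog a A -> homog b B -> homog c C ->
  cycsum (fun a A b B c C =>
    \sum_(d2 <- irange (- Num.min a b) (d + c)) (let d1 := d - d2 in S d1 (S d2 A B) C)
    - Dv C (fun w => sigma gam (d + c) w A B) q) a A b B c C = 0.
Proof.
have SS a1 b1 c1 A1 B1 C1 m : 0 <= a1 -> 0 <= b1 -> 0 <= c1 ->
    homog a1 A1 -> homog b1 B1 -> homog c1 C1 -> a1 + b1 + c1 + d = m ->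
    comp m (G (G A1 B1) C1) - comp m (DG C1 A1 B1) =
    \sum_(d2 <- irange (- Num.min a1 b1) (d + c1)) (let d1 := d - d2 in S d1 (S d2 A1 B1) C1)
    - Dv C1 (fun w => sigma gam (d + c1) w A1 B1) q.
  move=> a0 b0 c0 hA hB hC E; congr (_ - _); last first.
    apply/esym/(dgam_comp tr gt sfun) => w; apply: (sigmaE sfun w hA hB) => //; lia.
  rewrite (gam_gam_irange tr gt abb sfun (w := c1) (s := fun d2 => a1 + b1 + d2)
    (a := - Num.min a1 b1) (b := d + c1)) //.
  - rewrite !big_seq; apply: eq_bigr => d2; rewrite mem_irange => H /=.
    rewrite (sigmaE sfun q hA hB (m := a1 + b1 + d2)) //.
    by rewrite (sigmaE sfun q (homog_comp _ _) hC (m := m)) //; lia.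
  move=> e He; have [elow|elow] := ltP e (Num.max a1 b1).
    by rewrite (gam_pos tr gt abb sfun q hA hB) // (gam0l sfun) comp0.
  have me : m < e.
    rewrite ltNge; apply/negP => em; move: (He (e - (a1 + b1))) => /=; lia.
  by apply: (gam_low tr gt abb sfun q (homog_comp e (G A1 B1)) hC); lia.
move=> a0 b0 c0 hA hB hC; rewrite /cycsum.
rewrite -(SS a b c A B C (a + b + c + d)) // -(SS b c a B C A (a + b + c + d)) //; last by lia.
rewrite -(SS c a b C A B (a + b + c + d)) //; last by lia.
exact: (bianchi_comp tr gt sfun).
Qed.

End StructureEquations.

Theorem theorem4p1 (R : realType) (g : gradedLie R) (k0 : int) (T : towerData g)
    (W1 : int -> set (g -> g)) (W2 : int -> set (g -> g -> g))
    (gam : limQ T -> g -> g -> g) :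
  -1 <= k0 ->
  transitive_gl g -> is_prolongation g k0 ->
  geometric_tower T -> proper_structure T k0 ->
  normal_complements k0 W1 W2 -> normal_step_prolongation T k0 W1 W2 ->
  structure_function gam ->
  forall q : limQ T,
  let K := fun d => kappa gam d q in
  let Ta := fun d => tau gam d q in
  let S := fun d => sigma gam d q in
  [/\ forall (x y z : int) (X Y Z : g) (k : int),
        x < 0 -> y < 0 -> z < 0 -> homog x X -> homog y Y -> homog z Z -> 0 <= k ->
        cobd2 (K k) X Y Z =
        cycsum (fun x X y Y z Z =>
            \sum_(d2 <- irange 1 (k - 1)) (let d1 := k - d2 in
               K d1 (neg (K d2 X Y)) Z + Ta d1 (pos (K d2 X Y)) Z)
            - Dv X (fun w => kappa gam (k + x) w Y Z) q)
          x X y Y z Z,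
      forall (x y a : int) (X Y A : g) (d : int),
        x < 0 -> y < 0 -> 0 <= a -> homog x X -> homog y Y -> homog a A -> 0 <= d ->
        cobd1 (Ta d A) X Y =
        (Dv A (fun w => kappa gam (d + a) w X Y) q + rho_kappa gam A d q X Y)
        - skewsum (fun x X y Y => Ta d (pos (br A X)) Y) x X y Y
        + br (pos (K d X Y)) A - S 0 (pos (K d X Y)) A
        - \sum_(e2 <- irange 1 (d + a) |
                  let e1 := d - e2 in [&& - a <= e1, e1 < d & e1 != 0])
            (let e1 := d - e2 in
             Ta e1 (neg (K e2 X Y)) A + S e1 (pos (K e2 X Y)) A)
        - skewsum (fun x X y Y =>
            \sum_(d2 <- irange 1 (d - 1)) (let d1 := d - d2 in
               K d1 (neg (Ta d2 A X)) Y + Ta d1 (pos (Ta d2 A X)) Y))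
            x X y Y
        + skewsum (fun x X y Y => Dv Y (fun w => tau gam (d + y) w A X) q) x X y Y,
      forall (a b x : int) (A B X : g) (d : int),
        0 <= a -> 0 <= b -> x < 0 -> homog a A -> homog b B -> homog x X ->
        br (S d A B) X =
        skewsum (fun a A b B =>
            \sum_(d2 <- irange 0 (d + a)) (let d1 := d - d2 in
               S d1 A (pos (Ta d2 B X)) + Ta d1 A (neg (Ta d2 B X))))
          a A b B
        + \sum_(e1 <- irange 1 (d + Num.min a b)) (let e2 := d - e1 in
             Ta e1 X (S e2 A B))
        + Dv X (fun w => sigma gam (d + x) w A B) q
        + skewsum (fun a A b B => Dv A (fun w => tau gam (d + a) w B X) q) a A b B
    & forall (a b c : int) (A B C : g) (d : int),
        0 <= a -> 0 <= b -> 0 <= c -> homog a A -> homog b B -> homog c C ->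
        cycsum (fun a A b B c C =>
            \sum_(d2 <- irange (- Num.min a b) (d + c)) (let d1 := d - d2 in
               S d1 (S d2 A B) C)
            - Dv C (fun w => sigma gam (d + c) w A B) q)
          a A b B c C = 0].
Proof.
move=> _ tr _ gt prop _ nsp sfun q K Ta S.
have abb n : acts_by_bracket T n.
  by have [nk|kn] := leP n%:Z k0; [exact: prop|exact: (nsp n kn).1].
split.
- by move=> x y z X Y Z k; exact: structure_equation1.
- by move=> x y a X Y A d; exact: structure_equation2.
- by move=> a b x A B X d; exact: structure_equation3.
- by move=> a b c A B C d; exact: structure_equation4.
Qed.
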